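(* Let $K$ be a global function field of odd characteristic with full field of constants $\mathbb{F}_q$, and let $X$ be its set of places. Consider the following procedure. 1. Find divisors $\mathcal{D}_1,\dots,\mathcal{D}_n$ whose classes generate $\operatorname{Pic}X$. 2. Find a set of indices $J\subset\{1,\dots,n\}$ such that $\{[\mathcal{D}_j]+2\operatorname{Pic}X : j\in J\}$ generates $\operatorname{Pic}X/2\operatorname{Pic}X$. 3. For every $j\in J$ let $\{\mathfrak{p}_{j,1},\dots,\mathfrak{p}_{j,k_j}\}$ be the support of $\mathcal{D}_j$. 4. Find a maximal subset $\mathfrak{B}$ of $\{\mathfrak{p}_{j,i} : j\in J,\ i\le k_j\}$ that is linearly independent in $\operatorname{Pic}X/2\operatorname{Pic}X$. 5. Apply to $\mathfrak{B}$ the subroutine described in the context, which constructs a set $\mathscr{B}$ compatible with $\mathfrak{B}$. 6. Output $\mathscr{B}$. Then the procedure is correct: the output $\mathscr{B}$ is a basis over $\mathbb{F}_2$ of the group $\mathbb{E}$ of singular elements of $K$ modulo squares.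
   Context: $K$ is a global function field of odd characteristic with full constant field $\mathbb{F}_q$ ($q$ a power of an odd prime). $X$ is the set of places of $K$, viewed as a smooth complete curve over $\mathbb{F}_q$. For $\mathfrak{p}\in X$, $\operatorname{ord}_\mathfrak{p}$ is the normalized valuation and $K_\mathfrak{p}$ the completion. $\operatorname{Pic}X$ is the group of divisor classes, $\operatorname{Pic}^0X$ its subgroup of classes of degree $0$, $[\mathcal{D}]$ the class of the divisor $\mathcal{D}$. The Riemann--Roch space is $\mathcal{L}(\mathcal{D})=\{\lambda\in K^\times : \operatorname{div}_X\lambda\ge-\mathcal{D}\}\cup\{0\}$. The group of singular elements modulo squares is $\mathbb{E}=\{\lambda\in K^\times/K^{\times2} : \operatorname{ord}_\mathfrak{p}\lambda\equiv0\pmod 2\text{ for all }\mathfrak{p}\in X\}$; elements of $K^\times$ are identified with their square classes where appropriate. For $\lambda\in K^\times$ (or its square class), $\left(\frac{\lambda}{\mathfrak{p}}\right)$ equals $1$ if $\lambda$ is a square in $K_\mathfrak{p}$, $0$ if $\operatorname{ord}_\mathfrak{p}\lambda$ is odd, and $-1$ if $\operatorname{ord}_\mathfrak{p}\lambda$ is even but $\lambda$ is not a square in $K_\mathfrak{p}$. Places are said to be linearly independent (to form a basis) in $\operatorname{Pic}X/2\operatorname{Pic}X$ if the cosets of their classes modulo $2\operatorname{Pic}X$ are linearly independent over $\mathbb{F}_2$ (form a basis). Sets $\{\mathfrak{b}_1,\dots,\mathfrak{b}_n\}\subset X$ and $\{\beta_1,\dots,\beta_n\}\subset\mathbb{E}$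 are compatible if $\left(\frac{\beta_i}{\mathfrak{b}_i}\right)=-1$ for all $i$ and $\left(\frac{\beta_i}{\mathfrak{b}_j}\right)=1$ for all $i\ne j$. Subroutine (input: a set $\mathfrak{B}=\{\mathfrak{b}_1,\dots,\mathfrak{b}_r\}$ of places forming a basis of $\operatorname{Pic}X/2\operatorname{Pic}X$): start with $\mathscr{A}=\{\zeta\}$, $\zeta\in\mathbb{F}_q^\times$ a non-square; write $\operatorname{Pic}^0X=\langle[\mathcal{C}_1]\rangle\oplus\dots\oplus\langle[\mathcal{C}_m]\rangle$ in Smith Normal Form (a direct sum of cyclic groups, the order of each summand dividing the orders of its successors); for each $i$ such that $[\mathcal{C}_i]$ has even order $d_i$, append to $\mathscr{A}$ a nonzero element of $\mathcal{L}(d_i\mathcal{C}_i)$; write $\mathscr{A}=\{\alpha_1,\dots,\alpha_r\}$, define $\varepsilon_{i,j}\in\mathbb{F}_2$ by $(-1)^{\varepsilon_{i,j}}=\left(\frac{\alpha_i}{\mathfrak{b}_j}\right)$, let $(e_{i,j})$ be the inverse matrix of $(\varepsilon_{i,j})$ over $\mathbb{F}_2$, and return $\mathscr{B}=\{\beta_1,\dots,\beta_r\}$ with $\beta_i=\alpha_1^{e_{i,1}}\cdots\alpha_r^{e_{i,r}}$. *)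

(* Defs.v *)
From HB Require Import structures.
From mathcomp Require Import all_boot all_order all_algebra all_field.
From mathcomp Require Import boolp classical_sets functions.
From mathcomp Require Import generic_quotient ring_quotient.
From mathcomp Require Import freeg.

Set Implicit Arguments.
Unset Strict Implicit.
Unset Printing Implicit Defensive.

Import Order.TTheory GRing.Theory Num.Theory.

Local Open Scope ring_scope.
Local Open Scope quotient_scope.

(** * Quotients of abelian groups and linear algebra over F_2 *)

Definition doubled (V : zmodType) : {pred V} := fun x => `[< exists y : V, x = y *+ 2 >].

Lemma doubled_zmod_closed (V : zmodType) : zmod_closed (@doubled V).
Proof.
split; first by apply/asboolP; exists 0; rewrite mul0rn.
move=> x y /asboolP[a ->] /asboolP[b ->].
by apply/asboolP; exists (a - b); rewrite mulrnBl.
Qed.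

HB.instance Definition _ (V : zmodType) :=
  GRing.isZmodClosed.Build V (@doubled V) (@doubled_zmod_closed V).

(* V / 2V *)
Definition mod2 (V : zmodType) : zmodType := Quotient.quot (@doubled V).

Definition generates (V : zmodType) n (J : {set 'I_n}) (v : 'I_n -> V) :=
  forall x : V, exists m : 'I_n -> int, x = \sum_(i in J) v i *~ m i.

(* [c] splits the subgroup [S] as the direct sum of the cyclic groups <c i>. *)
Definition cyclic_direct_sum (V : zmodType) (S : set V) m (c : 'I_m -> V) :=
  [/\ forall i, S (c i),
      forall x, S x -> exists k : 'I_m -> int, x = \sum_i c i *~ k i &
      forall k : 'I_m -> int, \sum_i c i *~ k i = 0 -> forall i, c i *~ k i = 0].

Definition has_order (V : zmodType) (x : V) (n : nat) :=
  (0 < n)%N /\ forall k : nat, x *+ k = 0 <-> (n %| k)%N.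

(* The following two are meant for groups of exponent 2, where the action of
   the representatives 0 and 1 of 'F_2 is the F_2-vector space structure. *)
Definition F2_independent (V : zmodType) (s : seq V) :=
  forall e : 'I_(size s) -> 'F_2,
    \sum_(i < size s) s`_i *+ e i = 0 -> forall i, e i = 0.

Definition F2_basis (V : zmodType) (s : seq V) :=
  F2_independent s /\
  forall x : V, exists e : 'I_(size s) -> 'F_2, x = \sum_(i < size s) s`_i *+ e i.

(** * Places *)

Section Places.
Variable K : fieldType.
Implicit Types (x y : K).

(* Only the values of [v] on nonzero elements are meaningful; [v 0] is set to 0
   so that a place is determined by its valuation.  When the field of constants
   is finite, triviality on the constants is automatic. *)
Definition normalized_valuation (v : K -> int) : Prop :=
  [/\ v 0 = 0,
      forall x y, x != 0 -> y != 0 -> v (x * y) = v x + v y,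
      forall x y, x != 0 -> y != 0 -> x + y != 0 ->
        Num.min (v x) (v y) <= v (x + y) &
      exists2 x, x != 0 & v x = 1].

Record place := Place {
  ord :> K -> int;
  _ : `[< normalized_valuation ord >] }.

HB.instance Definition _ := [isSub for ord].
HB.instance Definition _ := [Choice of place by <:].

(* ord_p x >= N, with ord_p 0 = +oo *)
Definition ord_ge (p : place) (N : int) (x : K) : bool :=
  (x == 0) || (N <= ord p x).

Lemma placeP (p : place) : normalized_valuation (ord p).
Proof. by case: p => v /= /asboolP. Qed.

Lemma ord1 (p : place) : ord p 1 = 0.
Proof.
have [_ M _ _] := placeP p.
have := M 1 1 (oner_neq0 _) (oner_neq0 _); rewrite mulr1 => h.
by apply: (addrI (ord p 1)); rewrite -h addr0.
Qed.

Lemma ordV (p : place) x : x != 0 -> ord p x^-1 = - ord p x.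
Proof.
move=> x0; have [_ M _ _] := placeP p.
apply/eqP; rewrite -subr_eq0 opprK addrC -M ?invr_eq0 // mulfV //.
by rewrite ord1.
Qed.

Lemma ordN1 (p : place) : ord p (-1) = 0.
Proof.
have [_ M _ _] := placeP p.
have n0 : -1 != 0 :> K by rewrite oppr_eq0 oner_neq0.
have := M (-1) (-1) n0 n0; rewrite mulrNN mulr1 ord1 => /esym/eqP.
by rewrite -mulr2n mulrn_eq0 /= => /eqP.
Qed.

Lemma ord_geN (p : place) N x : ord_ge p N (- x) = ord_ge p N x.
Proof.
rewrite /ord_ge oppr_eq0; case: eqP => //= /eqP x0.
have [_ M _ _] := placeP p.
by rewrite -mulN1r M ?oppr_eq0 ?oner_neq0 // ordN1 add0r.
Qed.

Lemma ord_geD (p : place) N x y :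
  ord_ge p N x -> ord_ge p N y -> ord_ge p N (x + y).
Proof.
rewrite /ord_ge; have [->|x0] := eqVneq x 0; first by rewrite add0r.
have [->|y0] := eqVneq y 0; first by rewrite addr0 (negPf x0).
have [//|xy0] := eqVneq (x + y) 0.
move=> /= hx hy; have [_ _ M _] := placeP p.
by apply: le_trans (M x y x0 y0 xy0); rewrite le_min hx.
Qed.

Lemma ord_geB (p : place) N x y :
  ord_ge p N x -> ord_ge p N y -> ord_ge p N (x - y).
Proof. by move=> hx hy; apply: ord_geD => //; rewrite ord_geN. Qed.

Lemma ord_geM (p : place) M N x y :
  ord_ge p M x -> ord_ge p N y -> ord_ge p (M + N) (x * y).
Proof.
rewrite /ord_ge mulf_eq0; have [//|x0] := eqVneq x 0.
have [//|y0] := eqVneq y 0.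
by move=> /= hx hy; have [_ E _ _] := placeP p; rewrite E // lerD.
Qed.

Lemma ord_geW (p : place) M N x : M <= N -> ord_ge p N x -> ord_ge p M x.
Proof.
by move=> MN; rewrite /ord_ge; case: eqP => //= _; apply: le_trans.
Qed.

(** * Completions *)

Definition cauchy (p : place) : {pred nat -> K} := fun u =>
  `[< forall N : int, exists n0 : nat, forall m n : nat,
        (n0 <= m)%N -> (n0 <= n)%N -> ord_ge p N (u m - u n) >].

Lemma cauchy_bounded p u : u \in cauchy p ->
  exists N : int, exists n0 : nat, forall n, (n0 <= n)%N -> ord_ge p N (u n).
Proof.
move=> /asboolP /(_ 0)[n0 h]; exists (Num.min 0 (ord p (u n0))); exists n0.
move=> n hn; rewrite -[u n](subrK (u n0)); apply: ord_geD.
  by apply: ord_geW (h n n0 hn (leqnn _)); rewrite ge_min lexx.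
by rewrite /ord_ge; apply/orP; right; rewrite ge_min lexx orbT.
Qed.

Lemma cauchy_subring_closed p : subring_closed (cauchy p).
Proof.
split.
- apply/asboolP => N; exists 0%N => m n _ _.
  by rewrite /= subrr /ord_ge eqxx.
- move=> u v /asboolP hu /asboolP hv; apply/asboolP => N.
  have [a ha] := hu N; have [b hb] := hv N; exists (maxn a b) => m n.
  rewrite !geq_max => /andP[am bm] /andP[an bn].
  have -> : (u - v) m - (u - v) n = (u m - u n) - (v m - v n).
    by rewrite -[(u - v) m]/(u m - v m) -[(u - v) n]/(u n - v n)
      !opprB [v n - u n]addrC addrACA [- v m + v n]addrC.
  by apply: ord_geB; [apply: ha | apply: hb].
- move=> u v hu hv; apply/asboolP => N.
  have [A [a0 hA]] := cauchy_bounded hu; have [B [b0 hB]] := cauchy_bounded hv.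
  move: hu hv => /asboolP/(_ (N - B))[a1 ha] /asboolP/(_ (N - A))[b1 hb].
  exists (maxn (maxn a0 b0) (maxn a1 b1)) => m n; rewrite !geq_max.
  move=> /andP[/andP[m1 m2] /andP[m3 m4]] /andP[/andP[n1 n2] /andP[n3 n4]].
  have -> : (u * v) m - (u * v) n = (u m - u n) * v m + u n * (v m - v n).
    by rewrite -[(u * v) m]/(u m * v m) -[(u * v) n]/(u n * v n) mulrBl mulrBr addrA subrK.
  apply: ord_geD.
    by rewrite -[N](subrK B); apply: ord_geM; [apply: ha | apply: hB].
  by rewrite -[N](subrKC A); apply: ord_geM; [apply: hA | apply: hb].
Qed.

HB.instance Definition _ p :=
  GRing.isSubringClosed.Build (nat -> K) (cauchy p) (cauchy_subring_closed p).

Record cauchy_seq (p : place) := CauchySeq {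
  cseq :> nat -> K;
  _ : cauchy p cseq }.

HB.instance Definition _ p := [isSub for @cseq p].
HB.instance Definition _ p := [Choice of cauchy_seq p by <:].
HB.instance Definition _ p :=
  [SubChoice_isSubComNzRing of cauchy_seq p by <:].

Definition null_seq (p : place) : {pred cauchy_seq p} := fun u =>
  `[< forall N : int, exists n0 : nat, forall n, (n0 <= n)%N ->
        ord_ge p N (u n) >].

Lemma null_seq_idealr_closed p : idealr_closed (@null_seq p).
Proof.
split.
- by apply/asboolP => N; exists 0%N => n _; rewrite /ord_ge eqxx.
- apply/asboolP => /(_ 1)[n0 /(_ n0 (leqnn _))].
  by rewrite /ord_ge -[(_ : cauchy_seq p) n0]/(1 : K) oner_eq0 /= ord1.
- move=> a u v /asboolP hu /asboolP hv; apply/asboolP => N.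
  have [A [a0 hA]] := cauchy_bounded (valP a).
  have [n1 h1] := hu (N - A); have [n2 h2] := hv N.
  exists (maxn a0 (maxn n1 n2)) => n; rewrite !geq_max => /and3P[k0 k1 k2].
  rewrite -[(_ : cauchy_seq p) n]/(a n * u n + v n); apply: ord_geD.
    by rewrite -[N](subrKC A); apply: ord_geM; [apply: hA | apply: h1].
  exact: h2.
Qed.

HB.instance Definition _ p :=
  isIdealr.Build (cauchy_seq p) (@null_seq p) (null_seq_idealr_closed p).

(* K_p: Cauchy sequences modulo null sequences *)
Definition completion (p : place) : comNzRingType :=
  {ideal_quot (@null_seq p)}.

Lemma cauchy_cst p x : cauchy p (fun=> x).
Proof. by apply/asboolP => N; exists 0%N => m n _ _; rewrite subrr /ord_ge eqxx. Qed.

Definition to_completion (p : place) (x : K) : completion p :=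
  \pi_(completion p) (CauchySeq (cauchy_cst p x)).

Definition is_local_square (p : place) (x : K) : Prop :=
  exists y : completion p, y ^+ 2 = to_completion p x.

(* The symbol (x / p), for x != 0 *)
Definition symbol (x : K) (p : place) : int :=
  if `[< is_local_square p x >] then 1
  else if odd `|ord p x|%N then 0 else -1.

(** * Divisors and the Picard group *)

Definition divisor := {freeg place / int}.

Definition is_div (D : divisor) (x : K) := forall p, coeff p D = ord p x.

Definition principal : {pred divisor} :=
  fun D => `[< exists2 x : K, x != 0 & is_div D x >].

Lemma principal_zmod_closed : zmod_closed principal.
Proof.
split.
  by apply/asboolP; exists 1; rewrite ?oner_neq0 // => p; rewrite coeff0 ord1.
move=> D E /asboolP[x x0 hx] /asboolP[y y0 hy]; apply/asboolP.
exists (x / y); first by rewrite mulf_neq0 ?invr_eq0.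
move=> p; have [_ M _ _] := placeP p.
by rewrite coeffB hx hy M ?invr_eq0 // ordV.
Qed.

HB.instance Definition _ :=
  GRing.isZmodClosed.Build divisor principal principal_zmod_closed.

Definition Pic : zmodType := Quotient.quot principal.

Definition pic_class (D : divisor) : Pic := \pi_Pic D.

Definition pic2_class (D : divisor) : mod2 Pic :=
  \pi_(mod2 Pic) (pic_class D).

Definition place_pic2_class (p : place) : mod2 Pic := pic2_class << p >>.

(* An F_2-independent list of classes has no repetition, so lists of places
   satisfying these predicates are enumerations of sets. *)
Definition independent_places (b : seq place) : Prop :=
  F2_independent [seq place_pic2_class p | p <- b].

Definition basis_places (b : seq place) : Prop :=
  F2_basis [seq place_pic2_class p | p <- b].

Definition maximal_independent_places (S b : seq place) : Prop :=
  [/\ {subset b <= S}, independent_places b &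
      forall b' : seq place, {subset b <= b'} -> {subset b' <= S} ->
        independent_places b' -> {subset b' <= b}].

Definition supports n (D : 'I_n -> divisor) (J : {set 'I_n}) : seq place :=
  flatten [seq dom (D j) | j <- enum J].

Definition riemann_roch_space (D : divisor) : set K :=
  [set x | x = 0 \/ x != 0 /\ forall p, - coeff p D <= ord p x].

(** * Singular elements *)

Definition singular (x : K) : Prop :=
  x != 0 /\ forall p : place, ~~ odd `|ord p x|%N.

Definition same_square_class (x y : K) : Prop :=
  exists2 z, z != 0 & x = y * z ^+ 2.

(* The square classes of the entries of s form an F_2-basis of the group E of
   singular elements modulo squares, written multiplicatively. *)
Definition singular_basis (s : seq K) : Prop :=
  [/\ forall i, (i < size s)%N -> singular s`_i,
      forall e : 'I_(size s) -> 'F_2,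
        same_square_class (\prod_(i < size s) s`_i ^+ e i) 1 -> forall i, e i = 0 &
      forall x, singular x -> exists e : 'I_(size s) -> 'F_2,
        same_square_class x (\prod_(i < size s) s`_i ^+ e i)].

Definition compatible r (b : r.-tuple place) (beta : r.-tuple K) : Prop :=
  (forall i : 'I_r, symbol (tnth beta i) (tnth b i) = -1) /\
  (forall i j : 'I_r, i != j -> symbol (tnth beta i) (tnth b j) = 1).

(* The matrix over F_2 with (-1) ^ (entry i j) = (alpha_i / b_j), all symbols
   being 1 or -1. *)
Definition symbol_matrix r (alpha : seq K) (b : r.-tuple place) : 'M['F_2]_r :=
  \matrix_(i, j) (symbol alpha`_i (tnth b j) == -1)%:R.

Definition dual_family r (alpha : seq K) (b : r.-tuple place) : r.-tuple K :=
  [tuple \prod_(k < r) alpha`_k ^+ (invmx (symbol_matrix alpha b)) i k | i < r].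

End Places.

(** * Function fields *)

Section FunctionField.
(* A finite extension of F(t); every global function field with constants
   containing F is of this form, for some choice of t. *)
Variables (F : finFieldType) (K : fieldExtType {fraction {poly F}}).

Definition constK (c : F) : K := (tofrac c%:P)%:A.

Definition full_constant_field : Prop :=
  forall x : K, algebraicOver constK x -> exists c : F, x = constK c.

(* The residue classes of the [w i] form a basis over F of the residue field
   {x | ord_p x >= 0} / {x | ord_p x >= 1}. *)
Definition residue_basis (p : place K) d (w : 'I_d -> K) : Prop :=
  (forall i, ord_ge p 0 (w i)) /\
  forall x, ord_ge p 0 x -> exists! c : 'rV[F]_d,
    ord_ge p 1 (x - \sum_i constK (c 0 i) * w i).

Definition place_deg (p : place K) : nat :=
  xget 0%N [set d : nat | exists w : 'I_d -> K, residue_basis p w]%classic.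

Definition div_deg (D : divisor K) : int :=
  \sum_(p <- dom D) coeff p D * (place_deg p)%:Z.

Definition Pic0 : set (Pic K) :=
  [set c | exists2 D, div_deg D = 0 & pic_class D = c]%classic.

(* Pic^0 as the direct sum of the groups generated by the classes [C i], of
   orders [d i], in Smith normal form. *)
Definition Pic0_smith m (C : 'I_m -> divisor K) (d : 'I_m -> nat) : Prop :=
  [/\ cyclic_direct_sum Pic0 (fun i => pic_class (C i)),
      forall i, has_order (pic_class (C i)) (d i) &
      forall i j : 'I_m, (i < j)%N -> (d i %| d j)%N].

Definition even_family (zeta : F) m (d : 'I_m -> nat) (a : 'I_m -> K) : seq K :=
  constK zeta :: [seq a i | i <- enum 'I_m & ~~ odd (d i)].

End FunctionField.

(* Main.v *)
(* Proof idea.  The crucial point is that a singular [lam] which is a square at places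
   generating [Pic X / 2 Pic X] is a square.  Otherwise [L = K(sqrt lam)] is an unramified
   quadratic extension of [K] (possibly a constant one) whose norm [Pic L -> Pic K] is onto.
   The group [Pic^0 L] is finite by Riemann's inequality, so counting orders as for a Herbrand
   quotient shows that a divisor class of [L] of minimal positive degree can be made invariant
   under conjugation.  By Hilbert 90 the invariant classes come from [K] and have even degree,
   up to one class of degree zero when constants of [K] fail to be norms of constants, which
   is compensated by the class of [div lam / 2] becoming principal in [L].
   Hence the symbol matrix of independent singular elements has independent rows.  The
   elements alpha are independent because their divisors are the relations of [Pic^0 X],
   and their number is the rank of [Pic X / 2 Pic X] because [Pic X / Pic^0 X] is cyclic.
   The product formula is deduced from the given cyclic decomposition of [Pic^0 X] into finite
   groups: a function of nonzero degree would make a multiple of some place principal. *)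
Require Import Defs.
From HB Require Import structures.
From mathcomp Require Import all_boot all_order all_algebra all_field.
From mathcomp Require Import boolp classical_sets functions.
From mathcomp Require Import generic_quotient ring_quotient.
From mathcomp Require Import freeg.
From mathcomp Require Import zify ring.

Set Implicit Arguments.
Unset Strict Implicit.
Unset Printing Implicit Defensive.

Import Order.TTheory GRing.Theory Num.Theory.
Local Open Scope ring_scope.
Local Open Scope quotient_scope.

(** * Counting residue classes *)

Section Bound.
Variables (F : finFieldType) (K : fieldExtType {fraction {poly F}}).
Local Notation E := {fraction {poly F}}.
Local Notation N := (\dim {:K}).
Local Notation bK := (vbasis {:K}).
Local Notation "p %:F" := (tofrac p).

(** The existence of places, the finiteness of supports, the residue degrees and the bound on the
    poles of [t] all rest on one estimate for pairwise incongruent elements,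
    [incongruent_bound_aux]. As the constants are finite, dimensions are replaced throughout by
    cardinalities: [card_le] bounds a space and [covers] an index. The delicate point of the class
    group argument is the number of invariant classes. If the class of $D$ is invariant, then
    $\sigma D - D = div f$ with $N f$ a constant $c$, and $D$ descends to $K$ once $c$ is also the
    norm of an element of trivial divisor. When [lam] is a constant times a square, binary forms
    over a finite field represent every constant and all invariants descend. Otherwise the norms
    used are the squares of constants, of index 2, and this factor 2 is what capitulation pays for.
    Evenness of the orders of [lam] enters through the divisor $H = div lam / 2$: a root of [lam]
    has order $H$ at every place above $p$, so $L(D) + L(D + H) \sqrt{lam}$ is a subspace upstairs
    large enough for Riemann's inequality. *)

Definition bounded_coords (D : nat) (x : K) : Prop :=
  exists P : 'I_N -> {poly F},
    (forall j, (size (P j) <= D)%N) /\ x = \sum_j (P j)%:F *: bK`_j.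

Lemma bounded_coordsD D x y :
  bounded_coords D x -> bounded_coords D y -> bounded_coords D (x + y).
Proof.
move=> [P [sP ->]] [Q [sQ ->]]; exists (fun j => P j + Q j); split.
  by move=> j; rewrite (leq_trans (size_polyD _ _)) // geq_max sP sQ.
by rewrite -big_split; apply: eq_bigr => j _; rewrite /= rmorphD scalerDl.
Qed.

Lemma bounded_coords0 D : bounded_coords D 0.
Proof.
exists (fun=> 0); split=> [j|]; first by rewrite size_poly0.
by rewrite big1 // => j _; rewrite rmorph0 scale0r.
Qed.

Lemma bounded_coords_sum D (I : Type) (r : seq I) (f : I -> K) :
  (forall i, bounded_coords D (f i)) -> bounded_coords D (\sum_(i <- r) f i).
Proof.
move=> h; elim/big_rec: _ => [|i x _]; first exact: bounded_coords0.
exact: bounded_coordsD.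
Qed.

Lemma bounded_coordsW D D' x : (D <= D')%N ->
  bounded_coords D x -> bounded_coords D' x.
Proof.
by move=> le [P [sP ->]]; exists P; split=> // j; apply: leq_trans (sP j) le.
Qed.

Lemma bounded_coordsZ c D (p : {poly F}) x : (size p <= c)%N ->
  bounded_coords D x -> bounded_coords (D + c) (p%:F *: x).
Proof.
move=> sp [P [sP ->]]; exists (fun j => p * P j); split.
  move=> j; apply: leq_trans (size_polyMleq _ _) _.
  rewrite addnC; apply: leq_trans (leq_pred _) _; exact: leq_add.
by rewrite scaler_sumr; apply: eq_bigr => j _; rewrite scalerA rmorphM.
Qed.

Lemma frac_denom (x : E) : exists2 h : {poly F}, h != 0 & exists p, h%:F * x = p%:F.
Proof.
elim/quotW: x => r; exists \d_r; first exact: denom_ratioP.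
exists \n_r; rewrite !piE; apply/eqmodP => /=.
rewrite /FracField.mulf FracField.equivfE /= !numden_Ratio ?mulr1 ?mul1r ?oner_neq0 //;
  exact: denom_ratioP.
Qed.

Lemma coords_denom (x : K) :
  exists2 h : {poly F}, h != 0 & exists D, bounded_coords D (h%:F *: x).
Proof.
have /choice[h hP] : forall j : 'I_N, exists h : {poly F},
    h != 0 /\ exists p, h%:F * coord bK j x = p%:F.
  by move=> j; have [h h0 hp] := frac_denom (coord bK j x); exists h.
pose H := \prod_j h j; exists H.
  by apply/prodf_neq0 => j _; case: (hP j).
have /choice[p pP] : forall j : 'I_N, exists p : {poly F}, H%:F * coord bK j x = p%:F.
  move=> j; have [_ [p hp]] := hP j; exists (p * \prod_(i | i != j) h i).
  by rewrite /H (bigD1 j) //= mulrC rmorphM mulrA [_ * (h j)%:F]mulrC hp rmorphM.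
exists (\max_j size (p j)); exists p; split=> [j|]; first exact: leq_bigmax.
rewrite {1}(coord_vbasis (memvf x)) scaler_sumr; apply: eq_bigr => j _.
by rewrite scalerA pP.
Qed.

Lemma coords_denom_seq (s : seq K) : exists2 h : {poly F}, h != 0 &
  exists D, forall x, x \in s -> bounded_coords D (h%:F *: x).
Proof.
elim: s => [|x s [h h0 [D hD]]]; first by exists 1; [exact: oner_neq0 | exists 0].
have [k k0 [D' hD']] := coords_denom x.
exists (h * k); first by rewrite mulf_neq0.
exists (maxn (D' + size h) (D + size k)) => y; rewrite inE => /orP[/eqP->|ys].
  rewrite rmorphM -scalerA; apply: bounded_coordsW (leq_maxl _ _) _.
  exact: bounded_coordsZ.
rewrite mulrC rmorphM -scalerA; apply: bounded_coordsW (leq_maxr _ _) _.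
by apply: bounded_coordsZ => //; apply: hD.
Qed.

(** Counts coefficient matrices. A polynomial coordinate vector is merely chosen for each element;
    the element is recovered from it, which is all that injectivity asks. *)
Lemma bounded_coords_card D (s : seq K) : uniq s ->
  (forall x, x \in s -> bounded_coords D x) -> (size s <= #|F| ^ (N * D))%N.
Proof.
move=> us hs; rewrite -card_mx.
pose f (x : K) : 'M[F]_(N, D) :=
  \matrix_(j, k) (xget (fun=> 0) [set P : 'I_N -> {poly F} |
    (forall j, (size (P j) <= D)%N) /\ x = \sum_j (P j)%:F *: bK`_j] j)`_k.
have finj : {in s &, injective f}.
  move=> x y xs ys /matrixP fxy; move: fxy; rewrite /f.
  case: xgetP => [P _ [sP ->]|/(_ _)]; last first.
    by move=> no; have [P hP] := hs x xs; case: (no P).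
  case: xgetP => [Q _ [sQ ->]|/(_ _)]; last first.
    by move=> no; have [Q hQ] := hs y ys; case: (no Q).
  move=> e; apply: eq_bigr => j _; congr (_%:F *: _).
  apply/polyP => k; have [kD|Dk] := ltnP k D.
    by have := e j (Ordinal kD); rewrite !mxE.
  by rewrite !nth_default // (leq_trans _ Dk).
rewrite -(size_map f) -(card_uniqP _) ?max_card // map_inj_in_uniq //.
Qed.

(* If [B / y B] had many elements, then so would [B / y ^ m B]; but the digit expansions
   [\sum_(i < m) z_i y ^ i] have coordinates of size linear in [m]. *)
Lemma incongruent_bound_aux (y : K) (h : {poly F}) (c : nat) (B : K -> Prop) (Z : seq K) :
    y != 0 -> h != 0 ->
    (forall D x, bounded_coords D x -> bounded_coords (D + c) (h%:F *: x)) ->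
    (forall D x, bounded_coords D x -> bounded_coords (D + c) (h%:F *: (y * x))) ->
    (forall u v, B u -> B v -> B (u - v)) -> (forall u, B u -> B (y * u)) ->
    uniq Z -> (forall z, z \in Z -> B z) ->
    (forall z z', z \in Z -> z' \in Z -> z != z' -> forall w, B w -> z - z' != y * w) ->
  (size Z <= #|F| ^ (N * c))%N.
Proof.
move=> y0 h0 H1 H2 BB By uZ BZ incon.
set q := (#|F| ^ (N * c))%N.
have q0 : (0 < q)%N.
  by rewrite expn_gt0; apply/orP; left; apply/card_gt0P; exists 0.
have [g g0 [D hD]] := coords_denom_seq Z.
case: Z uZ BZ incon hD => [//|z0 Z'] uZ BZ incon hD.
set Z := z0 :: Z' in uZ BZ incon hD *.
(* There are [size Z ^ m] digit expansions of length [m]. They are distinct, and [h ^+ m * g] clears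
   all their denominators at a cost in degree that is linear in [m]. *)
have key m : (size Z ^ m <= #|F| ^ (N * (D + m * c)))%N.
  pose val (f : {ffun 'I_m -> 'I_(size Z)}) : K := \sum_(i < m) Z`_(f i) * y ^+ i.
  have B0 : B 0 by rewrite -(subrr z0); apply: BB; apply: BZ; rewrite mem_head.
  have BN u : B u -> B (- u) by move=> Bu; rewrite -sub0r; apply: BB.
  have BD u v : B u -> B v -> B (u + v).
    by move=> Bu Bv; rewrite -(opprK v); apply: BB => //; apply: BN.
  have BX n u : B u -> B (u * y ^+ n).
    by move=> Bu; elim: n => [|n IH]; rewrite ?mulr1 // exprS mulrCA; apply: By.
  have vinj : injective val.
    move=> f f' e; apply/ffunP => i0; apply/eqP; apply: contraT => ne.
    pose P := [pred n | [exists i : 'I_m, (n == i :> nat) && (f i != f' i)]].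
    have exP : exists n, P n by exists i0; apply/existsP; exists i0; rewrite eqxx.
    have [n /existsP[i /andP[/eqP ni nei]] minn] := find_ex_minn exP.
    have low (j : 'I_m) : (j < i)%N -> f j = f' j.
      move=> ji; apply/eqP; apply: contraT => nej.
      have : P j by apply/existsP; exists j; rewrite eqxx.
      by move/minn; rewrite ni leqNgt ji.
    (* At the lowest index [i] where the digits differ, dividing by [y ^+ i] shows that the two
       digits are congruent modulo [y], with a quotient [w] made of the higher digits. *)
    pose w := \sum_(j < m | (i < j)%N) (Z`_(f' j) - Z`_(f j)) * y ^+ (j - i.+1).
    have Bw : B w.
      rewrite /w; elim/big_rec: _ => // j x _ Bx; apply: BD => //.
      by apply: BX; apply: BB; apply: BZ; apply: mem_nth.
    have : Z`_(f i) - Z`_(f' i) = y * w.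
      apply: (mulIf (expf_neq0 i y0)).
      have : val f - val f' = 0 by rewrite e subrr.
      rewrite /val -sumrB (bigD1 i) //= -mulrBl => /(canRL (addrK _)) ->.
      rewrite add0r (bigID (fun j : 'I_m => (i < j)%N)) /= [X in - (_ + X)]big1.
        rewrite addr0 -sumrN /w mulr_sumr mulr_suml; apply: eq_big => j.
          by rewrite andbC; case: ltnP => //= ij; rewrite -val_eqE /= gtn_eqF.
        move=> /andP[_ ij]; rewrite -mulrBl -mulNr opprB -mulrA mulrCA -!mulrA.
        by congr (_ * _); rewrite -exprS -exprD; congr (_ ^+ _); lia.
      move=> j /andP[ji]; rewrite -leqNgt leq_eqVlt val_eqE (negPf ji) /= => /low ->.
      by rewrite subrr.
    move=> zz; suff: Z`_(f i) - Z`_(f' i) != y * w by rewrite zz eqxx.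
    apply: incon; rewrite ?mem_nth //.
    by rewrite nth_uniq // ?ltn_ord.
  pose s := [seq (h ^+ m * g)%:F *: val f | f : {ffun 'I_m -> 'I_(size Z)}].
  have -> : (size Z ^ m = size s)%N by rewrite size_map -cardE card_ffun !card_ord.
  apply: bounded_coords_card.
    rewrite map_inj_uniq ?enum_uniq // => f f' /scalerI e; apply: vinj; apply: e.
    by rewrite tofrac_eq0 mulf_neq0 ?expf_neq0.
  move=> _ /mapP[f _ ->]; rewrite /val scaler_sumr; apply: bounded_coords_sum => i.
  have Dx : bounded_coords D (g%:F *: Z`_(f i)) by apply: hD; apply: mem_nth.
  set x := g%:F *: Z`_(f i) in Dx.
  have -> : (h ^+ m * g)%:F *: (Z`_(f i) * y ^+ i) =
            (h%:F ^+ (m - i)) *: ((h%:F ^+ i) *: (y ^+ i * x)).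
    rewrite /x scalerA -exprD subnK 1?ltnW // rmorphM rmorphXn -scalerA.
    by rewrite -scalerAr mulrC.
  have Dy n : bounded_coords (D + n * c) (h%:F ^+ n *: (y ^+ n * x)).
    elim: n => [|n IH]; first by rewrite !expr0 scale1r mul1r mul0n addn0.
    have := H2 _ _ IH; rewrite -addnA -mulSnr => H; move: H.
    by rewrite -scalerAr scalerA -exprS mulrA -exprS.
  have Dh n E x' : bounded_coords E x' -> bounded_coords (E + n * c) (h%:F ^+ n *: x').
    move=> Ex; elim: n => [|n IH]; first by rewrite !expr0 scale1r mul0n addn0.
    by have := H1 _ _ IH; rewrite -addnA -mulSnr scalerA -exprS.
  have := Dh (m - i)%N _ _ (Dy i); rewrite -addnA -mulnDl subnKC 1?ltnW //.
rewrite leqNgt; apply/negP => Zq.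
set A := (#|F| ^ (N * D))%N in key.
(* If [size Z > q], then [q.+1 ^ m <= A * q ^ m] for all [m]. Bernoulli's inequality refutes this at
   [m = A * q + 1]. *)
have bern m : (q ^ m.+1 + m.+1 * q ^ m <= q.+1 ^ m.+1)%N.
  elim: m => [|m IH]; first by rewrite !expn1 expn0 mul1n addn1.
  by rewrite [(q.+1 ^ m.+2)%N]expnS; move: IH; rewrite !expnS; nia.
have Zm m : (q.+1 ^ m <= size Z ^ m)%N.
  by case: m => [|m]; [rewrite !expn0 | rewrite leq_exp2r].
have Fm m : (#|F| ^ (N * (D + m * c)) = A * q ^ m)%N.
  by rewrite /q -expnM /A -expnD mulnDr mulnCA [(m * _)%N]mulnC.
have := leq_trans (leq_trans (bern (A * q)%N) (Zm _)) (key _); rewrite Fm.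
rewrite expnS; have := expn_gt0 q (A * q); rewrite q0 /=; nia.
Qed.

(* A substitute for the inequality [\sum e f <= [K : F(y)]] : the order of [B / y B]
   is bounded independently of [B]. *)
Lemma incongruent_bound (y : K) : y != 0 -> exists M : nat,
  forall (B : K -> Prop) (Z : seq K),
    (forall u v, B u -> B v -> B (u - v)) -> (forall u, B u -> B (y * u)) ->
    uniq Z -> (forall z, z \in Z -> B z) ->
    (forall z z', z \in Z -> z' \in Z -> z != z' -> forall w, B w -> z - z' != y * w) ->
  (size Z <= M)%N.
Proof.
move=> y0.
have [h h0 [c hc]] := coords_denom_seq [seq y * b | b <- bK].
exists (#|F| ^ (N * (maxn (size h) c)))%N => B Z BB By uZ BZ incon.
apply: (incongruent_bound_aux y0 h0 _ _ BB By uZ BZ incon) => D x.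
  by apply: bounded_coordsZ; apply: leq_maxl.
move=> [P [sP ->]]; rewrite mulr_sumr scaler_sumr; apply: bounded_coords_sum => j.
rewrite -scalerAr scalerA mulrC -scalerA addnC; apply: bounded_coordsZ => //.
apply: bounded_coordsW (leq_maxr _ _) _; apply: hc; apply: map_f; apply: mem_nth.
by rewrite size_tuple.
Qed.

(** For [y = 1/t] the multiplier [h = 'X] costs one degree and cancels [y] exactly, so [c = 1]
    works. The resulting bound [#|F| ^ N] is what later gives degree at most [N] to the pole divisor
    of [t]. *)
Lemma incongruent_bound_invX (B : K -> Prop) (Z : seq K) (y : K) :
    y * ('X%:F)%:A = 1 ->
    (forall u v, B u -> B v -> B (u - v)) -> (forall u, B u -> B (y * u)) ->
    uniq Z -> (forall z, z \in Z -> B z) ->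
    (forall z z', z \in Z -> z' \in Z -> z != z' -> forall w, B w -> z - z' != y * w) ->
  (size Z <= #|F| ^ N)%N.
Proof.
move=> yX BB By uZ BZ incon; rewrite -[N]muln1.
have y0 : y != 0 by apply: contra_eq_neq yX => ->; rewrite mul0r eq_sym oner_neq0.
apply: (@incongruent_bound_aux y 'X 1 B Z) => //; first by rewrite polyX_eq0.
  move=> D x [P [sP ->]]; exists (fun j => P j * 'X); split.
    move=> j; have [->|P0] := eqVneq (P j) 0; first by rewrite mul0r size_poly0.
    by rewrite size_mulX // addn1 ltnS.
  by rewrite scaler_sumr; apply: eq_bigr => j _; rewrite scalerA mulrC rmorphM.
move=> D x Dx; rewrite -[_ *: _]mul1r -scalerAr scalerAl mulrA [_ *: 1 * y]mulrC yX mul1r.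
by apply: bounded_coordsW Dx; apply: leq_addr.
Qed.

End Bound.

(** * Places and weak approximation *)

Section Valuations.
Variable K : fieldType.
Implicit Types (p : place K) (x y z : K) (n : int).

Lemma ordM p x y : x != 0 -> y != 0 -> p (x * y) = p x + p y.
Proof. by have [_ h _ _] := placeP p; apply: h. Qed.

Lemma ordN p x : p (- x) = p x.
Proof.
have [->|x0] := eqVneq x 0; first by rewrite oppr0.
by rewrite -mulN1r ordM ?oppr_eq0 ?oner_neq0 // ordN1 add0r.
Qed.

Lemma ordX p x k : x != 0 -> p (x ^+ k) = p x *+ k.
Proof.
move=> x0; elim: k => [|k IH]; first by rewrite Defs.ord1.
by rewrite exprS ordM ?expf_neq0 // IH mulrS.
Qed.

Lemma ordXz p x k : x != 0 -> p (x ^ k) = k * p x.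
Proof.
move=> x0; case: k => k; first by rewrite -exprnP ordX // -mulr_natl natz.
by rewrite NegzE -exprnN ordV ?expf_neq0 // ordX // mulNr -mulr_natl natz.
Qed.

Lemma ord_ge0 p n : ord_ge p n 0. Proof. by rewrite /ord_ge eqxx. Qed.
Hint Resolve ord_ge0 : core.

Lemma ord_geE p n x : x != 0 -> ord_ge p n x = (n <= p x).
Proof. by rewrite /ord_ge => /negPf ->. Qed.

Lemma ord_ge_refl p x : ord_ge p (p x) x.
Proof. by rewrite /ord_ge lexx orbT. Qed.

Lemma ord_ge_sum p n (I : Type) (r : seq I) (P : pred I) (f : I -> K) :
  (forall i, P i -> ord_ge p n (f i)) -> ord_ge p n (\sum_(i <- r | P i) f i).
Proof. by move=> h; elim/big_rec: _ => // i x Pi; apply: ord_geD; apply: h. Qed.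

Lemma ord_geX p n x k : ord_ge p n x -> ord_ge p (n *+ k) (x ^+ k).
Proof.
move=> h; elim: k => [|k IH]; first by rewrite ord_geE ?oner_neq0 // Defs.ord1.
by rewrite exprS mulrS; apply: ord_geM.
Qed.

Lemma ord_ge_div p n x y : y != 0 -> ord_ge p (n + p y) x = ord_ge p n (x / y).
Proof.
move=> y0; have [->|x0] := eqVneq x 0; first by rewrite mul0r !ord_ge0.
by rewrite !ord_geE ?mulf_neq0 ?invr_eq0 // ordM ?invr_eq0 // ordV // lerBrDr.
Qed.

Lemma ord_ge_mul p n x y : y != 0 -> ord_ge p (n + p y) (x * y) = ord_ge p n x.
Proof. by move=> y0; rewrite ord_ge_div // mulfK. Qed.

Lemma ord_add_dom p x y : x != 0 -> ord_ge p (p x + 1) y ->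
  x + y != 0 /\ p (x + y) = p x.
Proof.
move=> x0 hy; have nz : x + y != 0.
  apply: contraTneq hy => /eqP; rewrite addr_eq0 => /eqP xy.
  rewrite -ord_geN -xy ord_geE // -ltNge; lia.
split=> //; apply/eqP; rewrite eq_le; apply/andP; split; last first.
  rewrite -ord_geE //; apply: ord_geD; first exact: ord_ge_refl.
  by apply: ord_geW hy; lia.
rewrite leNgt; apply/negP => lt.
have : ord_ge p (p x + 1) x.
  by rewrite -{2}[x](addrK y); apply: ord_geB => //; rewrite ord_geE // lezD1.
rewrite ord_geE //; lia.
Qed.

Lemma ord_torsion p x k : (0 < k)%N -> x ^+ k = 1 -> p x = 0.
Proof.
move=> k0 xk; have x0 : x != 0.
  by apply: contra_eq_neq xk => ->; rewrite expr0n gtn_eqF // eq_sym oner_neq0.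
have := ordX p k x0; rewrite xk Defs.ord1 => /esym/eqP.
by rewrite mulrn_eq0 gtn_eqF //= => /eqP.
Qed.

Lemma uniformizer p : exists2 x, x != 0 & p x = 1.
Proof. by have [_ _ _ h] := placeP p. Qed.

Lemma place_eq p p' : (forall x, x != 0 -> p x = p' x) -> p = p'.
Proof.
move=> h; apply/val_inj/funext => x; change (p x = p' x); have [->|x0] := eqVneq x 0; last exact: h.
by have [-> _ _ _] := placeP p; have [-> _ _ _] := placeP p'.
Qed.

(** Inclusion of the valuation rings keeps units units, so [p'] is [p' u] times [p] for a
    uniformizer [u] of [p]. As [p'] takes the value 1 and [p' u] is nonnegative, the factor is 1. *)
Lemma place_le_eq p p' :
  (forall x, x != 0 -> 0 <= p x -> 0 <= p' x) -> p = p'.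
Proof.
move=> h; have unit x : x != 0 -> p x = 0 -> p' x = 0.
  move=> x0 px; apply/eqP; rewrite eq_le h ?px // andbT -oppr_ge0 -ordV //.
  by apply: h; rewrite ?invr_eq0 // ordV // px.
have [u u0 pu] := uniformizer p.
have e x : x != 0 -> p' x = p x * p' u.
  move=> x0; have [uk0 uk] : u ^ p x != 0 /\ p (u ^ p x) = p x.
    by rewrite expfz_neq0 // ordXz // pu mulr1.
  have -> : x = (x / u ^ p x) * u ^ p x by rewrite divfK.
  have y0 : x / u ^ p x != 0 by rewrite mulf_neq0 ?invr_eq0.
  have py : p (x / u ^ p x) = 0 by rewrite ordM ?invr_eq0 // ordV // uk subrr.
  by rewrite ordM // (unit _ y0 py) ordXz // ordM // py uk !add0r.
have [v v0 pv] := uniformizer p'; have := e _ v0; rewrite pv => /esym/eqP.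
have : 0 <= p' u by apply: h => //; rewrite pu.
move=> pu0 /eqP pvu; have pu1 : p' u = 1.
  move: (p' u) (p v) pu0 pvu => k l k0 e1.
  have h1 : l <= 0 \/ 1 <= l by lia.
  have h2 : k = 1 \/ k = 0 \/ 2 <= k by lia.
  case: h2 => [//|[k00|k2]]; first by rewrite k00 mulr0 in e1.
  by case: h1 => h1; [have := mulr_le0_ge0 h1 k0|have := ler_pM _ _ h1 k2]; rewrite e1; lia.
by apply: place_eq => x x0; rewrite (e x) // pu1 mulr1.
Qed.

Lemma place_sep p p' : p != p' -> exists2 x, x != 0 & 0 < p x /\ p' x < 0.
Proof.
have half (q q' : place K) : q != q' -> exists2 x, x != 0 & 0 <= q x /\ q' x < 0.
  move=> qq'; apply: contrapT => no; move/eqP: qq'; apply.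
  apply: place_le_eq => x x0 qx; rewrite leNgt; apply/negP => lt.
  by apply: no; exists x.
move=> ne; have [x x0 [px p'x]] := half _ _ ne.
have [y y0 [p'y py]] : exists2 x, x != 0 & 0 <= p' x /\ p x < 0.
  by apply: half; rewrite eq_sym.
exists (x / y); first by rewrite mulf_neq0 ?invr_eq0.
rewrite !ordM ?invr_eq0 // !ordV //; lia.
Qed.

Lemma pos_mul_large (T : eqType) (s : seq T) (f g : T -> int) :
  (forall i, i \in s -> 0 < f i) ->
  exists k0 : nat, forall k, (k0 <= k)%N -> forall i, i \in s -> 0 < f i *+ k + g i.
Proof.
elim: s => [|j s IH] fs; first by exists 0%N.
have [k0 h] := IH (fun i hi => fs i (mem_behead (s := j :: s) hi)).
exists (k0 + `|g j|.+1)%N => k hk i; rewrite inE => /orP[/eqP->|]; last by apply: h; lia.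
have := fs j (mem_head _ _); rewrite -mulr_natr natz.
move: (f j) (g j) hk => a b; nia.
Qed.

(** Induction on the list: given [z] with a pole at [p] and zeros on [s], and [w] with a zero at the
    new place [p1] and a pole at [p], a high power of [z] is corrected so as to vanish at [p1]
    too. *)
Lemma approx_pole p (s : seq (place K)) : p \notin s ->
  exists2 x, x != 0 & p x < 0 /\ forall p', p' \in s -> 0 < p' x.
Proof.
elim: s => [_|p1 s IH].
  by have [u u0 pu] := uniformizer p; exists u^-1; rewrite ?invr_eq0 // ordV // pu.
rewrite inE negb_or eq_sym => /andP[pp1 /IH[z z0 [pz sz]]] {IH}.
have [p1z|p1z] := ltP 0 (p1 z).
  by exists z => //; split=> // p'; rewrite inE => /orP[/eqP->|/sz].
have [w w0 [p1w pw]] := place_sep pp1.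
have [k0 kP] := pos_mul_large (fun p' => p' w) sz.
have zk0 : z ^+ k0.+1 != 0 by rewrite expf_neq0.
have sk (p' : place K) : p' \in s -> 0 < p' (z ^+ k0.+1) + p' w.
  by move=> ps; rewrite ordX //; apply: kP.
have pk : p (z ^+ k0.+1) < 0 by rewrite ordX // pmulrn_llt0.
have [p1z0|p1z0] := eqVneq (p1 z) 0.
  exists (z ^+ k0.+1 * w); first by rewrite mulf_neq0.
  split=> [|p']; first by rewrite ordM // addrC ltr_wnDr // ltW.
  rewrite inE => /orP[/eqP->|/sk]; last by rewrite ordM.
  by rewrite ordM // ordX // p1z0 mul0rn add0r.
(* If [z] has a pole at [p1] as well, the factor [z ^ k / (z ^ k + 1)] has order 0 at both poles and
   keeps the zeros of [z ^ k] on [s]; multiplying by [w] then gives the required signs. *)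
have p1k : p1 (z ^+ k0.+1) < 0 by rewrite ordX // pmulrn_llt0 // lt_neqAle p1z0.
have dom (q : place K) : q (z ^+ k0.+1) < 0 ->
    z ^+ k0.+1 + 1 != 0 /\ q (z ^+ k0.+1 + 1) = q (z ^+ k0.+1).
  by move=> qz; apply: ord_add_dom => //; rewrite ord_geE ?oner_neq0 // Defs.ord1 lezD1.
have [z10 pz1] := dom p pk; have [_ p1z1] := dom p1 p1k.
exists (z ^+ k0.+1 / (z ^+ k0.+1 + 1) * w); first by rewrite !mulf_neq0 ?invr_eq0.
have e (q : place K) : q (z ^+ k0.+1 / (z ^+ k0.+1 + 1) * w) =
    q (z ^+ k0.+1) - q (z ^+ k0.+1 + 1) + q w.
  by rewrite !ordM ?mulf_neq0 ?invr_eq0 // ordV.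
split=> [|p']; first by rewrite e pz1 subrr add0r.
rewrite inE => /orP[/eqP->|ps]; first by rewrite e p1z1 subrr add0r.
have p'z : 0 < p' (z ^+ k0.+1) by rewrite ordX // pmulrn_lgt0 // sz.
have := @ord_add_dom p' 1 (z ^+ k0.+1) (oner_neq0 _).
rewrite Defs.ord1 add0r ord_geE // => /(_ p'z)[_].
by rewrite e [_ + 1]addrC => ->; rewrite subr0; apply: sk.
Qed.

(** [w / (w + 1)] is close to 1 where [w] has a high pole and close to 0 where [w] has a high
    zero. *)
Lemma approx_idem p (s : seq (place K)) n : p \notin s ->
  exists x, ord_ge p n (x - 1) /\ forall p', p' \in s -> ord_ge p' n x.
Proof.
move=> /approx_pole[z z0 [pz sz]]; pose k := `|n|.+1; pose w := z ^+ k.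
have w0 : w != 0 by rewrite expf_neq0.
have pw : p w <= - n by rewrite ordX // -mulr_natr natz /k; move: (p z) pz => a; nia.
have pw0 : p w < 0 by rewrite ordX // pmulrn_llt0.
have sw (p' : place K) : p' \in s -> n <= p' w.
  by move=> /sz; rewrite ordX // -mulr_natr natz /k; move: (p' z) => a; nia.
have sw0 (p' : place K) : p' \in s -> 0 < p' w by move=> /sz; rewrite ordX // pmulrn_lgt0.
have [w10 pw1] : w + 1 != 0 /\ p (w + 1) = p w.
  by apply: ord_add_dom => //; rewrite ord_geE ?oner_neq0 // Defs.ord1 lezD1.
exists (w / (w + 1)); split=> [|p' ps].
  have -> : w / (w + 1) - 1 = - (w + 1)^-1 by field.
  by rewrite ord_geN ord_geE ?invr_eq0 // ordV // pw1 lerNr.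
have := @ord_add_dom p' 1 w (oner_neq0 _).
rewrite Defs.ord1 add0r ord_geE // => /(_ (sw0 _ ps))[_].
move=> e1; rewrite ord_geE ?mulf_neq0 ?invr_eq0 // ordM ?invr_eq0 // ordV // [w + 1]addrC e1.
by rewrite oppr0 addr0 sw.
Qed.

Lemma weak_approximation (s : seq (place K)) (f : place K -> K) n : uniq s ->
  exists x, forall p, p \in s -> ord_ge p n (x - f p).
Proof.
(* [M] compensates the worst pole of the targets [f p'] at places of [s], so approximate idempotents
   of precision [M] suffice. *)
have [M hM] : exists M : int, forall p, p \in s -> forall p', p' \in s ->
    ord_ge p (n - M) (f p').
  suff [M hM] : exists M : int, forall l, l \in [seq p (f p') | p <- s, p' <- s] -> n - M <= l.
    exists M => p ps p' p's; apply: ord_geW (ord_ge_refl _ _); apply: hM.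
    by apply/allpairsP; exists (p, p').
  elim: [seq _ | _ <- _, _ <- _] => [|l L [M hM]]; first by exists 0.
  exists (`|M| + `|n - l|) => l'; rewrite inE => /orP[/eqP->|/hM]; lia.
move=> us; have /choice[e eP] : forall p, exists x, p \in s ->
    ord_ge p M (x - 1) /\ forall p', p' \in s -> p' != p -> ord_ge p' M x.
  move=> p; have pn : p \notin [seq p' <- s | p' != p] by rewrite mem_filter eqxx.
  have [x [h1 h2]] := approx_idem M pn; exists x => _; split=> // p' p's ne.
  by apply: h2; rewrite mem_filter ne.
exists (\sum_(p <- s) e p * f p) => p ps; rewrite (bigD1_seq p) //=.
have -> (a b c : K) : a * b + c - b = (a - 1) * b + c by ring.
have [h _] := eP p ps; apply: ord_geD.
  by rewrite -[n](subrKC M); apply: ord_geM => //; apply: hM.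
rewrite big_seq_cond; apply: ord_ge_sum => p' /andP[p's ne].
rewrite -[n](subrKC M); apply: ord_geM; last exact: hM.
by have [_ h'] := eP p' p's; apply: h' => //; rewrite eq_sym.
Qed.

End Valuations.
#[export] Hint Resolve ord_ge0 : core.

(** * Existence of places *)

Section ValuationRings.
Variable K : fieldType.
Implicit Types (R V : K -> Prop) (x y z a b c : K).

Definition is_subring R : Prop :=
  [/\ R 1, forall a b, R a -> R b -> R (a - b) & forall a b, R a -> R b -> R (a * b)].

Section Subring.
Variables (R : K -> Prop) (sR : is_subring R).
Let R1 : R 1. Proof. by case: sR. Qed.
Let RB a b : R a -> R b -> R (a - b). Proof. by case: sR => _ h _; apply: h. Qed.
Let RM a b : R a -> R b -> R (a * b). Proof. by case: sR => _ _; apply. Qed.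

Lemma subring0 : R 0. Proof. by rewrite -(subrr 1); apply: (RB). Qed.
Lemma subringN a : R a -> R (- a).
Proof. by move=> Ra; rewrite -sub0r; apply: (RB) => //; apply: subring0. Qed.
Lemma subringD a b : R a -> R b -> R (a + b).
Proof. by move=> Ra Rb; rewrite -(opprK b); apply: (RB) => //; apply: subringN. Qed.
Lemma subringX a n : R a -> R (a ^+ n).
Proof. by move=> Ra; elim: n => [//|n IH]; rewrite exprS; apply: (RM). Qed.
Lemma subring_sum (I : Type) (r : seq I) (P : pred I) (f : I -> K) :
  (forall i, P i -> R (f i)) -> R (\sum_(i <- r | P i) f i).
Proof.
move=> h; elim/big_rec: _ => [|i a Pi Ra]; first exact: subring0.
by apply: subringD => //; apply: h.
Qed.

Definition adjoin z : K -> Prop :=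
  fun w => exists h : {poly K}, (forall i, R h`_i) /\ w = h.[z].

Lemma adjoin_subring z : is_subring (adjoin z).
Proof.
split=> [|_ _ [g [Rg ->]] [h [Rh ->]]|_ _ [g [Rg ->]] [h [Rh ->]]].
- exists 1; split; last by rewrite hornerC.
  by move=> i; rewrite coef1; case: eqP => _ //=; apply: subring0.
- by exists (g - h); split=> [i|]; rewrite ?coefB ?hornerD ?hornerN //; apply: (RB).
- exists (g * h); split=> [i|]; rewrite ?hornerM // coefM.
  by apply: subring_sum => j _; apply: (RM).
Qed.

Lemma adjoin_sub z a : R a -> adjoin z a.
Proof.
move=> Ra; exists a%:P; split; last by rewrite hornerC.
by move=> i; rewrite coefC; case: eqP => _ //; apply: subring0.
Qed.

Lemma adjoin_gen z : adjoin z z.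
Proof.
exists 'X; split; last by rewrite hornerX.
by move=> i; rewrite coefX; case: eqP => _ //=; apply: subring0.
Qed.

End Subring.

Lemma maximal_subring R0 x : is_subring R0 -> ~ R0 x ->
  exists R, [/\ is_subring R, ~ R x, forall a, R0 a -> R a &
    forall S, is_subring S -> (forall a, R a -> S a) -> ~ S x -> forall a, S a -> R a].
Proof.
move=> sR0 nx.
pose P : set (set K) := fun A => A = set0 \/
  [/\ is_subring A, ~ A x & forall a, R0 a -> A a].
have [|A [PA maxA]] := @Zorn_bigcup _ P.
  move=> C CP totC; have [[A0 CA0 [a0 A0a0]]|none] :=
      pselect (exists2 A, C A & exists a, A a); last first.
    left; apply/seteqP; split=> // a [A CA Aa]; case: none; exists A => //; by exists a.
  right; have good A a : C A -> A a -> [/\ is_subring A, ~ A x & forall b, R0 b -> A b].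
    by move=> CA Aa; have [A_0|//] := CP _ CA; move: Aa; rewrite A_0.
  have pair a b : (\bigcup_(X in C) X)%classic a -> (\bigcup_(X in C) X)%classic b ->
      exists A, [/\ C A, A a & A b].
    move=> [A CA Aa] [B CB Bb]; have [AB|BA] := totC _ _ CA CB.
      by exists B; split=> //; apply: AB.
    by exists A; split=> //; apply: BA.
  have [sA0 _ RA0] := good _ _ CA0 A0a0.
  split.
  - split.
    + by exists A0 => //; case: sA0.
    + move=> a b ha hb; have [A [CA Aa Ab]] := pair _ _ ha hb; exists A => //.
      by have [[_ h _] _ _] := good _ _ CA Aa; apply: h.
    + move=> a b ha hb; have [A [CA Aa Ab]] := pair _ _ ha hb; exists A => //.
      by have [[_ _ h] _ _] := good _ _ CA Aa; apply: h.
  - by move=> [A CA Ax]; have [_ nAx _] := good _ _ CA Ax.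
  - by move=> a Ra; exists A0 => //; apply: RA0.
have max' S : is_subring S -> (forall a, A a -> S a) -> ~ S x -> (forall a, R0 a -> S a) ->
    forall a, S a -> A a.
  move=> sS AS nSx RS a Sa; apply: contrapT => nAa; apply: (maxA S); last by right.
  by split=> // /(_ a Sa).
have [A0|[sA nAx RA]] := PA.
  exfalso; have [h _ _] := sR0.
  by have := max' R0 sR0; rewrite A0 => /(_ (fun _ => False_ind _) nx (fun _ => id) 1 h).
by exists A; split=> // S sS AS nSx; apply: max' => // a /RA/AS.
Qed.

(* A subring maximal for not containing [x], but containing [x^-1], is a valuation ring. *)
Lemma chevalley R0 x : is_subring R0 -> R0 x^-1 -> ~ R0 x ->
  exists V, [/\ is_subring V, V x^-1, ~ V x & forall z, V z \/ V z^-1].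
Proof.
move=> sR0 R0y /(maximal_subring sR0)[R [sR nRx R0R maxR]].
exists R; split=> //; first exact: R0R.
set y := x^-1 in R0y *; have Ry := R0R _ R0y.
have [R1 RB RM] := sR.
have x0 : x != 0 by apply: contra_not_neq nRx => ->; apply: subring0.
have yx : y * x = 1 by rewrite mulVf.
have adj z : ~ R z -> adjoin R z x.
  move=> nRz; apply: contrapT => h; apply: nRz; apply: (maxR _ _ _ h).
  - exact: adjoin_subring.
  - by move=> a; apply: adjoin_sub.
  - exact: adjoin_gen.
(* [y] lies in the Jacobson radical of [R]: otherwise maximality puts [x] in [R[1/u]] with
   [u = 1 - y * b], so some [x * u ^+ n] is in [R]; as [u ^+ n = 1 - y * b'] with [b'] in [R], this
   puts [x] itself in [R]. *)
have jac b : R b -> R (1 - y * b)^-1.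
  move=> Rb; apply: contrapT => /adj[h [Rh xh]].
  set u := 1 - y * b in xh.
  have u0 : u != 0.
    rewrite subr_eq0; apply: contra_not_neq nRx => e.
    by rewrite -[x]mulr1 e mulrA [x * y]mulrC yx mul1r.
  have [b' Rb' ub'] : exists2 b', R b' & u ^+ size h = 1 - y * b'.
    elim: (size h) => [|k [c Rc IH]]; first by exists 0; [apply: subring0 | rewrite mulr0 subr0].
    exists (b + c * (1 - y * b)).
      by apply: subringD => //; apply: (RM) => //; apply: (RB) => //; apply: (RM).
    by rewrite exprS IH /u; ring.
  have Rxu : R (x * u ^+ size h).
    rewrite xh horner_coef mulr_suml; apply: subring_sum => // i _.
    rewrite -mulrA; apply: (RM) => //.
    have -> : u ^+ size h = u ^+ (size h - i) * u ^+ i by rewrite -exprD subnK // ltnW.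
    rewrite exprVn mulrC mulfK ?expf_neq0 //.
    by apply: subringX => //; apply: (RB) => //; apply: (RM).
  apply: nRx; have -> : x = x * u ^+ size h + b'.
    by rewrite ub' mulrBr mulrA [x * y]mulrC yx; ring.
  exact: subringD.
(* The expansion of [x] in powers of [z^-1] yields a relation [1 = \sum_j k j * z^-1 ^+ j.+1] with
   all [k j] in [R]. Multiplied by the leading term of [h], it rewrites that term in lower powers of
   [z]. *)
have red z (h h' : {poly K}) : z != 0 -> (forall i, R h`_i) -> (forall i, R h'`_i) ->
    x = h.[z] -> x = h'.[z^-1] -> (size h' <= size h)%N ->
  exists2 g : {poly K}, (forall i, R g`_i) & x = g.[z] /\ (size g < size h)%N.
  move=> z0 Rh Rh' xh xh' sh.
  case sz : (size h) => [|n].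
    by exfalso; apply: nRx; move: xh; rewrite horner_coef sz big_ord0 => ->; apply: subring0.
  set u := 1 - y * h'`_0; have Ru : R u^-1 by apply: jac.
  have u0 : u != 0.
    rewrite subr_eq0; apply: contra_not_neq nRx => e.
    by rewrite -[x]mulr1 e mulrA [x * y]mulrC yx mul1r.
  pose k j := y * h'`_j.+1 / u.
  have Rk j : R (k j) by apply: (RM) => //; apply: (RM).
  have k1 : \sum_(j < n) k j * z^-1 ^+ j.+1 = 1.
    have e : u = \sum_(j < n) y * h'`_j.+1 * z^-1 ^+ j.+1.
      have xs : x = \sum_(j < n.+1) h'`_j * z^-1 ^+ j.
        by rewrite xh'; apply: horner_coef_wide; rewrite -sz.
      rewrite /u -{1}yx {1}xs big_ord_recl expr0 mulr1 mulrDr addrC addKr mulr_sumr.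
      by apply: eq_bigr => j _; rewrite mulrA.
    apply: (mulIf u0); rewrite mul1r mulr_suml {2}e.
    by apply: eq_bigr => j _; rewrite /k mulrAC divfK.
  exists (\poly_(i < n) (h`_i + h`_n * k (n - i.+1)%N)).
    by move=> i; rewrite coef_poly; case: ifP => _; [apply: subringD => //; apply: (RM) | apply: subring0].
  split; last by rewrite ltnS size_poly.
  rewrite horner_poly xh horner_coef sz big_ord_recr /= -[X in _ + X]mulr1.
  have {k1}<- : \sum_(i < n) k (n - i.+1)%N * z^-1 ^+ (n - i.+1).+1 = 1.
    by rewrite -[RHS]k1 [RHS](reindex_inj rev_ord_inj).
  rewrite mulr_sumr -big_split; apply: eq_bigr => i _ /=.
  rewrite mulrDl; congr (_ + _); have ni := ltn_ord i.
  have -> : (n - i.+1).+1 = (n - i)%N by lia.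
  have -> : z ^+ n = z ^+ (n - i) * z ^+ i by rewrite -exprD; congr (_ ^+ _); lia.
  have zn : z ^+ (n - i) != 0 by rewrite expf_neq0.
  by rewrite exprVn; field.
move=> z; have [->|z0] := eqVneq z 0; first by left; apply: subring0.
apply: contrapT => /not_orP[/adj[h [Rh xh]] /adj[h' [Rh' xh']]].
have [n] := ubnP (size h + size h')%N; elim: n => // n IH in z z0 h h' Rh Rh' xh xh' *.
move=> sn; have [le|/ltnW le] := leqP (size h') (size h).
  have [g Rg [xg sg]] := red z h h' z0 Rh Rh' xh xh' le.
  by apply: (IH z z0 g h') => //; lia.
have xhV : x = h.[(z^-1)^-1] by rewrite invrK.
have zV0 : z^-1 != 0 by rewrite invr_eq0.
have [g Rg [xg sg]] := red z^-1 h' h zV0 Rh' Rh xh' xhV le.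
by apply: (IH z z0 h g) => //; lia.
Qed.


(* [Vbound] bounds the length of chains of values below a given one, whence a discrete
   valuation of rank one. *)
Section Discrete.
Variables (V : K -> Prop) (sV : is_subring V).
Hypothesis Vtot : forall z, V z \/ V z^-1.
Hypothesis Vbound : forall w, w != 0 -> V w -> exists M : nat, forall Z : seq K,
  uniq Z -> (forall z, z \in Z -> V z) ->
  (forall z z', z \in Z -> z' \in Z -> z != z' -> forall v, V v -> z - z' != w * v) ->
  (size Z <= M)%N.

Let V1 : V 1. Proof. by case: sV. Qed.
Let VB a b : V a -> V b -> V (a - b). Proof. by case: sV => _ h _; apply: h. Qed.
Let VM a b : V a -> V b -> V (a * b). Proof. by case: sV => _ _; apply. Qed.

(** The strict order of values before any value group is available: [a] divides [b] in [V] but not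
    conversely. Zero is related to nothing, since [x / 0 = 0]. *)
Definition val_lt : rel K := fun a b => `[< V (b / a) /\ ~ V (a / b) >].

Lemma val_ltP a b : reflect (V (b / a) /\ ~ V (a / b)) (val_lt a b).
Proof. exact: asboolP. Qed.

Lemma val_lt_neq0 a b : val_lt a b -> a != 0 /\ b != 0.
Proof.
move=> /val_ltP[_ n]; split; apply: contra_not_neq n => ->; rewrite ?mul0r ?invr0 ?mulr0;
  exact: subring0.
Qed.

Lemma val_lt_irr : irreflexive val_lt.
Proof. by move=> a; apply/negP => /val_ltP[]. Qed.

Lemma val_lt_trans : transitive val_lt.
Proof.
move=> b a c ab bc; have [a0 b0] := val_lt_neq0 ab; have [_ c0] := val_lt_neq0 bc.
move: ab bc => /val_ltP[ab nab] /val_ltP[bc nbc]; apply/val_ltP; split.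
  have -> : c / a = c / b * (b / a) by rewrite mulrA divfK.
  exact: VM.
move=> ac; apply: nab.
have -> : a / b = a / c * (c / b) by rewrite mulrA divfK.
exact: VM.
Qed.

Lemma val_lt_total a b : ~ V (a / b) -> val_lt a b.
Proof.
move=> n; apply/val_ltP; split=> //.
by have [//|] := Vtot (a / b); rewrite invf_div.
Qed.

Lemma val_lt_sub a b : val_lt a b -> V (a / (a - b)).
Proof.
move=> ab; have [a0 b0] := val_lt_neq0 ab; move/val_ltP: ab => [ab nab].
have ab0 : a - b != 0.
  by rewrite subr_eq0; apply: contra_not_neq nab => ->; rewrite divff.
have [v|] := Vtot (b / (a - b)).
  have -> : a / (a - b) = b / (a - b) + 1 by field.
  exact: subringD.
rewrite invf_div => v; exfalso; apply: nab.
have -> : a / b = (a - b) / b + 1 by field.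
exact: subringD.
Qed.

(** Elements of distinct values below that of [w] are incongruent modulo [w]: if [val_lt a b], then
    [a - b] divides [a], so [w] dividing [a - b] would divide [a]. Hence [Vbound] limits the
    chain. *)
Lemma val_chain_bound w : V w -> exists M : nat, forall s : seq K,
  (forall z, z \in s -> V z) -> sorted val_lt (rcons s w) -> (size s <= M)%N.
Proof.
move=> Vw; have [w0|w0] := eqVneq w 0.
  exists 0%N; case=> // a s _ /=; rewrite rcons_path => /andP[_ /val_lt_neq0[]].
  by rewrite w0 eqxx.
have [M hM] := Vbound w0 Vw; exists M => s Vs srt.
have us : uniq (rcons s w) := sorted_uniq val_lt_trans val_lt_irr srt.
have lt_sw z : z \in s -> val_lt z w.
  move=> zs; move: srt; rewrite (sorted_pairwise val_lt_trans).
  by rewrite pairwise_rcons => /andP[/allP h _]; apply: h.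
have lt_ss z z' : z \in s -> z' \in s -> z != z' -> val_lt z z' \/ val_lt z' z.
  move=> zs z's ne.
  have srt' : sorted val_lt s.
    by move: srt; rewrite !(sorted_pairwise val_lt_trans) pairwise_rcons => /andP[].
  have nth_lt i j : (i < j < size s)%N -> val_lt s`_i s`_j.
    by move=> /andP[ij js]; apply: (sorted_ltn_nth val_lt_trans 0 srt') => //; rewrite inE // (ltn_trans ij).
  have [ij|ij|ij] := ltngtP (index z s) (index z' s).
  - by left; rewrite -[z](nth_index 0 zs) -[z'](nth_index 0 z's) nth_lt // ij index_mem.
  - by right; rewrite -[z](nth_index 0 zs) -[z'](nth_index 0 z's) nth_lt // ij index_mem.
  - by move: ne; rewrite -[z](nth_index 0 zs) -[z'](nth_index 0 z's) ij eqxx.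
apply: hM => //; first by move: us; rewrite rcons_uniq => /andP[].
have key a b v : a \in s -> val_lt a b -> V v -> a - b != w * v.
  move=> sa ab Vv; apply/negP => /eqP e; have /val_ltP[_] := lt_sw a sa; apply.
  have [a0 _] := val_lt_neq0 ab.
  have ab0 : a - b != 0.
    rewrite subr_eq0; apply/negP => /eqP h; move: ab; rewrite h.
    by rewrite val_lt_irr.
  have -> : a / w = a / (a - b) * v.
    by apply: (mulIf w0); rewrite divfK // -[RHS]mulrA [v * w]mulrC -e divfK.
  by apply: VM => //; apply: val_lt_sub.
move=> z z' zs z's ne v Vv; have [lt|lt] := lt_ss _ _ zs z's ne; first exact: key.
rewrite -eqr_opp opprB -mulrN; apply: key => //.
exact: subringN.
Qed.

Variable y : K.
Hypotheses (Vy : V y) (nVy : ~ V y^-1).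

Let y0 : y != 0.
Proof. by apply: contra_not_neq nVy => ->; rewrite invr0; apply: subring0 sV. Qed.

(** [pi] is the first element of a longest chain of values strictly between 1 and [y], or [y] itself
    if that chain is empty. A value strictly between those of 1 and [pi] would lengthen the
    chain. *)
Lemma val_uniformizer : exists pi : K, [/\ V pi, ~ V pi^-1 &
  forall a, V a -> ~ V a^-1 -> V (a / pi)].
Proof.
have [M hM] := val_chain_bound Vy.
have y1 : val_lt 1 y by apply: val_lt_total; rewrite mul1r.
pose P k := `[< exists s : seq K, size s = k /\ path val_lt 1 (rcons s y) >].
have Vlt1 a : val_lt 1 a -> V a by move=> /val_ltP[]; rewrite divr1.
have chainV s : path val_lt 1 (rcons s y) -> forall z, z \in s -> V z.
  move=> /(order_path_min val_lt_trans)/allP h z zs; apply/Vlt1/h.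
  by rewrite mem_rcons inE zs orbT.
have P0 : exists k, P k by exists 0%N; apply/asboolP; exists [::]; split=> //=; rewrite y1.
have Pub k : P k -> (k <= M)%N.
  move=> /asboolP[s [<- ps]]; apply: hM; first exact: chainV.
  exact: path_sorted ps.
case: (ex_maxnP P0 Pub) => k /asboolP[s [ss ps]] maxk.
case es : (rcons s y) ps => [|pi s'] /=; first by case: (s) es.
move=> /andP[lt1 ps']; exists pi; split.
- exact: Vlt1.
- by move/val_ltP: lt1; rewrite mul1r => -[].
move=> a Va nVa; apply: contrapT => /val_lt_total api.
have : P k.+1.
  apply/asboolP; exists (a :: s); rewrite /= ss es /=; split=> //.
  by rewrite api ps' !andbT; apply: val_lt_total; rewrite mul1r.
by move/maxk; rewrite ltnn.
Qed.

(** Otherwise the powers of [pi] form arbitrarily long chains below [x], against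
    [val_chain_bound]. *)
Lemma val_archimedean pi x : V pi -> ~ V pi^-1 -> V x -> x != 0 ->
  exists n : nat, ~ V (x / pi ^+ n).
Proof.
move=> Vpi nVpi Vx x0; have [M hM] := val_chain_bound Vx.
apply: contrapT => no; have all_n n : V (x / pi ^+ n).
  by apply: contrapT => h; apply: no; exists n.
have pi0 : pi != 0 by apply: contra_not_neq nVpi => ->; rewrite invr0; apply: subring0 sV.
have VX n : V (pi ^+ n) by apply: subringX.
have step n : val_lt (pi ^+ n) (pi ^+ n.+1).
  apply: val_lt_total; have -> : pi ^+ n / pi ^+ n.+1 = pi^-1; last by [].
  by rewrite exprS invfM mulrCA divff ?mulr1 // expf_neq0.
have lt_x n : val_lt (pi ^+ n) x.
  apply: val_lt_total => h; apply: nVpi.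
  have -> : pi^-1 = pi ^+ n / x * (x / pi ^+ n.+1); last by apply: VM.
  by rewrite mulrA divfK // exprS invfM mulrCA divff ?mulr1 // expf_neq0.
have := hM [seq pi ^+ n | n <- iota 0 M.+1].
rewrite size_map size_iota ltnn => h; suff: false by []; apply: h.
  by move=> z /mapP[n _ ->].
have : path val_lt (pi ^+ 0) (rcons [seq pi ^+ n | n <- iota 1 M] x).
  elim: M 0%N {hM} => [|m IH] i /=; first by rewrite lt_x.
  by rewrite step IH.
by [].
Qed.

(** Every nonzero element is a unit of [V] times a unique power of [pi], and the exponent is the
    valuation. *)
Lemma place_of_valuation_ring : exists p : place K, forall x, x != 0 -> V x <-> 0 <= p x.
Proof.
have [pi [Vpi nVpi pimin]] := val_uniformizer.
have pi0 : pi != 0 by apply: contra_not_neq nVpi => ->; rewrite invr0; apply: subring0 sV.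
pose unit u := V u /\ V u^-1.
have unitM u v : unit u -> unit v -> unit (u * v).
  by move=> [h1 h2] [h3 h4]; split; rewrite ?invfM; apply: VM.
have unitV u : unit u -> unit u^-1 by move=> [h1 h2]; split; rewrite ?invrK.
have VXz (k : int) : 0 <= k -> V (pi ^ k) by case: k => // k _; apply: subringX.
have ex x : x != 0 -> exists k : int, unit (x / pi ^ k).
  have exV z : z != 0 -> V z -> exists k : int, unit (z / pi ^ k).
    move=> z0 Vz; have [n0 hn0] := val_archimedean Vpi nVpi Vz z0.
    have exn : exists n, `[< ~ V (z / pi ^+ n) >] by exists n0; apply/asboolP.
    case: (ex_minnP exn) => -[/asboolP|n /asboolP hn minn].
      by rewrite expr0 divr1.
    have Vn : V (z / pi ^+ n).
      apply: contrapT => h; have := minn n; rewrite ltnn => f.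
      by suff: false by []; apply: f; apply/asboolP.
    exists n; rewrite -exprnP; split=> //; apply: contrapT => nV; apply: hn.
    by have := pimin _ Vn nV; rewrite exprS invfM mulrA mulrAC.
  move=> x0; have [/(exV x x0)//|Vx] := Vtot x.
  have [|k [h1 h2]] := exV x^-1 _ Vx; first by rewrite invr_eq0.
  exists (- k); have e : x / pi ^ (- k) = (x^-1 / pi ^ k)^-1.
    by rewrite invf_div invrK -invr_expz invrK mulrC.
  by rewrite e; apply: unitV.
have uniq_k x (k l : int) : x != 0 -> unit (x / pi ^ k) -> unit (x / pi ^ l) -> k <= l.
  move=> x0 uk ul; rewrite leNgt; apply/negP => lk; apply: nVpi.
  have : unit (pi ^ (k - l)).
    have -> : pi ^ (k - l) = (x / pi ^ l) / (x / pi ^ k).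
      rewrite expfzDr // -invr_expz; field.
      by rewrite x0 !expfz_neq0.
    by apply: unitM => //; apply: unitV.
  have -> : k - l = (k - l - 1) + 1 by lia.
  rewrite expfzDr // expr1z => -[_]; rewrite invfM => h.
  have -> : pi^-1 = pi ^ (k - l - 1) * ((pi ^ (k - l - 1))^-1 * pi^-1).
    by rewrite mulrA divff ?mul1r // expfz_neq0.
  by apply: VM => //; apply: VXz; lia.
have /choice[v0 hv0] : forall x, exists k : int, x != 0 -> unit (x / pi ^ k).
  by move=> x; have [->|/ex[k hk]] := eqVneq x 0; [exists 0 | exists k].
pose v x := if x == 0 then 0 else v0 x.
have hv x : x != 0 -> unit (x / pi ^ v x).
  by move=> x0; rewrite /v (negPf x0); apply: hv0.
have vE x k : x != 0 -> unit (x / pi ^ k) -> v x = k.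
  move=> x0 hk; apply/eqP; rewrite eq_le; apply/andP; split; apply: (uniq_k x) => //;
    exact: hv.
have vV x : x != 0 -> V x <-> 0 <= v x.
  move=> x0; have [h1 h2] := hv x x0; have pk : pi ^ v x != 0 by rewrite expfz_neq0.
  split=> [Vx|vx]; last first.
    by rewrite -[x](divfK pk); apply: VM => //; apply: VXz.
  rewrite leNgt; apply/negP => lt; apply: nVpi.
  have -> : pi^-1 = x * (x / pi ^ v x)^-1 * pi ^ (- v x - 1).
    rewrite expfzDr // -invr_expz; have -> : pi ^ (-1) = pi^-1 by [].
    by field; rewrite x0 pi0 !expfz_neq0.
  apply: VM; first exact: VM.
  by apply: VXz; lia.
have vM x z : x != 0 -> z != 0 -> v (x * z) = v x + v z.
  move=> x0 z0; apply: vE; first by rewrite mulf_neq0.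
  have -> : x * z / pi ^ (v x + v z) = (x / pi ^ v x) * (z / pi ^ v z).
    by rewrite expfzDr // invfM mulrACA.
  by apply: unitM; apply: hv.
have vpi : v pi = 1 by apply: vE => //; rewrite expr1z divff //; split; rewrite ?invr1.
have vadd x z : x != 0 -> z != 0 -> x + z != 0 -> v x <= v z -> v x <= v (x + z).
  move=> x0 z0 xz0 le.
  have vdiv a b : a != 0 -> b != 0 -> v (a / b) = v a - v b.
    move=> a0 b0; have := vM (a / b) b; rewrite divfK // => -> //; first by rewrite addrK.
    by rewrite mulf_neq0 ?invr_eq0.
  rewrite -subr_ge0 -vdiv //; apply/vV; first by rewrite mulf_neq0 ?invr_eq0.
  rewrite mulrDl divff //; apply: subringD => //; apply/vV.
    by rewrite mulf_neq0 ?invr_eq0.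
  by rewrite vdiv // subr_ge0.
have nv : normalized_valuation v.
  split=> //; first by rewrite /v eqxx.
    move=> x z x0 z0 xz0; have [le|/ltW le] := leP (v x) (v z); first exact: vadd.
    by rewrite addrC; apply: vadd => //; rewrite addrC.
  by exists pi.
by exists (Place (introT (asboolP _) nv)) => x x0; apply: vV.
Qed.

End Discrete.

End ValuationRings.

(** * Places of a function field *)

Section Counting.
Variable V : zmodType.
Implicit Types (S T U : V -> Prop).

Definition card_le (X : eqType) (S : X -> Prop) (n : nat) :=
  forall s : seq X, uniq s -> (forall x, x \in s -> S x) -> (size s <= n)%N.

Lemma finite_of_card_le (X : eqType) (S : X -> Prop) n : card_le S n ->
  exists s : seq X, uniq s /\ forall x, x \in s <-> S x.
Proof.
move=> hn; pose P k := `[< exists s : seq X, [/\ size s = k, uniq s & forall x, x \in s -> S x] >].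
have P0 : exists k, P k by exists 0%N; apply/asboolP; exists [::].
have Pub k : P k -> (k <= n)%N by move=> /asboolP[s [<- us Ss]]; apply: hn.
case: (ex_maxnP P0 Pub) => k /asboolP[s [sk us Ss]] maxk; exists s; split=> // x.
split=> [|Sx]; first exact: Ss.
apply: contraT => xs; have : P k.+1.
  apply/asboolP; exists (x :: s); rewrite /= sk xs us; split=> // y.
  by rewrite inE => /orP[/eqP->|/Ss].
by move/maxk; rewrite ltnn.
Qed.

Lemma card_le_seq (X : eqType) (S : X -> Prop) (s : seq X) :
  (forall x, S x -> x \in s) -> card_le S (size s).
Proof. by move=> h s' us' Ss'; apply: uniq_leq_size => // x /Ss'/h. Qed.

(* Cardinalities stand for dimensions over the finite field of constants: [covers S T n]
   means that the index of [T] in [S] is at most [n]. *)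
Definition covers S T (n : nat) :=
  exists2 s : seq V, (size s <= n)%N & forall x, S x -> exists2 r, r \in s & T (x - r).

Lemma covers_trans S T U n m : covers S T n -> covers T U m -> covers S U (n * m).
Proof.
move=> [s sn hs] [s' sm hs']; exists [seq x + y | x <- s, y <- s'].
  by rewrite size_allpairs leq_mul.
move=> x /hs[r rs /hs'[r' rs' h]]; exists (r + r'); first exact: allpairs_f.
by rewrite opprD addrA.
Qed.

Lemma covers_fin S T (R : finType) (phi : V -> R) :
  (forall x y, S x -> S y -> phi x = phi y -> T (x - y)) -> covers S T #|R|.
Proof.
move=> h; have /choice[rep hrep] : forall r : R, exists x, (exists2 y, S y & phi y = r) -> S x /\ phi x = r.
  move=> r; have [[y Sy py]|no] := pselect (exists2 y, S y & phi y = r).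
    by exists y.
  by exists 0.
exists [seq rep r | r : R]; first by rewrite size_map -cardE.
move=> x Sx; have [|Sr pr] := hrep (phi x); first by exists x.
by exists (rep (phi x)); [apply: map_f; rewrite mem_enum | apply: h].
Qed.

Lemma card_le_covers S T n m : (forall x y, T x -> T y -> T (x - y)) ->
  covers S T n -> card_le T m -> card_le S (n * m).
Proof.
move=> TB [s sn hs] hm s' us' Ss'; apply: leq_trans (leq_mul sn (leqnn m)).
have {hs Ss'} : forall x, x \in s' -> exists2 r, r \in s & T (x - r).
  by move=> x xs; apply: hs; apply: Ss'.
elim: s s' us' {sn} => [|r s IH] s' us' hs.
  by case: s' us' hs => // x s' _ /(_ x (mem_head _ _))[].
pose f x := `[< T (x - r) >].
rewrite -(count_predC f s') mulSn; apply: leq_add.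
  rewrite -size_filter; case e : (filter f s') => [//|x0 s0].
  have x0f : x0 \in filter f s' by rewrite e mem_head.
  rewrite -e -(size_map (fun x => x - x0)); apply: hm.
    by rewrite map_inj_uniq ?filter_uniq // => x y /addIr.
  move=> _ /mapP[x + ->]; rewrite mem_filter => /andP[/asboolP Tx _].
  move: x0f; rewrite mem_filter => /andP[/asboolP Tx0 _].
  have -> : x - x0 = (x - r) - (x0 - r) by rewrite opprB addrA subrK.
  exact: TB.
rewrite -size_filter; apply: IH; first exact: filter_uniq.
move=> x; rewrite mem_filter => /andP[/= nf /hs[r']]; rewrite inE => /orP[/eqP->|r's] Tx.
  by move/negP: nf => []; apply/asboolP.
by exists r'.
Qed.

End Counting.

Section FunctionFieldPlaces.
Variables (F : finFieldType) (K : fieldExtType {fraction {poly F}}).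
Local Notation cst := (@constK F K).
Implicit Types (p : place K) (x y z : K).

Lemma constK_is_zmod_morphism : zmod_morphism cst.
Proof. by move=> a b; rewrite /constK polyCB rmorphB scalerBl. Qed.

Lemma constK_is_monoid_morphism : monoid_morphism cst.
Proof.
split; first by rewrite /constK polyC1 rmorph1 scale1r.
by move=> a b; rewrite /constK polyCM rmorphM -scalerAl mul1r scalerA.
Qed.

HB.instance Definition _ := GRing.isZmodMorphism.Build F K cst constK_is_zmod_morphism.
HB.instance Definition _ := GRing.isMonoidMorphism.Build F K cst constK_is_monoid_morphism.

(** A nonzero constant is a root of unity of order dividing [#|F| - 1]; the constant 0 has order 0
    by the convention of [normalized_valuation]. *)
Lemma ord_constK p (c : F) : p (cst c) = 0.
Proof.
have [->|c0] := eqVneq c 0; first by rewrite rmorph0; have [-> _ _ _] := placeP p.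
apply: (@ord_torsion _ p _ #|F|.-1); first by rewrite -subn1 subn_gt0 finRing_gt1.
rewrite -rmorphXn; suff -> : c ^+ #|F|.-1 = 1 by rewrite rmorph1.
apply: (mulIf c0); by rewrite mul1r -exprSr prednK ?expf_card // (ltn_trans _ (finRing_gt1 F)).
Qed.

Lemma ord_ge_constK p (c : F) : ord_ge p 0 (cst c).
Proof. by rewrite /ord_ge ord_constK lexx orbT. Qed.

Lemma constK_eq0 (c : F) : (cst c == 0) = (c == 0).
Proof. exact: fmorph_eq0. Qed.

(** [x] is not in $F[1/x]$, else it would be algebraic over $F$ and hence constant. Chevalley's
    theorem extends $F[1/x]$ to a valuation ring avoiding [x], and [incongruent_bound] makes this
    ring discrete. *)
Lemma pole_of_nonconstant x : full_constant_field K ->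
  (forall c, x != cst c) -> exists p : place K, p x < 0.
Proof.
move=> full nc.
have x0 : x != 0 by rewrite -(rmorph0 cst); apply: nc.
pose R0 := fun w : K => exists h : {poly F}, w = (map_poly cst h).[x^-1].
have sR0 : is_subring R0.
  split=> [|_ _ [g ->] [h ->]|_ _ [g ->] [h ->]].
  - by exists 1; rewrite rmorph1 hornerC.
  - by exists (g - h); rewrite rmorphB hornerD hornerN.
  - by exists (g * h); rewrite rmorphM hornerM.
have R0y : R0 x^-1 by exists 'X; rewrite map_polyX hornerX.
have nR0x : ~ R0 x.
  move=> [h xh]; set n := size h.
  have [|c xc] := full x; last by move/eqP: xc; apply/negP.
  (* The equation satisfied by [x] after multiplying [x = h(1/x)] by [x ^+ n]. *)
  exists ('X^(n.+1) - \sum_(i < n) h`_i *: 'X^(n - i)).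
    apply: contraTneq (oner_neq0 F) => /(congr1 (fun g : {poly F} => g`_n.+1)).
    rewrite coefB coefXn eqxx coef_sum big1 ?subr0 ?coef0 => [/eqP|i _].
      by rewrite oner_eq0.
    rewrite coefZ coefXn; case: eqP => [|_]; last by rewrite mulr0.
    have := ltn_ord i; lia.
  rewrite /root rmorphB /= map_polyXn rmorph_sum hornerD hornerN hornerXn horner_sum.
  rewrite exprSr {2}xh horner_coef size_map_poly mulr_sumr subr_eq0; apply/eqP.
  apply: eq_bigr => i _; rewrite coef_map /= map_polyZ hornerZ map_polyXn hornerXn.
  rewrite mulrCA; congr (_ * _).
  have -> : x ^+ n = x ^+ (n - i) * x ^+ i by rewrite -exprD subnK // ltnW.
  by rewrite exprVn mulfK // expf_neq0.
have [V [sV Vy nVx Vtot]] := chevalley sR0 R0y nR0x.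
have [|//||p pV] := @place_of_valuation_ring _ V sV Vtot _ x^-1.
- move=> w w0 Vw; have [M hM] := incongruent_bound w0; exists M => Z uZ VZ incon.
  have [_ VB VM] := sV.
  by apply: (hM V) => // u Vu; apply: VM.
- by rewrite invrK.
by exists p; rewrite ltNge; apply/negP => /(pV x x0).
Qed.

Lemma constant_of_no_pole x : full_constant_field K ->
  (forall p : place K, 0 <= p x) -> exists c, x = cst c.
Proof.
move=> full h; apply: contrapT => no.
have [|p] := pole_of_nonconstant full (x := x); last by rewrite ltNge h.
by move=> c; apply/eqP => xc; apply: no; exists c.
Qed.

(** Approximate idempotents attached to distinct zeros of [x] are pairwise incongruent modulo [x] in
    the semilocal ring of those zeros, so [incongruent_bound] limits their number. *)
Lemma finitely_many_zeros x : x != 0 ->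
  exists s : seq (place K), forall p : place K, 0 < p x -> p \in s.
Proof.
move=> x0; have [M hM] := incongruent_bound x0.
suff /finite_of_card_le[s [_ hs]] : card_le (fun p : place K => 0 < p x) M.
  by exists s => p /hs.
move=> s us zs.
have /choice[u hu] : forall p : place K, exists z, forall p', p' \in s ->
    ord_ge p' 1 (z - (p' == p)%:R).
  by move=> p; have [z hz] := weak_approximation (fun p' => (p' == p)%:R) 1 us; exists z.
have incon p p' w : p \in s -> p' \in s -> p != p' -> u p - u p' = w -> ~ ord_ge p 1 w.
  move=> ps p's ne <- h.
  have h1 := hu p p ps; have h2 := hu p' p ps.
  rewrite eqxx in h1; rewrite (negPf ne) subr0 in h2.
  have := ord_geD (ord_geB h h1) h2.
  have -> : u p - u p' - (u p - 1) + u p' = 1 by ring.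
  by rewrite ord_geE ?oner_neq0 // Defs.ord1.
rewrite -(size_map u).
apply: (hM (fun z => forall p, p \in s -> ord_ge p 0 z)).
- by move=> a b ha hb p ps; apply: ord_geB; [apply: ha | apply: hb].
- move=> a ha p ps; rewrite -[0]addr0; apply: ord_geM; last exact: ha.
  by rewrite ord_geE // ltW // zs.
- rewrite map_inj_in_uniq // => p p' ps p's e; apply/eqP; apply: contraT => ne.
  by exfalso; apply: (incon p p' 0 ps p's ne); rewrite ?e ?subrr.
- move=> _ /mapP[p ps ->] p' p's; have := hu p p' p's => h.
  rewrite -[u p](subrK (p' == p)%:R); apply: ord_geD; first exact: ord_geW h.
  by case: eqP => _ //; rewrite ord_geE ?oner_neq0 // Defs.ord1.
move=> _ _ /mapP[p ps ->] /mapP[p' p's ->] ne w Bw; apply/negP => /eqP e.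
have pp' : p != p' by apply: contraNneq ne => ->.
apply: (incon p p' (x * w) ps p's pp' e); rewrite -[1]addr0.
by apply: ord_geM; [rewrite ord_geE // -gtz0_ge1 zs | apply: Bw].
Qed.

Lemma finite_support x : x != 0 ->
  exists s : seq (place K), forall p : place K, p x != 0 -> p \in s.
Proof.
move=> x0; have [s hs] := finitely_many_zeros x0.
have xV0 : x^-1 != 0 by rewrite invr_eq0.
have [s' hs'] := finitely_many_zeros xV0.
exists (s ++ s') => p; rewrite neq_lt mem_cat => /orP[px|/hs->//].
by rewrite hs' ?orbT // ordV // oppr_gt0.
Qed.

Lemma divisor_of_function (f : place K -> int) (s : seq (place K)) :
  (forall p, f p != 0 -> p \in s) -> exists D : divisor K, forall p, coeff p D = f p.
Proof.
move=> fs; exists (\sum_(p <- undup s) << f p *g p >>) => p.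
rewrite raddf_sum /=; under eq_bigr do rewrite coeffU.
have [ps|ps] := boolP (p \in undup s).
  rewrite (bigD1_seq p) ?undup_uniq //= eqxx mulr1 big1 ?addr0 // => q /negPf ->.
  by rewrite mulr0.
rewrite big_seq big1 => [|q qs].
  by apply/esym/eqP; apply: contraNT ps => /fs; rewrite mem_undup.
by case: eqP qs ps => [-> ->|_ _ _]; rewrite ?mulr0.
Qed.

Lemma has_divisor x : x != 0 -> exists D : divisor K, is_div D x.
Proof. by move=> x0; have [s hs] := finite_support x0; apply: divisor_of_function hs. Qed.

Lemma residue_bound p : exists M : nat, forall Z : seq K, uniq Z ->
  (forall z, z \in Z -> ord_ge p 0 z) ->
  (forall z z', z \in Z -> z' \in Z -> z != z' -> ~~ ord_ge p 1 (z - z')) ->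
  (size Z <= M)%N.
Proof.
have [u u0 pu] := uniformizer p; have [M hM] := incongruent_bound u0; exists M.
move=> Z uZ OZ incon; apply: (hM (fun z => ord_ge p 0 z)) => //.
- by move=> a b; apply: ord_geB.
- move=> a Oa; rewrite -[0]addr0; apply: ord_geM => //; by rewrite ord_geE // pu.
move=> z z' zZ z'Z ne w Ow; apply: contraNneq (incon z z' zZ z'Z ne) => ->.
by rewrite -[1]addr0; apply: ord_geM => //; rewrite ord_geE // pu.
Qed.

(** A longest family independent modulo the maximal ideal exists, because its [#|F| ^ d] incongruent
    combinations obey [residue_bound]. So [place_deg] is the size of an actual basis and not the
    default value of [xget]. *)
Lemma residue_basis_exists p : exists d (w : 'I_d -> K), residue_basis p w.
Proof.
pose indep d (w : 'I_d -> K) := (forall i, ord_ge p 0 (w i)) /\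
  forall c : 'rV[F]_d, ord_ge p 1 (\sum_i cst (c 0 i) * w i) -> c = 0.
pose comb d (w : 'I_d -> K) (c : 'rV[F]_d) := \sum_i cst (c 0 i) * w i.
have combB d (w : 'I_d -> K) c c' : comb d w c - comb d w c' = comb d w (c - c').
  by rewrite /comb -sumrB; apply: eq_bigr => i _; rewrite !mxE rmorphB mulrBl.
have combO d (w : 'I_d -> K) c : (forall i, ord_ge p 0 (w i)) -> ord_ge p 0 (comb d w c).
  move=> Ow; apply: ord_ge_sum => i _; rewrite -[0]addr0; apply: ord_geM => //.
  exact: ord_ge_constK.
pose P d := `[< exists w : 'I_d -> K, indep d w >].
have P0 : exists d, P d.
  exists 0%N; apply/asboolP; exists (fun=> 0); split=> // c _.
  by apply/rowP => -[].
have [M hM] := residue_bound p.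
have Pub d : P d -> (d <= M)%N.
  move=> /asboolP[w [Ow iw]].
  apply: leq_trans (ltnW (ltn_expl d (finRing_gt1 F))) _.
  have -> : (#|F| ^ d = size [seq comb d w c | c : 'rV[F]_d])%N.
    by rewrite size_map -cardE card_mx mul1n.
  have cinj c c' : ord_ge p 1 (comb d w c - comb d w c') -> c = c'.
    by rewrite combB => /iw/eqP; rewrite subr_eq0 => /eqP.
  apply: hM.
  - rewrite map_inj_uniq ?enum_uniq // => c c' e; apply: cinj.
    by rewrite e subrr ord_ge0.
  - by move=> _ /mapP[c _ ->]; apply: combO.
  - move=> _ _ /mapP[c _ ->] /mapP[c' _ ->]; apply: contraNN => /cinj ->; exact: eqxx.
case: (ex_maxnP P0 Pub) => d /asboolP[w [Ow iw]] maxd.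
exists d, w; split=> // x Ox.
suff [c hc] : exists c, ord_ge p 1 (x - comb d w c).
  exists c; split=> // c' hc'; apply/eqP; rewrite -subr_eq0; apply/eqP/iw.
  have -> : \sum_i cst ((c - c') 0 i) * w i = (x - comb d w c') - (x - comb d w c).
    by rewrite -[LHS]/(comb d w (c - c')) -combB; ring.
  exact: ord_geB.
pose w' (i : 'I_d.+1) := if unlift ord0 i is Some j then w j else x.
have : ~ indep d.+1 w'.
  by move=> h; have : P d.+1 by [apply/asboolP; exists w']; move/maxd; rewrite ltnn.
move=> /not_andP[|].
  by case=> i; rewrite /w'; case: unlift.
move=> /existsNP[c /not_implyP[]].
rewrite big_ord_recl {1}/w' unlift_none.
have -> : \sum_(i < d) cst (c 0 (fintype.lift ord0 i)) * w' (fintype.lift ord0 i) =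
    comb d w (\row_i c 0 (fintype.lift ord0 i)).
  by apply: eq_bigr => i _; rewrite mxE /w' liftK.
set c1 := \row_i _; move=> h1 c0.
have c00 : c 0 ord0 != 0.
  apply: contra_not_neq c0 => e; move: h1; rewrite e rmorph0 mul0r add0r => /iw c10.
  apply/rowP => i; case: (unliftP ord0 i) => [j ->|->]; last by rewrite e mxE.
  by have := congr1 (fun c : 'rV[F]_d => c 0 j) c10; rewrite !mxE.
exists (- (c 0 ord0)^-1 *: c1).
have -> : comb d w (- (c 0 ord0)^-1 *: c1) = - cst (c 0 ord0)^-1 * comb d w c1.
  rewrite /comb mulr_sumr; apply: eq_bigr => i _; rewrite mxE rmorphM rmorphN mulrA //.
rewrite mulNr opprK -[x]mul1r -(rmorph1 cst) -(mulVf c00) rmorphM -mulrA -mulrDr.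
by rewrite -[1%R]add0r; apply: ord_geM => //; apply: ord_ge_constK.
Qed.

Lemma place_degP p : exists w : 'I_(place_deg p) -> K, residue_basis p w.
Proof.
have [d [w hw]] := residue_basis_exists p.
by apply: (@xgetPex _ 0%N [set d | exists w : 'I_d -> K, residue_basis p w]%classic); exists d, w.
Qed.

Lemma place_deg_gt0 p : (0 < place_deg p)%N.
Proof.
have [w [_ hw]] := place_degP p; rewrite lt0n; apply/eqP => d0; move: w hw.
rewrite d0 => w hw; have [|c [hc _]] := hw 1; first by rewrite ord_geE ?oner_neq0 ?Defs.ord1.
by move: hc; rewrite big_ord0 subr0 ord_geE ?oner_neq0 ?Defs.ord1.
Qed.

Lemma residue_reps p : exists f : 'rV[F]_(place_deg p) -> K,
  [/\ forall c, ord_ge p 0 (f c),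
      forall c c', ord_ge p 1 (f c - f c') -> c = c' &
      forall x, ord_ge p 0 x -> exists c, ord_ge p 1 (x - f c)].
Proof.
have [w [Ow hw]] := place_degP p.
exists (fun c => \sum_i cst (c 0 i) * w i).
have O (c : 'rV[F]_(place_deg p)) : ord_ge p 0 (\sum_i cst (c 0 i) * w i).
  apply: ord_ge_sum => i _; rewrite -[0]addr0; apply: ord_geM => //.
  exact: ord_ge_constK.
split=> // [c c' h|x /hw[c [hc _]]]; last by exists c.
have [c1 [_ h1]] := hw _ (O c); rewrite -(h1 c) ?subrr ?ord_ge0 //.
exact: h1.
Qed.

End FunctionFieldPlaces.

(** * Divisors and Riemann-Roch spaces *)

Section Divisors.
Variables (F : finFieldType) (K : fieldExtType {fraction {poly F}}).
Local Notation cst := (@constK F K).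
Local Notation q := #|F|.
Implicit Types (p : place K) (x y z : K) (D E : divisor K).

Lemma div_degE D (s : seq (place K)) : uniq s -> {subset dom D <= s} ->
  div_deg D = \sum_(p <- s) coeff p D * (place_deg p)%:Z.
Proof.
move=> us sub; rewrite /div_deg [RHS](bigID (fun p => p \in dom D)) /=.
rewrite [X in _ + X]big1 ?addr0; last by move=> p /coeff_outdom ->; rewrite mul0r.
rewrite -[RHS]big_filter; apply: perm_big; apply: uniq_perm; rewrite ?filter_uniq ?uniq_dom //.
move=> p; rewrite mem_filter; case pD : (p \in dom D) => //=; by rewrite sub.
Qed.

Lemma div_deg_is_zmod_morphism : zmod_morphism (@div_deg F K).
Proof.
move=> D E; pose s := undup (dom D ++ dom E).
have us : uniq s by apply: undup_uniq.
rewrite !(@div_degE _ s) // -?sumrB.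
- by apply: eq_bigr => p _; rewrite coeffB mulrBl.
- by move=> p pE; rewrite mem_undup mem_cat pE orbT.
- by move=> p pD; rewrite mem_undup mem_cat pD.
- by move=> p /domB; rewrite mem_undup.
Qed.

HB.instance Definition _ :=
  GRing.isZmodMorphism.Build (divisor K) int (@div_deg F K) div_deg_is_zmod_morphism.

Lemma div_degU (k : int) p : div_deg << k *g p >> = k * (place_deg p)%:Z.
Proof.
rewrite (@div_degE _ [:: p]) // ?big_seq1 ?coeffU ?eqxx ?mulr1 // => p'.
by rewrite mem_dom coeffU inE [p' == p]eq_sym; case: (p == p'); rewrite // mulr0 eqxx.
Qed.

Definition effective D := forall p, 0 <= coeff p D.

Lemma div_deg_ge0 D : effective D -> 0 <= div_deg D.
Proof. by move=> eD; apply: sumr_ge0 => p _; apply: mulr_ge0. Qed.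

Lemma effective_deg0 D : effective D -> div_deg D <= 0 -> D = 0.
Proof.
move=> eD; rewrite le_eqVlt ltNge div_deg_ge0 // orbF => dD.
apply/eqP/freeg_eqP => p; rewrite coeff0; apply/eqP; apply: contraT => pD.
have pdom : p \in dom D by rewrite mem_dom.
move: dD; rewrite /div_deg psumr_eq0; last by move=> p' _; apply: mulr_ge0.
move/allP => /(_ p pdom); rewrite mulf_eq0 (negPf pD) /= => dp.
by have := place_deg_gt0 p; rewrite lt0n -(eqr_nat int) natz dp.
Qed.

Lemma pic_class_eq0 D : pic_class D = 0 <-> exists2 x, x != 0 & is_div D x.
Proof.
have -> : 0 = pic_class (0 : divisor K) by rewrite /pic_class raddf0.
split.
  move=> /eqP; rewrite /pic_class -Quotient.idealrBE subr0; by move/asboolP.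
move=> h; apply/eqP; rewrite /pic_class -Quotient.idealrBE subr0; exact/asboolP.
Qed.

Lemma pic_class_is_zmod_morphism : zmod_morphism (@pic_class K).
Proof. by move=> D E; rewrite /pic_class raddfB. Qed.

HB.instance Definition _ :=
  GRing.isZmodMorphism.Build (divisor K) (Pic K) (@pic_class K) pic_class_is_zmod_morphism.

Lemma pic_class_surj (c : Pic K) : exists D, pic_class D = c.
Proof. by exists (repr c); rewrite /pic_class reprK. Qed.

Lemma pic_class_eq D E : pic_class D = pic_class E -> exists2 x, x != 0 & is_div (D - E) x.
Proof. by move=> e; apply/pic_class_eq0; rewrite raddfB /= e subrr. Qed.

Definition in_RR D x := forall p, ord_ge p (- coeff p D) x.

Lemma in_RR_B D x y : in_RR D x -> in_RR D y -> in_RR D (x - y).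
Proof. by move=> hx hy p; apply: ord_geB. Qed.

Lemma residue_class p (k : int) : exists phi : K -> 'rV[F]_(place_deg p),
  forall x y, ord_ge p k x -> ord_ge p k y -> phi x = phi y -> ord_ge p (k + 1) (x - y).
Proof.
have [f [_ _ hf]] := residue_reps p; have [u u0 pu] := uniformizer p.
have uk0 : u ^ k != 0 by rewrite expfz_neq0.
have puk : p (u ^ k) = k by rewrite ordXz // pu mulr1.
have /choice[phi hphi] : forall x, exists c, ord_ge p k x -> ord_ge p 1 (x / u ^ k - f c).
  move=> x; have [hx|nx] := boolP (ord_ge p k x); last by exists 0.
  have [|c hc] := hf (x / u ^ k); last by exists c.
  by rewrite -ord_ge_div // puk add0r.
exists phi => x y hx hy e; rewrite addrC -puk ord_ge_div // mulrBl.
have := ord_geB (hphi x hx) (hphi y hy); rewrite e.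
by congr (ord_ge _ _ _); ring.
Qed.

Lemma covers_RR_step D p : covers (in_RR D) (in_RR (D - << p >>)) (q ^ place_deg p).
Proof.
have [phi hphi] := residue_class p (- coeff p D).
rewrite -[place_deg p]mul1n -card_mx; apply: (covers_fin (phi := phi)).
move=> x y hx hy e p'; rewrite coeffB coeffU mul1r opprB addrC.
have [<-|_] := eqVneq p p'; first exact: hphi.
by rewrite addr0; apply: ord_geB.
Qed.

(** In terms of dimensions, [l(D) - l(D - E) <= deg E]: each place removed from [E] costs at most
    one copy of its residue field. *)
Lemma covers_RR D E n : effective E -> div_deg E = n%:Z ->
  covers (in_RR D) (in_RR (D - E)) (q ^ n).
Proof.
have [k] := ubnP n; elim: k => // k IH in n D E *; move=> nk eE dE.
have [E0|E0] := eqVneq E 0.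
  exists [:: 0]; first by rewrite expn_gt0 (ltn_trans _ (finRing_gt1 F)).
  by move=> x hx; exists 0; rewrite ?mem_head // E0 !subr0.
have [p pE] : exists p, 0 < coeff p E.
  apply: contrapT => no; move/eqP: E0; apply; apply/eqP/freeg_eqP => p.
  rewrite coeff0; apply/eqP; rewrite eq_le eE andbT leNgt; apply/negP => h.
  by apply: no; exists p.
have dp := place_deg_gt0 p.
have eE' : effective (E - << p >>).
  move=> p'; rewrite coeffB coeffU mul1r; have := eE p'.
  by case: eqP => [<-|_] /=; rewrite ?subr0 // => _; lia.
have dE' : div_deg (E - << p >>) = n%:Z - (place_deg p)%:Z.
  by rewrite raddfB /= dE div_degU mul1r.
have le : (place_deg p <= n)%N by have := div_deg_ge0 eE'; rewrite dE' subr_ge0.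
rewrite -(subnKC le) expnD; apply: covers_trans (covers_RR_step D p) _.
have -> : D - E = D - << p >> - (E - << p >>) by rewrite opprB addrA subrK.
apply: IH => //; first by lia.
by rewrite dE'; lia.
Qed.

Lemma card_le_RR D E n m : (forall p, coeff p D <= coeff p E) ->
  div_deg E - div_deg D = n%:Z -> card_le (in_RR D) m -> card_le (in_RR E) (q ^ n * m).
Proof.
move=> le dn; apply: card_le_covers; first exact: in_RR_B.
have -> : D = E - (E - D) by rewrite opprB addrC subrK.
apply: covers_RR; last by rewrite raddfB.
by move=> p; rewrite coeffB subr_ge0.
Qed.

(** Chinese remaindering, one digit at a time: representatives for the exponents [e] are those for
    [e'], lower by one at [p], plus a residue digit carried by [u ^+ (e p).-1] at [p] and negligible
    at the other places of [s]. *)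
Lemma incongruent_family (s : seq (place K)) (e : place K -> nat) : uniq s ->
  exists Z : seq K, [/\ uniq Z, size Z = (q ^ (\sum_(p <- s) e p * place_deg p))%N,
    forall z, z \in Z -> forall p, p \in s -> ord_ge p 0 z &
    forall z z', z \in Z -> z' \in Z ->
      (forall p, p \in s -> ord_ge p (e p)%:Z (z - z')) -> z = z'].
Proof.
move=> us; have [n] := ubnP (\sum_(p <- s) e p); elim: n => // n IH in e *; move=> sn.
have [all0|] := boolP (all (fun p => e p == 0%N) s).
  exists [:: 0]; split=> //=.
  - by rewrite big_seq big1 // => p /(allP all0)/eqP ->.
  - by move=> z; rewrite inE => /eqP -> p _; rewrite ord_ge0.
  - by move=> z z'; rewrite !inE => /eqP -> /eqP ->.
move=> /allPn[p ps ep]; pose e' p' := if p' == p then (e p).-1 else e p'.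
have [|Z [uZ sZ OZ iZ]] := IH e'.
  have lt : (\sum_(p0 <- s) e' p0 < \sum_(p0 <- s) e p0)%N.
    rewrite (bigD1_seq p) //= [X in (_ < X)%N](bigD1_seq p) //= /e' eqxx -addSn leq_add //.
      by rewrite prednK // lt0n.
    by apply: leq_sum => p' _; case: eqP => // ->; lia.
  exact: leq_trans lt _.
have [f [Of fi _]] := residue_reps p; have [u u0 pu] := uniformizer p.
set M := (\sum_(p <- s) e p)%N.
have eM p' : p' \in s -> (e p' <= M)%N.
  by move=> p's; rewrite /M (bigD1_seq p') //= leq_addr.
have uk0 : u ^+ (e p).-1 != 0 by rewrite expf_neq0.
have puk : p (u ^+ (e p).-1) = (e p).-1%:Z by rewrite ordX // pu natz.
have /choice[x hx] : forall c, exists y, forall p', p' \in s ->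
    ord_ge p' M%:Z (y - if p' == p then f c * u ^+ (e p).-1 else 0).
  by move=> c; apply: (weak_approximation (fun p' => if p' == p then f c * u ^+ (e p).-1 else 0)).
have hxp c : ord_ge p (e p)%:Z (x c - f c * u ^+ (e p).-1).
  by have := hx c p ps; rewrite eqxx; apply: ord_geW; rewrite lez_nat eM.
have hxq c p' : p' \in s -> p' != p -> ord_ge p' (e p')%:Z (x c).
  move=> p's ne; have := hx c p' p's; rewrite (negPf ne) subr0; apply: ord_geW.
  by rewrite lez_nat eM.
have hfu c : ord_ge p (e p).-1%:Z (f c * u ^+ (e p).-1).
  by rewrite -[_%:Z]add0r; apply: ord_geM => //; rewrite ord_geE // puk.
have hxp' c : ord_ge p (e p).-1%:Z (x c).
  rewrite -[x c](subrK (f c * u ^+ (e p).-1)); apply: ord_geD => //.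
  by apply: ord_geW (hxp c); lia.
have key z z' c c' : z \in Z -> z' \in Z ->
    (forall p0, p0 \in s -> ord_ge p0 (e p0)%:Z (z + x c - (z' + x c'))) -> z = z' /\ c = c'.
  move=> zZ z'Z h; have ezz : z = z'.
    apply: iZ => // p' p's; have -> : z - z' = (z + x c - (z' + x c')) - (x c - x c') by ring.
    rewrite /e'; have [->|ne] := eqVneq p' p.
      apply: ord_geB; last exact: ord_geB.
      by apply: ord_geW (h p ps); lia.
    by apply: ord_geB; [apply: h | apply: ord_geB; apply: hxq].
  split=> //; apply: fi.
  have := h p ps; rewrite ezz => hp.
  rewrite -(@ord_ge_mul _ p 1 _ _ uk0) puk.
  have -> : 1 + (e p).-1%:Z = e p by lia.
  have -> : (f c - f c') * u ^+ (e p).-1 = (z' + x c - (z' + x c'))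
     - (x c - f c * u ^+ (e p).-1) + (x c' - f c' * u ^+ (e p).-1) by ring.
  by apply: ord_geD => //; apply: ord_geB.
pose R := [seq (z, c) | z <- Z, c <- enum 'rV[F]_(place_deg p)].
have memR z c : ((z, c) \in R) = (z \in Z).
  apply/allpairsP/idP => [[[z' c'] [/= h _ [-> _]]] //|zZ].
  by exists (z, c); rewrite mem_enum.
have injR : {in R &, injective (fun zc => zc.1 + x zc.2)}.
  move=> [z c] [z' c'] /=; rewrite !memR => zZ z'Z e1.
  have [|-> ->] // := key z z' c c' zZ z'Z.
  by move=> p' _; rewrite e1 subrr ord_ge0.
exists [seq zc.1 + x zc.2 | zc <- R]; split.
- rewrite map_inj_in_uniq //; apply: allpairs_uniq; rewrite ?enum_uniq //.
  by move=> [z c] [z' c'] _ _ /= [-> ->].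
- rewrite size_map size_allpairs sZ -cardE card_mx mul1n -expnD; congr (_ ^ _)%N.
  rewrite (bigD1_seq p) //= [RHS](bigD1_seq p) //= /e' eqxx.
  under eq_bigr => i ne do rewrite (negPf ne).
  by move: ep; case: (e p) => // k _; rewrite mulSn /= addnC addnA.
- move=> _ /mapP[[z c] /= + ->]; rewrite memR => zZ p' p's; apply: ord_geD; first exact: OZ.
  have [->|ne] := eqVneq p' p; first by apply: ord_geW (hxp' c).
  by apply: ord_geW (hxq c p' p's ne).
- move=> _ _ /mapP[[z c] /= + ->] /mapP[[z' c'] /= + ->]; rewrite !memR => zZ z'Z h.
  by have [-> ->] := key z z' c c' zZ z'Z h.
Qed.

Local Notation t := ((tofrac 'X)%:A : K).

Lemma t_neq0 : t != 0.
Proof. by rewrite scaler_eq0 oner_eq0 orbF tofrac_eq0 polyX_eq0. Qed.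

(* The easy half of [deg (t)_oo = [K : F(t)]]. *)
Lemma pole_divisor_t : exists T : divisor K,
  [/\ effective T, in_RR T t & div_deg T <= (\dim {:K})%:Z].
Proof.
have [s hs] := finite_support t_neq0.
have [|T hT] := @divisor_of_function _ _ (fun p => Num.max 0 (- p t)) s.
  move=> p hp; apply: hs; apply: contraNneq hp => ->; by rewrite oppr0 maxxx.
exists T; split.
- by move=> p; rewrite hT le_max lexx.
- by move=> p; rewrite hT ord_geE ?t_neq0 // lerNl le_max lexx orbT.
have [Z [uZ sZ OZ iZ]] := incongruent_family (fun p => `|coeff p T|%N) (uniq_dom T).
have eT : div_deg T = (\sum_(p <- dom T) `|coeff p T| * place_deg p)%N%:Z.
  rewrite /div_deg -natz natr_sum; apply: eq_bigr => p _; rewrite natz PoszM; congr (_ * _).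
  by rewrite gez0_abs // hT le_max lexx.
rewrite eT lez_nat -(leq_exp2l _ _ (finRing_gt1 F)) -sZ.
apply: (@incongruent_bound_invX F K (fun z => forall p, p \in dom T -> ord_ge p 0 z) Z t^-1) => //.
- by rewrite mulVf ?t_neq0.
- by move=> a b ha hb p pT; apply: ord_geB; [apply: ha | apply: hb].
- move=> a ha p pT; rewrite -[0]addr0; apply: ord_geM; last exact: ha.
  rewrite ord_geE ?invr_eq0 ?t_neq0 // ordV ?t_neq0 //.
  by move: pT; rewrite mem_dom hT; case: (leP 0 (- p t)) => //; rewrite eqxx.
move=> z z' zZ z'Z ne w Bw; apply: contraNneq ne => e; apply/eqP; apply: iZ => // p pT.
rewrite e -[X in ord_ge _ X]addr0; apply: ord_geM; last exact: Bw.
rewrite ord_geE ?invr_eq0 ?t_neq0 // ordV ?t_neq0 //.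
move: pT; rewrite mem_dom hT; case: (leP 0 (- p t)) => [h _|]; last by rewrite eqxx.
by rewrite gez0_abs.
Qed.

End Divisors.

(** * The product formula and Riemann inequality *)

Section ProductFormula.
Variables (F : finFieldType) (K : fieldExtType {fraction {poly F}}).
Local Notation cst := (@constK F K).
Local Notation q := #|F|.
Local Notation N := (\dim {:K}).
Local Notation Pic0 := (@Pic0 F K).
Local Notation t := ((tofrac 'X)%:A : K).
Implicit Types (p : place K) (x y z : K) (D E : divisor K).

Hypothesis full : full_constant_field K.
Variables (m : nat) (C : 'I_m -> divisor K) (d : 'I_m -> nat).
Hypothesis smith : Pic0_smith C d.

Let e := (\prod_i d i)%N.

Let e_gt0 : (0 < e)%N.
Proof. by have [_ ho _] := smith; apply: prodn_gt0 => i; have [] := ho i. Qed.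

Let C_e i : pic_class (C i) *+ e = 0.
Proof. by have [_ /(_ i)[_ ho] _] := smith; apply/ho; rewrite /e (bigD1 i) //= dvdn_mulr. Qed.

Lemma Pic0_torsion c : Pic0 c -> c *+ e = 0.
Proof.
move=> c0; have [[_ h _] _ _] := smith; have [k ->] := h c c0.
rewrite -sumrMnl big1 // => i _; rewrite pmulrn -mulrzA mulrC mulrzA -pmulrn C_e.
by rewrite mul0rz.
Qed.

Lemma Pic0_finite : exists s : seq (Pic K), forall c, Pic0 c -> c \in s.
Proof.
exists [seq \sum_i pic_class (C i) *+ (k i) | k : {ffun 'I_m -> 'I_e}].
move=> c c0; have [[_ h _] _ _] := smith; have [k ->] := h c c0.
have ez : e%:Z != 0 by rewrite eqz_nat -lt0n.
have lt i : (`|(k i %% e)%Z| < e)%N.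
  by rewrite -ltz_nat gez0_abs ?modz_ge0 // ltz_pmod // ltz_nat.
apply/mapP; exists [ffun i => Ordinal (lt i)]; first by rewrite mem_enum.
apply: eq_bigr => i _; rewrite ffunE /= {1}(divz_eq (k i) e) mulrzDr.
rewrite [(_ %/ _)%Z * _]mulrC mulrzA -pmulrn C_e mul0rz add0r pmulrn gez0_abs ?modz_ge0 //.
Qed.

(* Since [Pic0] is torsion, if [div x] had a nonzero degree then some multiple of a place
   would be principal, giving a nonconstant element without poles. *)
Lemma div_deg_principal x D : x != 0 -> is_div D x -> div_deg D = 0.
Proof.
move=> x0 Dx; apply/eqP; apply: contraT => dD.
have [p pD] : exists p, p \in dom D.
  case eD : (dom D) => [|p s]; last by exists p; rewrite mem_head.
  by move/eqP: eD dD; rewrite dom_eq0 => /eqP ->; rewrite raddf0 eqxx.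
have dp := place_deg_gt0 p.
(* A combination of [p] and [D] of degree zero. As [D] is principal, a torsion relation for [G]
   makes the multiple [k] of [p] alone principal, with [k] nonzero. *)
pose G : divisor K := << p >> *~ div_deg D - D *+ place_deg p.
have G0 : Pic0 (pic_class G).
  exists G => //; rewrite raddfB /= raddfMz raddfMn /= div_degU mul1r.
  by rewrite -mulrzl -mulr_natr intz natz subrr.
have := Pic0_torsion G0; rewrite -raddfMn => /pic_class_eq0[y y0 Dy].
pose k := div_deg D * e%:Z.
have k0 : k != 0 by rewrite mulf_neq0 // eqz_nat -lt0n.
have [z z0 Dz] : exists2 z, z != 0 & is_div (<< p >> *~ k) z.
  exists (y * x ^+ (place_deg p * e)); first by rewrite mulf_neq0 ?expf_neq0.
  move=> p'; rewrite ordM ?expf_neq0 // ordX // -Dy -Dx -coeffMn -coeffD.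
  by rewrite /G mulrnBl -mulrnA subrK /k mulrzA pmulrn.
have coefz p' : p' z = k * (p == p')%:R.
  by rewrite -Dz freegU_mulz coeffU intz.
have [w [w0 wk wp]] : exists w, [/\ w != 0, p w != 0 & forall p', 0 <= p' w].
  have [k_ge|k_lt] := leP 0 k.
    exists z; split=> // [|p']; rewrite coefz ?eqxx ?mulr1 //.
    by apply: mulr_ge0; rewrite ?ler0n.
  exists z^-1; split=> [||p']; first by rewrite invr_eq0.
    by rewrite ordV // coefz eqxx mulr1 oppr_eq0.
  by rewrite ordV // coefz -mulNr mulr_ge0 ?ler0n // oppr_ge0 ltW.
have [c wc] := constant_of_no_pole full wp.
by move: wk; rewrite wc ord_constK eqxx.
Qed.

Lemma t_nonconstant (c : F) : t != cst c.
Proof.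
rewrite /constK; apply/negP => /eqP h.
have /eqP : tofrac ('X - c%:P) *: (1 : K) = 0 by rewrite rmorphB scalerBl h subrr.
by rewrite scaler_eq0 oner_eq0 orbF tofrac_eq0 polyXsubC_eq0.
Qed.

Lemma exists_place : exists p : place K, True.
Proof. by have [p _] := pole_of_nonconstant full t_nonconstant; exists p. Qed.

Lemma RR_neg_deg D x : div_deg D < 0 -> in_RR D x -> x = 0.
Proof.
move=> dD hx; apply/eqP; apply: contraT => x0; have [E hE] := has_divisor x0.
have : effective (D + E).
  by move=> p; rewrite coeffD hE -lerBlDl sub0r -ord_geE.
by move=> /div_deg_ge0; rewrite raddfD /= (div_deg_principal x0 hE) addr0 leNgt dD.
Qed.

Lemma RR_finite D : exists s : seq K, forall x, in_RR D x -> x \in s.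
Proof.
have [p _] := exists_place; have dp := place_deg_gt0 p.
(* Removing [k] copies of [p] makes the degree negative, where only 0 remains; [card_le_RR] then
   climbs back to [D]. *)
pose k := `|div_deg D|.+1; pose E : divisor K := << k%:Z *g p >>.
have dE : div_deg E = (k * place_deg p)%N%:Z by rewrite div_degU PoszM.
have cl : card_le (in_RR (D - E)) 1.
  move=> [|x [|y s]] //= /andP[xs _] h; exfalso; move: xs.
  have lt : div_deg (D - E) < 0 by rewrite raddfB /= dE /k; nia.
  have hx : x = 0 by apply: (RR_neg_deg lt); apply: h; rewrite mem_head.
  have hy : y = 0 by apply: (RR_neg_deg lt); apply: h; rewrite !inE eqxx orbT.
  by rewrite hx hy mem_head.
have : card_le (in_RR D) (q ^ (k * place_deg p) * 1).
  apply: card_le_RR cl => [p'|]; last by rewrite raddfB /= opprB addrC subrK.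
  rewrite coeffB gerBl coeffU; exact: mulr_ge0.
by move=> /finite_of_card_le[s [_ hs]]; exists s => x /hs.
Qed.

Lemma exists_in_RR (s : seq K) : exists2 W : divisor K, effective W &
  forall x, x \in s -> in_RR W x.
Proof.
elim: s => [|x s [W eW hW]]; first by exists 0 => // p; rewrite coeff0.
have [x0|x0] := eqVneq x 0.
  exists W => // y; rewrite inE => /orP[/eqP-> p|/hW//]; rewrite x0; exact: ord_ge0.
have [D hD] := has_divisor x0.
exists (W + fgneg D) => [p|y].
  by rewrite coeffD addr_ge0 // coeff_fgnegE oppr_ge0 ge_min lexx.
rewrite inE => /orP[/eqP-> p|/hW h p].
  rewrite ord_geE // -hD coeffD coeff_fgnegE opprD opprK.
  by rewrite -[leRHS]add0r lerD ?oppr_le0 // ge_min lexx orbT.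
apply: ord_geW (h p); rewrite coeffD coeff_fgnegE opprD opprK.
by rewrite gerDl ge_min lexx.
Qed.

(* With [W] absorbing the poles of a basis of [K] over [F(t)], the elements
   [\sum_i f_i(t) w_i], [deg f_i <= n], all lie in [L(W + nT)]. *)
Lemma RR_growth : exists W T : divisor K, [/\ effective W, effective T,
  div_deg T <= N%:Z & forall n k, card_le (in_RR (W + T *+ n)) k -> (q ^ (N * n.+1) <= k)%N].
Proof.
have [T [eT hT dT]] := pole_divisor_t K.
have [W eW hW] := exists_in_RR (vbasis {:K}).
exists W, T; split=> // n k hk.
pose f (M : 'M[F]_(N, n.+1)) : K :=
  \sum_i tofrac (\poly_(j < n.+1) (M i (inord j))) *: (vbasis {:K})`_i.
have finj : injective f.
  move=> M M' e1; apply/matrixP => i j.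
  have free := basis_free (vbasisP {:K}).
  have : tofrac (\poly_(j < n.+1) (M i (inord j))) = tofrac (\poly_(j < n.+1) (M' i (inord j))).
    have := congr1 (coord (vbasis {:K}) i) e1; by rewrite !coord_sum_free.
  move/eqP; rewrite tofrac_eq => /eqP/polyP/(_ j); rewrite !coef_poly ltn_ord.
  by rewrite inord_val.
have -> : (q ^ (N * n.+1) = size [seq f M | M : 'M[F]_(N, n.+1)])%N.
  by rewrite size_map -cardE card_mx.
apply: hk; first by rewrite map_inj_uniq ?enum_uniq.
move=> _ /mapP[M _ ->] p; rewrite /f; apply: ord_ge_sum => i _.
rewrite poly_def rmorph_sum scaler_suml; apply: ord_ge_sum => j _.
have -> : tofrac (M i (inord j) *: 'X^j) *: (vbasis {:K})`_i =
    cst (M i (inord j)) * (t ^+ j * (vbasis {:K})`_i).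
  rewrite -mul_polyC rmorphM rmorphXn /constK -scalerAl mul1r -scalerA.
  by rewrite exprZn expr1n -scalerAl mul1r.
rewrite -[- _]add0r; apply: ord_geM; first exact: ord_ge_constK.
rewrite coeffD opprD addrC coeffMn; apply: ord_geM.
  apply: (@ord_geW _ p _ ((- coeff p T) *+ j)); last by apply: ord_geX.
  by rewrite mulNrn lerN2 -[leLHS]mulr_natr -[leRHS]mulr_natr ler_wpM2l // ler_nat -ltnS.
by apply: hW; apply: mem_nth; rewrite size_tuple.
Qed.

(** Up to a principal divisor, [D] lies below [G = W + T *+ l], because [L(G)] is too large for
    [L(G - D1)] to vanish. Passing from [L(G)] down to [L(D)] loses at most the difference of
    degrees, and [deg T <= N] closes the count with [c = deg W]. *)
Lemma riemann : exists c : nat, forall D k n, card_le (in_RR D) k ->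
  n%:Z + c%:Z <= div_deg D -> (q ^ n <= k)%N.
Proof.
have q1 := finRing_gt1 F.
have [W [T [eW eT dT growth]]] := RR_growth; exists `|div_deg W|%N => D k n hk hn.
have dW := div_deg_ge0 eW; have dT0 := div_deg_ge0 eT.
have N1 : (0 < N)%N by rewrite adim_gt0.
pose D1 := fgpos D.
have eD1 : effective D1 by move=> p; rewrite coeff_fgposE le_max lexx.
have DD1 p : coeff p D <= coeff p D1 by rewrite coeff_fgposE le_max lexx orbT.
have [l dl] : exists l : nat, div_deg D1 = l by exists `|div_deg D1|%N; rewrite gez0_abs ?div_deg_ge0.
pose G := W + T *+ l.
have [z z0 hz] : exists2 z, z != 0 & in_RR (G - D1) z.
  apply: contrapT => no.
  have cl : card_le (in_RR (G - D1)) 1.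
    move=> [|x [|y s]] //= /andP[xs _] h; exfalso; move: xs.
    have z0 z : z \in [:: x, y & s] -> z = 0.
      by move=> zs; apply/eqP; apply: contraT => z0; exfalso; apply: no; exists z => //; apply: h.
    by rewrite (z0 x) ?mem_head // (z0 y) ?mem_head // !inE eqxx orbT.
  have big : card_le (in_RR G) (q ^ l * 1).
    apply: card_le_RR cl => [p|]; first by rewrite coeffB gerBl eD1.
    by rewrite raddfB /= opprB addrC subrK.
  by have := growth l _ big; rewrite muln1 leq_exp2l //; nia.
have [Z hZ] := has_divisor z0; pose G' := G + Z.
have dZ := div_deg_principal z0 hZ.
have DG p : coeff p D <= coeff p G'.
  apply: le_trans (DD1 p) _; rewrite /G' coeffD hZ.
  by have := hz p; rewrite ord_geE // coeffB opprB lerBlDl.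
have dG' : div_deg G' = div_deg W + div_deg T *+ l.
  by rewrite raddfD /= dZ addr0 raddfD raddfMn.
have [a da] : exists a : nat, div_deg G' - div_deg D = a.
  exists `|div_deg G' - div_deg D|%N; rewrite gez0_abs // -raddfB /=.
  by apply: div_deg_ge0 => p; rewrite coeffB subr_ge0.
have hG' : card_le (in_RR G') (q ^ a * k) by apply: card_le_RR hk.
have hG : card_le (in_RR G) (q ^ a * k).
  move=> s us hs; rewrite -(size_map (fun x => x / z)); apply: hG'.
    by rewrite map_inj_uniq // => x y /(mulIf (invr_neq0 z0)).
  move=> _ /mapP[x xs ->] p; rewrite /G' coeffD hZ opprD -ordV //.
  by apply: ord_geM; [apply: hs | apply: ord_ge_refl].
have le : (n + a <= N * l.+1)%N.
  rewrite -lez_nat PoszD -da dG' -mulr_natr natz PoszM mulrC.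
  move: hn dT; rewrite gez0_abs //; move: (div_deg W) (div_deg D) (div_deg T) => w x y h1 h2.
  have : y * l%:Z <= N%:Z * l%:Z by rewrite ler_wpM2r.
  nia.
have q0 := ltnW q1; have := leq_trans (leq_pexp2l q0 le) (growth l _ hG).
by rewrite expnD [(q ^ a * k)%N]mulnC leq_pmul2r // expn_gt0 q0.
Qed.

End ProductFormula.

(** * Local squares *)

Section LocalSquares.
Variables (F : finFieldType) (K : fieldExtType {fraction {poly F}}).
Local Notation cst := (@constK F K).
Implicit Types (p : place K) (x y z : K).
Hypothesis odd_char : 2%N \notin [pchar K].

Lemma two_neq0 : 2%:R != 0 :> K.
Proof. by move: odd_char; rewrite inE. Qed.

Lemma ord_two p : p 2%:R = 0.
Proof. by rewrite -(rmorph_nat cst) ord_constK. Qed.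

(** Finite-level form of being a square in $K_p$, for nonzero [x]: a square root up to a relative
    error of positive order, which is where Hensel's lemma starts in odd characteristic. *)
Definition near_square p x := exists c, ord_ge p (p x + 1) (c ^+ 2 - x).

Lemma near_square_root p x c : x != 0 -> ord_ge p (p x + 1) (c ^+ 2 - x) ->
  c != 0 /\ p x = p c *+ 2.
Proof.
move=> x0 hc; have := ord_add_dom x0 hc; rewrite subrKC => -[c20 pc2].
have c0 : c != 0 by move: c20; rewrite expf_eq0.
by rewrite -pc2 ordX.
Qed.

Lemma newton_step p x c (k : nat) : x != 0 -> (0 < k)%N -> ord_ge p (p x + k%:Z) (c ^+ 2 - x) ->
  exists c', ord_ge p (p x + k.+1%:Z) (c' ^+ 2 - x) /\ ord_ge p (p c + k%:Z) (c' - c).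
Proof.
move=> x0 k0 hc; have [c0 pxc] : c != 0 /\ p x = p c *+ 2.
  by apply: near_square_root x0 _; apply: ord_geW hc; lia.
have tc0 : 2%:R * c != 0 by rewrite mulf_neq0 ?two_neq0.
pose dl := (c ^+ 2 - x) / (2%:R * c).
(* [dl] is Newton's correction, and the new error is exactly [dl ^+ 2]. Dividing by [2 * c] costs
   only the order of [c], since 2 is a unit at [p]. *)
have hd : ord_ge p (p c + k%:Z) dl.
  rewrite -ord_ge_div // ordM ?two_neq0 // ord_two add0r; apply: ord_geW hc.
  by rewrite pxc mulr2n; lia.
exists (c - dl); split; last by rewrite addrAC subrr add0r ord_geN.
have -> : (c - dl) ^+ 2 - x = dl ^+ 2.
  by rewrite /dl; field; rewrite c0 two_neq0.
by apply: ord_geW (ord_geX 2 hd); rewrite pxc !mulr2n; lia.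
Qed.

Lemma near_square_hensel p x : x != 0 -> near_square p x ->
  exists u : nat -> K, cauchy p u /\ forall n, ord_ge p (p x + n.+1%:Z) (u n ^+ 2 - x).
Proof.
move=> x0 [c hc]; have /choice[g hg] : forall kc : nat * K, exists c',
    ord_ge p (p x + kc.1.+1%:Z) (kc.2 ^+ 2 - x) ->
    ord_ge p (p x + kc.1.+2%:Z) (c' ^+ 2 - x) /\ ord_ge p (p kc.2 + kc.1.+1%:Z) (c' - kc.2).
  move=> [k c1] /=; have [h|nh] := pselect (ord_ge p (p x + k.+1%:Z) (c1 ^+ 2 - x)).
    by have [//|c' h'] := newton_step x0 _ h; exists c'.
  by exists 0.
pose fix u n := if n is n'.+1 then g (n', u n') else c.
have hu n : ord_ge p (p x + n.+1%:Z) (u n ^+ 2 - x).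
  by elim: n => [//|n IH] /=; have [] := hg (n, u n) IH.
have pu n : p (u n) = p c.
  have [_ h1] : u n != 0 /\ p x = p (u n) *+ 2.
    by apply: near_square_root x0 _; apply: ord_geW (hu n); lia.
  by have [_] := near_square_root x0 hc; rewrite h1 !mulr2n; lia.
have du n : ord_ge p (p c + n.+1%:Z) (u n.+1 - u n).
  by have [] := hg (n, u n) (hu n); rewrite /= pu.
exists u; split=> //; apply/asboolP => N.
pose n0 := `|N - p c|%N; exists n0 => i j hi hj.
have tail i0 : (n0 <= i0)%N -> ord_ge p N (u i0 - u n0).
  elim: i0 => [|i0 IH].
    by rewrite leqn0 => /eqP ->; rewrite subrr ord_ge0.
  rewrite leq_eqVlt => /orP[/eqP <-|lt]; first by rewrite subrr ord_ge0.
  rewrite -(subrKA (u i0)); apply: ord_geD; last by apply: IH.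
  by apply: ord_geW (du i0); rewrite /n0 in lt *; lia.
have -> : u i - u j = (u i - u n0) - (u j - u n0) by ring.
by apply: ord_geB; apply: tail.
Qed.

Lemma local_square_seq p x : is_local_square p x ->
  exists u : nat -> K, cauchy p u /\
    forall N, exists n0 : nat, forall n, (n0 <= n)%N -> ord_ge p N (u n ^+ 2 - x).
Proof.
move=> [y]; rewrite -(reprK y) /to_completion; set u := repr y.
rewrite -rmorphXn => /eqP; rewrite -Quotient.idealrBE => /asboolP h.
by exists u; split=> //; case: (u).
Qed.

Lemma local_squareP p x : x != 0 -> is_local_square p x <-> near_square p x.
Proof.
move=> x0; split.
  move=> /local_square_seq[u [_ /(_ (p x + 1))[n0 h]]]; exists (u n0); exact: h.
move=> /(near_square_hensel x0)[u [cu hu]].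
exists (\pi_(completion p) (CauchySeq cu)); rewrite /to_completion -rmorphXn.
apply/eqP; rewrite -Quotient.idealrBE; apply/asboolP => N; exists `|N - p x|%N => n hn.
by apply: ord_geW (hu n); lia.
Qed.

Lemma near_squareM p x y : x != 0 -> y != 0 ->
  near_square p x -> near_square p y -> near_square p (x * y).
Proof.
move=> x0 y0 [c hc] [c' hc']; exists (c * c').
have [c0 pc] := near_square_root x0 hc.
have -> : (c * c') ^+ 2 - x * y = c ^+ 2 * (c' ^+ 2 - y) + (c ^+ 2 - x) * y by ring.
rewrite ordM //; apply: ord_geD.
  by rewrite -addrA; apply: ord_geM => //; rewrite ord_geE ?expf_neq0 // ordX // pc.
by rewrite addrAC; apply: ord_geM => //; apply: ord_ge_refl.
Qed.

Lemma near_square_sqr p z : z != 0 -> near_square p (z ^+ 2).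
Proof. by move=> z0; exists z; rewrite subrr ord_ge0. Qed.

Lemma near_squareMl p x y : x != 0 -> y != 0 -> near_square p x ->
  near_square p (x * y) <-> near_square p y.
Proof.
move=> x0 y0 sx; split; last exact: near_squareM.
move=> sxy; have -> : y = x * (x * y) * x^-1 ^+ 2 by field.
apply: near_squareM; rewrite ?mulf_neq0 ?expf_neq0 ?invr_eq0 //.
  by apply: near_squareM; rewrite ?mulf_neq0.
by apply: near_square_sqr; rewrite invr_eq0.
Qed.

Lemma card_imset_half (R : finType) (U : {set R}) (g : R -> R) (nu : R -> R) :
  (forall c c' : R, c \in U -> c' \in U -> g c = g c' -> c = c' \/ c = nu c') ->
  (#|U| <= 2 * #|g @: U|)%N.
Proof.
move=> h; rewrite -sum1_card (partition_big_imset g) /= mulnC -sum_nat_const.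
apply: leq_sum => b /imsetP[c0 c0U ->]; rewrite sum1_card.
apply: leq_trans (_ : #|[set c0; nu c0]| <= 2)%N; last by rewrite cards2; case: eqP.
rewrite -cardsE; apply: subset_leq_card; apply/fintype.subsetP => c.
rewrite inE unfold_in /= => /andP[cU /eqP e].
by have [->|->] := h c c0 cU c0U e; rewrite !inE eqxx ?orbT.
Qed.

(* Otherwise the classes of [1], [x] and [y] modulo squares would be distinct in the unit
   group of the residue field, where squaring is two-to-one. *)
Lemma near_square_unit_mul p x y : x != 0 -> y != 0 -> p x = 0 -> p y = 0 ->
  ~ near_square p x -> ~ near_square p y -> near_square p (x * y).
Proof.
move=> x0 y0 px py nx ny; apply: contrapT => nxy.
have [f [Of fi fs]] := residue_reps p.
have /choice[phi hphi] : forall z, exists c, ord_ge p 0 z -> ord_ge p 1 (z - f c).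
  move=> z; have [/fs[c hc]|nz] := boolP (ord_ge p 0 z); first by exists c.
  by exists 0.
have phiE z z' : ord_ge p 0 z -> ord_ge p 0 z' -> phi z = phi z' -> ord_ge p 1 (z - z').
  move=> Oz Oz' e; have -> : z - z' = (z - f (phi z)) - (z' - f (phi z)) by ring.
  by apply: ord_geB; [apply: hphi | rewrite e; apply: hphi].
pose unit z := (z != 0) && (p z == 0).
have unitP z : ord_ge p 0 z -> ~~ ord_ge p 1 z -> unit z.
  have [->|z0] := eqVneq z 0; first by rewrite !ord_ge0.
  by rewrite /unit z0 !ord_geE //; lia.
have unit_ge z : unit z -> ord_ge p 0 z by move=> /andP[z0 /eqP pz]; rewrite ord_geE // pz.
have unit_nge z : unit z -> ~~ ord_ge p 1 z by move=> /andP[z0 /eqP pz]; rewrite ord_geE // pz.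
have unitM z z' : unit z -> unit z' -> unit (z * z').
  by move=> /andP[z0 /eqP pz] /andP[z'0 /eqP pz']; rewrite /unit mulf_neq0 //= ordM // pz pz'.
have unitV z : unit z -> unit z^-1.
  by move=> /andP[z0 /eqP pz]; rewrite /unit invr_eq0 z0 ordV // pz.
(* Residue classes of units. For each unit [w], the classes of [w] times a square fill at least half
   of [U]; three disjoint such cosets, for 1, [x] and [y], do not fit. *)
pose U := [set c | unit (f c)].
have phiU z : unit z -> phi z \in U.
  move=> uz; rewrite inE; apply: unitP => //.
  apply: contraNN (unit_nge z uz) => h.
  by rewrite -[z](subrK (f (phi z))); apply: ord_geD => //; apply: hphi; apply: unit_ge.
pose g w c := phi (w * f c ^+ 2).
have u2 c : c \in U -> unit (f c ^+ 2) by rewrite inE => uc; rewrite expr2; apply: unitM.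
have gU w c : unit w -> c \in U -> g w c \in U.
  by move=> uw cU; apply: phiU; apply: unitM => //; apply: u2.
have gE w w' c c' : unit w -> unit w' -> c \in U -> c' \in U -> g w c = g w' c' ->
    ord_ge p 1 (w * f c ^+ 2 - w' * f c' ^+ 2).
  by move=> uw uw' cU c'U; apply: phiE; apply: unit_ge; apply: unitM => //; apply: u2.
have half w : unit w -> (#|U| <= 2 * #|g w @: U|)%N.
  move=> uw; apply: (@card_imset_half _ _ _ (fun c => phi (- f c))) => c c' cU c'U.
  move=> /(gE w w c c' uw uw cU c'U).
  have -> : w * f c ^+ 2 - w * f c' ^+ 2 = (f c + f c') * (w * (f c - f c')) by ring.
  have [/fi ->|nd] := boolP (ord_ge p 1 (f c - f c')); first by left.
  have ud : unit (w * (f c - f c')) by apply: unitM => //; apply: unitP => //; apply: ord_geB.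
  move/andP: ud => [d0 /eqP pd]; rewrite -{1}[1]addr0 -pd ord_ge_mul // => hs; right; apply: fi.
  have -> : f c - f (phi (- f c')) = (f c + f c') + (- f c' - f (phi (- f c'))) by ring.
  by apply: ord_geD => //; apply: hphi; rewrite ord_geN.
have disj w w' : unit w -> unit w' -> ~ near_square p (w * w') ->
    [disjoint g w @: U & g w' @: U].
  move=> uw uw' nww'; rewrite -setI_eq0; apply/eqP/setP => b; rewrite !inE.
  apply/negP => /andP[/imsetP[c cU ->] /imsetP[c' c'U /(gE _ _ _ _ uw uw' cU c'U) h]].
  apply: nww'; move: (cU) (c'U); rewrite !inE => uc uc'.
  move/andP: (unitM _ _ uw uw') => [ww0 /eqP pww].
  (* In the residue field, [w c^2 = w' c'^2] gives [w w' = (w' c' / c)^2]. *)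
  exists (w' * (f c' / f c)); rewrite pww add0r.
  have fc0 : f c != 0 by case/andP: uc.
  have -> : (w' * (f c' / f c)) ^+ 2 - w * w' =
      (w * f c ^+ 2 - w' * f c' ^+ 2) * (- w' / f c ^+ 2) by field.
  have uz : unit (w' / f c ^+ 2) by apply: unitM => //; apply: unitV; apply: u2.
  rewrite mulNr mulrN ord_geN; move/andP: uz => [z0 /eqP pz].
  by rewrite -[1]addr0 -pz ord_ge_mul.
have u1 : unit 1 by rewrite /unit oner_neq0 Defs.ord1 eqxx.
have ux : unit x by rewrite /unit x0 px eqxx.
have uy : unit y by rewrite /unit y0 py eqxx.
have d1 : [disjoint g 1 @: U & g x @: U] by apply: disj; rewrite ?mul1r.
have d2 : [disjoint g 1 @: U & g y @: U] by apply: disj; rewrite ?mul1r.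
have d3 : [disjoint g x @: U & g y @: U] by apply: disj.
have sub w : unit w -> g w @: U \subset U.
  by move=> uw; apply/fintype.subsetP => _ /imsetP[c cU ->]; apply: gU.
pose A w := g w @: U; have le : (#|A 1%R| + #|A x| + #|A y| <= #|U|)%N.
  rewrite -cardsUI (disjoint_setI0 d1) cards0 addn0.
  rewrite -cardsUI finset.setIUl (disjoint_setI0 d2) (disjoint_setI0 d3) finset.setU0 cards0 addn0.
  by apply: subset_leq_card; rewrite !finset.subUset !sub.
have U0 : (0 < #|U|)%N by apply/card_gt0P; exists (phi 1); apply: phiU.
have := half 1 u1; have := half x ux; have := half y uy; rewrite -/(A 1) -/(A x) -/(A y); lia.
Qed.

(** Even powers of a uniformizer scale both elements to units without changing their square
    classes. *)
Lemma near_square_nonsquare_mul p x y : x != 0 -> y != 0 ->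
  ~~ odd `|p x|%N -> ~~ odd `|p y|%N ->
  ~ near_square p x -> ~ near_square p y -> near_square p (x * y).
Proof.
have [u u0 pu] := uniformizer p.
have scale z : z != 0 -> ~~ odd `|p z|%N -> exists s, [/\ s != 0, p (z * s ^+ 2) = 0 &
    near_square p (z * s ^+ 2) <-> near_square p z].
  move=> z0 ez; have [k hk] : exists k : int, p z = k *+ 2.
    exists (p z %/ 2)%Z; rewrite -mulr_natr -[RHS]addr0; lia.
  exists (u ^ (- k)); have s0 : u ^ (- k) != 0 by rewrite expfz_neq0.
  split=> //; first by rewrite ordM ?expf_neq0 // ordX // ordXz // pu hk mulr1 mulNrn subrr.
  by rewrite mulrC; apply: near_squareMl; rewrite ?expf_neq0 //; apply: near_square_sqr.
move=> x0 y0 /(scale x x0)[s [s0 ps hs]] /(scale y y0)[r [r0 pr hr]] nx ny.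
have : near_square p (x * s ^+ 2 * (y * r ^+ 2)).
  apply: near_square_unit_mul; rewrite ?mulf_neq0 ?expf_neq0 // => h.
    by apply: nx; apply/hs.
  by apply: ny; apply/hr.
have -> : x * s ^+ 2 * (y * r ^+ 2) = (s * r) ^+ 2 * (x * y) by ring.
by move/near_squareMl; apply; rewrite ?mulf_neq0 ?expf_neq0 ?mulf_neq0 //;
  apply: near_square_sqr; rewrite mulf_neq0.
Qed.

Definition nonsquare p x : bool := symbol x p == -1.

Lemma nonsquareP p x : x != 0 -> ~~ odd `|p x|%N ->
  reflect (~ near_square p x) (nonsquare p x).
Proof.
move=> x0 ex; rewrite /nonsquare /symbol (negPf ex).
apply: (iffP eqP); case: asboolP => h //.
  by move=> _ h'; apply/h/local_squareP.
by move=> n; exfalso; apply/n/local_squareP.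
Qed.

Lemma symbolE p x : ~~ odd `|p x|%N -> symbol x p = (-1) ^+ nonsquare p x.
Proof. by move=> ex; rewrite /nonsquare /symbol (negPf ex); case: asboolP. Qed.

Lemma nonsquareM p x y : x != 0 -> y != 0 -> ~~ odd `|p x|%N -> ~~ odd `|p y|%N ->
  nonsquare p (x * y) = nonsquare p x (+) nonsquare p y.
Proof.
move=> x0 y0 ex ey; have exy : ~~ odd `|p (x * y)%R|%N by rewrite ordM //; lia.
have xy0 : x * y != 0 by rewrite mulf_neq0.
case: (nonsquareP x0 ex) => hx; case: (nonsquareP y0 ey) => hy /=.
- by apply/(nonsquareP xy0 exy) => h; apply: h; apply: near_square_nonsquare_mul.
- apply/(nonsquareP xy0 exy); rewrite mulrC => h; apply: hx.
  by apply/(near_squareMl y0 x0 (contrapT hy)).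
- apply/(nonsquareP xy0 exy) => h; apply: hy.
  by apply/(near_squareMl x0 y0 (contrapT hx)).
- by apply/(nonsquareP xy0 exy) => h; apply: h; apply: near_squareM => //; apply: contrapT.
Qed.

End LocalSquares.

(** * The Herbrand quotient of a class group *)

Section Herbrand.

Lemma card_ker_im (V W : zmodType) (f : {additive V -> W}) (s : seq V) : uniq s ->
  (forall x y, x \in s -> y \in s -> x - y \in s) ->
  size s = (size [seq x <- s | f x == 0%R] * size (undup (map f s)))%N.
Proof.
move=> us sB; have sD x y : x \in s -> y \in s -> x + y \in s.
  move=> xs ys; rewrite -(opprK y); apply: (sB) => //.
  by rewrite -sub0r -(subrr y); apply: (sB) => //; apply: (sB).
have fib y : y \in undup (map f s) -> count (fun x => f x == y) s = size [seq x <- s | f x == 0].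
  rewrite mem_undup => /mapP[x0 x0s ->]; rewrite -size_filter.
  rewrite -(size_map (fun x => x - x0)); apply: perm_size; apply: uniq_perm.
  - by rewrite map_inj_uniq ?filter_uniq // => u v /addIr.
  - exact: filter_uniq.
  move=> x; rewrite mem_filter; apply/mapP/andP.
    move=> [z]; rewrite mem_filter => /andP[/eqP fz zs] ->.
    by rewrite raddfB fz subrr eqxx; split=> //; apply: (sB).
  move=> [/eqP fx xs]; exists (x + x0); last by rewrite addrK.
  by rewrite mem_filter raddfD fx add0r eqxx sD.
transitivity (\sum_(y <- undup (map f s)) count (fun x => f x == y) s)%N.
  have gen (T : seq W) (s' : seq V) : uniq T -> all (fun x => f x \in T) s' ->
      size s' = (\sum_(y <- T) count (fun x => f x == y) s')%N.
    move=> uT; elim: s' => [|x s' IH] /=; first by rewrite big1.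
    move=> /andP[fx /IH ->]; rewrite big_split /=.
    suff -> : (\sum_(y <- T) (f x == y) = 1)%N by rewrite add1n.
    rewrite (bigD1_seq (f x) fx uT) /= eqxx big1 // => y.
    by rewrite eq_sym => /negPf ->.
  apply: gen; first exact: undup_uniq.
  by apply/allP => x xs; rewrite mem_undup map_f.
rewrite big_seq (eq_bigr (fun=> size [seq x <- s | f x == 0])); last by move=> y; apply: fib.
by rewrite -big_seq big_const_seq count_predT iter_addn_0.
Qed.

(* [A0] is the group of divisor classes of a quadratic extension and [B] that of the base
   field.  With [M] and [P] the finite subgroups of degree zero and [N] onto,
     [|M^sigma| * |(1 - sigma) M| = |M| = |ker N| * |P|].
   If [|M^sigma| <= |P|], then [ker N = (1 - sigma) M], so the degree of any [c] is also
   that of some invariant [c - a]; but classes coming from [B] have even degree. *)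
Variables (A B : zmodType) (A0 : A -> Prop).
Variables (sigma : {additive A -> A}) (N : {additive A -> B}) (j : {additive B -> A}).
Variable dg : {additive B -> int}.
Hypothesis A0B : forall a b, A0 a -> A0 b -> A0 (a - b).
Hypothesis A0s : forall a, A0 a -> A0 (sigma a).
Hypothesis A0j : forall b, A0 (j b).
Hypothesis Ns : forall a, N (sigma a) = N a.
Hypothesis Nj : forall b, N (j b) = b *+ 2.
Hypothesis Nsurj : forall b, exists2 a, A0 a & N a = b.
Variables (sM : seq A) (sP : seq B).
Hypothesis sM_fin : forall a, A0 a -> dg (N a) = 0 -> a \in sM.
Hypothesis sP_fin : forall b, dg b = 0 -> b \in sP.
Hypothesis dg_neq0 : exists b, dg b != 0.

Let M : seq A := undup [seq a <- sM | `[< A0 a >] & dg (N a) == 0].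
Let P : seq B := undup [seq b <- sP | dg b == 0].

Let memM a : a \in M <-> A0 a /\ dg (N a) = 0.
Proof.
rewrite mem_undup mem_filter; split; first by move=> /andP[/andP[/asboolP h /eqP h'] _].
by move=> [h h']; rewrite sM_fin // andbT h' eqxx andbT; apply/asboolP.
Qed.

Let memP b : b \in P <-> dg b = 0.
Proof.
rewrite mem_undup mem_filter; split; first by move=> /andP[/eqP].
by move=> h; rewrite h eqxx sP_fin.
Qed.

Let MB x y : x \in M -> y \in M -> x - y \in M.
Proof.
move=> /memM[Ax dx] /memM[Ay dy]; apply/memM; split; first exact: A0B.
by rewrite !raddfB /= dx dy subrr.
Qed.

Let PB x y : x \in P -> y \in P -> x - y \in P.
Proof. by move=> /memP dx /memP dy; apply/memP; rewrite raddfB /= dx dy subrr. Qed.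

Let uM : uniq M := undup_uniq _.
Let uP : uniq P := undup_uniq _.

Let M0 : 0 \in M.
Proof. by apply/memM; rewrite !raddf0 -(raddf0 j); split=> //; apply: A0j. Qed.

Let P0 : 0 \in P. Proof. by apply/memP; rewrite raddf0. Qed.

Let delta : {additive A -> A} := idfun \- sigma.

Let kerN := [seq a <- M | N a == 0].

Let card_M_N : size M = (size kerN * size P)%N.
Proof.
rewrite (card_ker_im N uM MB); congr (_ * _)%N; apply: perm_size.
apply: uniq_perm; rewrite ?undup_uniq // => b; rewrite mem_undup.
apply/mapP/idP => [[a /memM[_ da] ->]|/memP db]; first exact/memP.
by have [a Aa Na] := Nsurj b; exists a => //; apply/memM; rewrite Na.
Qed.

Let fixed := [seq a <- M | delta a == 0].

Let memfixed a : a \in fixed <-> a \in M /\ sigma a = a.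
Proof.
rewrite mem_filter /= subr_eq0; split; first by move=> /andP[/eqP <- ->].
by move=> [-> ->]; rewrite eqxx.
Qed.

Let card_P_gt0 : (0 < size P)%N.
Proof. by case: (P) P0. Qed.

Let im_delta : {subset undup (map delta M) <= kerN}.
Proof.
move=> a; rewrite mem_undup => /mapP[c cM ->]; rewrite mem_filter raddfB /= Ns subrr eqxx /=.
apply: MB => //; move/memM: cM => [Ac dc]; apply/memM; split; first exact: A0s.
by rewrite Ns.
Qed.

Let jP := undup (map j P).

Let mem_jP a b : a = j b -> dg (N a) = 0 -> a \in jP.
Proof.
move=> -> /eqP; rewrite Nj raddfMn mulrn_eq0 /= => /eqP db.
by rewrite mem_undup map_f //; apply/memP.
Qed.

Let card_jP : (size jP <= size P)%N.
Proof. by rewrite (leq_trans (size_undup _)) // size_map. Qed.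

(** Half of the smallest positive degree would be a smaller one. This [l] is the degree that
    elements [j b] are unable to reach. *)
Lemma min_degree : exists l : nat, [/\ (0 < l)%N, (exists b, dg b = l) & forall b, dg b *+ 2 <> l].
Proof.
have ex : exists l : nat, (0 < l)%N && `[< exists b, dg b = l%:Z >].
  have [b db] := dg_neq0; exists `|dg b|%N; rewrite absz_gt0 db; apply/asboolP.
  have [le|lt] := leP 0 (dg b); first by exists b; rewrite gez0_abs.
  by exists (- b); rewrite raddfN /= ltz0_abs.
case: (ex_minnP ex) => l /andP[l0 /asboolP[b db]] minl; exists l; split=> //; first by exists b.
move=> b' db'; have := minl `|dg b'|%N.
have d0 : 0 < dg b' by rewrite mulr2n in db'; lia.
have -> : (0 < `|dg b'|)%N by rewrite absz_gt0 gt_eqF.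
have -> : `[< exists b, dg b = `|dg b'|%N%:Z >] by apply/asboolP; exists b'; rewrite gtz0_abs.
by move=> /(_ isT); rewrite mulr2n in db'; lia.
Qed.

Let fixed_of_degree : (size fixed <= size P)%N ->
  forall b, exists a, [/\ A0 a, sigma a = a & dg (N a) = dg b].
Proof.
move=> fP b; have [c Ac Nc] := Nsurj b.
have eqM : (size fixed * size (undup (map delta M)) = size kerN * size P)%N.
  by rewrite -(card_ker_im delta uM MB) -card_M_N.
have le : (size kerN <= size (undup (map delta M)))%N by nia.
have [_ eqi] := uniq_min_size (undup_uniq _) im_delta le.
have : delta c \in kerN.
  rewrite mem_filter /= raddfB /= Ns subrr eqxx; apply/memM; split.
    by apply: A0B => //; apply: A0s.
  by rewrite raddfB /= Ns subrr raddf0.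
rewrite -eqi mem_undup => /mapP[a /memM[Aa da] e].
exists (c - a); split; first exact: A0B.
  rewrite raddfB /=; move: e => /= e; rewrite -[sigma c](subKr c) e.
  by rewrite opprB addrA addrAC addrK.
by rewrite !raddfB /= da subr0 Nc.
Qed.

(** If all invariants come from [B], those of degree zero number at most [|P|], so some invariant
    has degree [l]. Being some [j b'], it has degree [2 * dg b'], which is excluded. *)
Lemma herbrand_invariants : ~ (forall a, A0 a -> sigma a = a -> exists b, a = j b).
Proof.
move=> inv; have [l [l0 [b db] nl]] := min_degree.
have [|a [Aa sa]] := fixed_of_degree _ b.
  apply: leq_trans card_jP; apply: uniq_leq_size; first exact: filter_uniq.
  move=> a /memfixed[/memM[Aa da] sa]; have [b' ab] := inv a Aa sa.
  exact: mem_jP ab da.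
by have [b' ->] := inv a Aa sa; rewrite Nj raddfMn /= db => /nl.
Qed.

(** The class [tau] in the kernel of [j] halves the image: [2 |j P| <= |P|]. This leaves room for
    one nontrivial class of invariants modulo [j B], so the bound of the invariants of degree zero
    by [|P|] survives. *)
Lemma herbrand_capitulation tau : tau != 0 -> dg tau = 0 -> j tau = 0 ->
  ~ (forall a a', A0 a -> sigma a = a -> A0 a' -> sigma a' = a' ->
       [\/ exists b, a = j b, exists b, a' = j b | exists b, a - a' = j b]).
Proof.
move=> tau0 dtau jtau inv; have [l [l0 [b db] nl]] := min_degree.
have jP2 : (2 * size jP <= size P)%N.
  rewrite (card_ker_im j uP PB) leq_mul2r; apply/orP; right.
  have -> : 2%N = size [:: 0; tau] by [].
  apply: uniq_leq_size; first by rewrite /= inE eq_sym tau0.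
  move=> x; rewrite !inE mem_filter => /orP[/eqP->|/eqP->]; rewrite ?raddf0 ?jtau eqxx //=.
  exact/memP.
have [[a0 /memfixed[/memM[Aa0 da0] sa0] nj0]|all_j] :=
    pselect (exists2 a, a \in fixed & ~ exists b, a = j b); last first.
  (* If every invariant of degree zero comes from [B], then already [|M^sigma| |(1 - sigma) M| <=
     (|P| / 2) |ker N| < |M|]. *)
  have fj : (size fixed <= size jP)%N.
    apply: uniq_leq_size; first exact: filter_uniq.
    move=> a af; have [b' ab] : exists b, a = j b.
      by apply: contrapT => h; apply: all_j; exists a.
    by move/memfixed: af => [/memM[_ da] _]; apply: mem_jP ab da.
  have eqM := card_ker_im delta uM MB; rewrite -/fixed card_M_N in eqM.
  have lei := uniq_leq_size (undup_uniq _) im_delta.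
  have kN : (0 < size kerN)%N.
    have : 0 \in kerN by rewrite mem_filter raddf0 eqxx M0.
    by case: (kerN).
  have := leq_mul fj lei; rewrite -eqM mulnC leq_pmul2r //.
  by move: card_P_gt0 jP2; lia.
have sub : {subset fixed <= jP ++ [seq a0 + x | x <- jP]}.
  move=> a /memfixed[/memM[Aa da] sa]; rewrite mem_cat.
  have [[b' ab]|[b' ab]|[b' ab]] := inv a a0 Aa sa Aa0 sa0.
  - by rewrite (mem_jP ab da).
  - by case: nj0; exists b'.
  - apply/orP; right; apply/mapP; exists (a - a0); last by rewrite addrC subrK.
    by apply: mem_jP ab _; rewrite !raddfB /= da da0 subrr.
have [|a [Aa sa]] := fixed_of_degree _ b.
  apply: leq_trans (uniq_leq_size (filter_uniq _ uM) sub) _.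
  by rewrite size_cat size_map addnn -mul2n.
have [[b' ->]|[b' ab]|[b' ab]] := inv a a0 Aa sa Aa0 sa0.
- by rewrite Nj raddfMn /= db => /nl.
- by case: nj0; exists b'.
(* Subtracting [a0], of degree zero, leaves the degree unchanged, so the parity argument applies
   through [a - a0]. *)
have <- : dg (N (a - a0)) = dg (N a) by rewrite !raddfB /= da0 subr0.
by rewrite ab Nj raddfMn /= db => /nl.
Qed.

End Herbrand.

(** * Quadratic extensions *)

Section QuadraticExtension.
Variables (F : finFieldType) (K : fieldExtType {fraction {poly F}}).
Local Notation q := #|F|.
Implicit Types (p : place K) (x y : K) (z : K * K).
Hypothesis odd_char : 2%N \notin [pchar K].

Variable lam : K.
Hypothesis lam0 : lam != 0.
Hypothesis lam_even : forall p, exists a : int, p lam = a *+ 2.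
Hypothesis lam_nsq : forall y, lam != y ^+ 2.

(* [K(sqrt lam)] is modelled by [K * K], with [(x, y)] standing for [x + y sqrt lam]. *)
Definition quad_mul (z z' : K * K) : K * K :=
  (z.1 * z'.1 + lam * (z.2 * z'.2), z.1 * z'.2 + z.2 * z'.1).
Definition quad_conj (z : K * K) : K * K := (z.1, - z.2).
Definition quad_norm (z : K * K) : K := z.1 ^+ 2 - lam * z.2 ^+ 2.

Lemma pair_neq0 z : (z != 0) = (z.1 != 0) || (z.2 != 0).
Proof. by case: z => x y; rewrite -negb_and. Qed.

Lemma qnormM z z' : quad_norm (quad_mul z z') = quad_norm z * quad_norm z'.
Proof. by rewrite /quad_norm /=; ring. Qed.

Lemma qnorm_conj z : quad_norm (quad_conj z) = quad_norm z.
Proof. by rewrite /quad_norm /= sqrrN. Qed.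

Lemma qconjK : involutive quad_conj.
Proof. by case=> x y; rewrite /quad_conj /= opprK. Qed.

Lemma qnorm_eq0 z : (quad_norm z == 0) = (z == 0).
Proof.
apply/idP/idP => [|/eqP->]; last by rewrite /quad_norm /= !expr0n mulr0 subrr.
apply: contraTT; rewrite pair_neq0 /quad_norm; have [z2|z2 _] := eqVneq z.2 0.
  by rewrite z2 orbF expr0n mulr0 subr0 expf_eq0.
rewrite subr_eq0; apply/negP => /eqP e; have := lam_nsq (z.1 / z.2).
by rewrite expr_div_n e mulfK ?eqxx // expf_neq0.
Qed.

Lemma qmul_neq0 z z' : z != 0 -> z' != 0 -> quad_mul z z' != 0.
Proof. by rewrite -!qnorm_eq0 qnormM => h h'; rewrite mulf_neq0. Qed.

Lemma qconj_neq0 z : z != 0 -> quad_conj z != 0.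
Proof. by rewrite !pair_neq0 /= oppr_eq0. Qed.

Lemma qconjM z z' : quad_conj (quad_mul z z') = quad_mul (quad_conj z) (quad_conj z').
Proof. by rewrite /quad_conj /quad_mul /=; congr pair; ring. Qed.

Definition qge (w : K * K -> int) (n : int) z : bool := (z == 0) || (n <= w z).

(** The residue degree over [F] of one place above [p]: [p] splits if [lam] is a local square and is
    inert otherwise, evenness of the orders of [lam] excluding ramification. *)
Definition residue_size p : nat :=
  if `[< near_square p lam >] then place_deg p else (2 * place_deg p)%N.

(* [w] is a normalized valuation of [K(sqrt lam)] above [p]; the other one, if [p]
   splits, is [w \o quad_conj]. *)
Record above p (w : K * K -> int) : Prop := Above {
  above_mul : forall z z', z != 0 -> z' != 0 -> w (quad_mul z z') = w z + w z';
  above_sub : forall n z z', qge w n z -> qge w n z' -> qge w n (z - z');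
  above_base : forall x, x != 0 -> w (x, 0) = p x;
  above_norm : forall z, z != 0 -> w z + w (quad_conj z) = p (quad_norm z);
  above_inert : ~ near_square p lam -> forall z, w (quad_conj z) = w z;
  above_covers : forall n, exists R : finType, exists phi : K * K -> R,
    #|R| = (q ^ residue_size p)%N /\
    forall z z', qge w n z -> qge w n z' -> phi z = phi z' -> qge w (n + 1) (z - z') }.

(** No cancellation occurs in [z.1 ^+ 2 - lam * z.2 ^+ 2], as otherwise [z.1 / z.2] would be an
    approximate square root of [lam]. So the order of the norm is twice the minimum of [p z.1] and
    [p z.2 + a], with 0 of infinite order. *)
Lemma inert_norm p a z : p lam = a *+ 2 -> ~ near_square p lam -> z != 0 ->
  exists k : int, p (quad_norm z) = k *+ 2 /\
    forall n, (n <= k) = ord_ge p n z.1 && ord_ge p (n - a) z.2.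
Proof.
move=> pl ns z0; move: (z0); rewrite -qnorm_eq0 /quad_norm.
have [z1|z1] := eqVneq z.1 0.
  rewrite z1 expr0n sub0r oppr_eq0 => nz; rewrite ordN; move: nz; rewrite mulf_eq0 negb_or lam0 /=.
  rewrite expf_eq0 /= => z2; exists (a + p z.2); rewrite ordM ?expf_neq0 // ordX // pl -mulrnDl.
  by split=> // n; rewrite ord_ge0 ord_geE //= lerBlDl.
have [z2|z2] := eqVneq z.2 0.
  rewrite z2 expr0n mulr0 subr0 => _; exists (p z.1); rewrite ordX //; split=> // n.
  by rewrite ord_ge0 andbT ord_geE.
move=> nz; have z12 : z.1 ^+ 2 != 0 by rewrite expf_neq0.
have z22 : z.2 ^+ 2 != 0 by rewrite expf_neq0.
have lz : lam * z.2 ^+ 2 != 0 by rewrite mulf_neq0.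
have p1 : p (z.1 ^+ 2) = p z.1 *+ 2 by rewrite ordX.
have p2 : p (lam * z.2 ^+ 2) = (a + p z.2) *+ 2 by rewrite ordM // ordX // pl mulrnDl.
have fin k : k = Num.min (p z.1) (a + p z.2) ->
    forall n, (n <= k) = ord_ge p n z.1 && ord_ge p (n - a) z.2.
  by move=> -> n; rewrite le_min !ord_geE // lerBlDl.
have [lt|gt|eq] := ltgtP (p z.1) (a + p z.2).
- exists (p z.1); split; last by apply: fin; rewrite min_l // ltW.
  have := @ord_add_dom _ p (z.1 ^+ 2) (- (lam * z.2 ^+ 2)) z12; rewrite ord_geN ord_geE // p1 p2.
  by move=> h; apply: (h _).2; rewrite !mulr2n; lia.
- exists (a + p z.2); split; last by apply: fin; rewrite min_r // ltW.
  have := @ord_add_dom _ p (lam * z.2 ^+ 2) (- z.1 ^+ 2) lz; rewrite ord_geN ord_geE // p1 p2.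
  by move=> h; rewrite -ordN opprB; apply: (h _).2; rewrite !mulr2n; lia.
exists (p z.1); split; last by apply: fin; rewrite -eq minxx.
apply/eqP; rewrite eq_le; apply/andP; split; last first.
  rewrite -ord_geE //; apply: ord_geB; rewrite ord_geE // ?p1 // p2 eq //.
rewrite leNgt -lezD1 -ord_geE //; apply/negP => h; apply: ns; exists (z.1 / z.2).
have -> : (z.1 / z.2) ^+ 2 - lam = (z.1 ^+ 2 - lam * z.2 ^+ 2) / z.2 ^+ 2 by field.
rewrite -ord_ge_div // pl ordX //; apply: ord_geW h; rewrite eq !mulr2n; lia.
Qed.

(** The valuation is half the order of the norm; its residue classes are pairs of residue classes of
    [p], one for each coordinate. *)
Lemma above_inert_exists p : ~ near_square p lam -> exists w, above p w.
Proof.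
move=> ns; have [a pl] := lam_even p.
have /choice[w hw] : forall z, exists k : int, z != 0 -> p (quad_norm z) = k *+ 2 /\
    forall n, (n <= k) = ord_ge p n z.1 && ord_ge p (n - a) z.2.
  move=> z; have [->|z0] := eqVneq z 0; first by exists 0.
  by have [k hk] := inert_norm pl ns z0; exists k.
have wE z k : z != 0 -> p (quad_norm z) = k *+ 2 -> w z = k.
  by move=> z0 e; have [] := hw z z0; rewrite e !mulr2n; lia.
have geE n z : qge w n z = ord_ge p n z.1 && ord_ge p (n - a) z.2.
  rewrite /qge; have [->|z0] := eqVneq z 0; first by rewrite !ord_ge0.
  by have [_ ->] := hw z z0.
exists w; split.
- move=> z z' z0 z'0; apply: wE; first exact: qmul_neq0.
  have nz : quad_norm z != 0 by rewrite qnorm_eq0.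
  have nz' : quad_norm z' != 0 by rewrite qnorm_eq0.
  by rewrite qnormM ordM // mulrnDl (hw z z0).1 (hw z' z'0).1.
- move=> n z z'; rewrite !geE => /andP[h1 h2] /andP[h3 h4].
  by rewrite !ord_geB.
- move=> x x0; apply: wE; first by rewrite pair_neq0 x0.
  by rewrite /quad_norm /= expr0n mulr0 subr0 ordX.
- move=> z z0; rewrite (hw z z0).1 mulr2n; congr (_ + _); apply: wE; first exact: qconj_neq0.
  by rewrite qnorm_conj (hw z z0).1.
- move=> _ z; have [->|z0] := eqVneq z 0; first by rewrite /quad_conj /= oppr0.
  by apply: wE; [apply: qconj_neq0 | rewrite qnorm_conj (hw z z0).1].
move=> n; have [f1 h1] := residue_class p n; have [f2 h2] := residue_class p (n - a).
exists ('rV[F]_(place_deg p) * 'rV[F]_(place_deg p))%type, (fun z => (f1 z.1, f2 z.2)); split.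
  rewrite card_prod card_mx mul1n /residue_size; case: asboolP => // _.
  by rewrite mul2n -addnn expnD.
move=> z z'; rewrite !geE => /andP[g1 g2] /andP[g3 g4] [e1 e2].
by rewrite h1 //= addrAC h2.
Qed.

Section Split.
Variables (p : place K) (u : nat -> K) (a : int).
Hypothesis pl : p lam = a *+ 2.
Hypothesis cu : cauchy p u.
Hypothesis hu : forall n, ord_ge p (p lam + n.+1%:Z) (u n ^+ 2 - lam).

(** Evaluation at approximations [u n] of a root of [lam] in $K_p$: the embedding of [K(sqrt lam)]
    in $K_p$, kept at the level of sequences. *)
Let ev z n := z.1 + z.2 * u n.

Let pu n : u n != 0 /\ p (u n) = a.
Proof.
have [|h1 h2] := @near_square_root _ _ p lam (u n) lam0.
  by apply: ord_geW (hu n); lia.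
by split=> //; move: h2; rewrite pl !mulr2n; lia.
Qed.

Let ev_sub z z' n : ev (z - z') n = ev z n - ev z' n.
Proof. by rewrite /ev /=; ring. Qed.

Let ev_bound z : exists m : int, forall n, ord_ge p m (ev z n).
Proof.
have [m [h1 h2]] : exists m : int, ord_ge p m z.1 /\ ord_ge p (m - a) z.2.
  exists (Num.min (p z.1) (p z.2 + a)); split.
    by apply: ord_geW (ord_ge_refl p z.1); rewrite ge_min lexx.
  by apply: ord_geW (ord_ge_refl p z.2); rewrite lerBlDr ge_min lexx orbT.
exists m => n; apply: ord_geD => //; rewrite -[m](subrK a); apply: ord_geM => //.
by have [u0 e] := pu n; rewrite ord_geE // e.
Qed.

Let ev_cauchy z (N : int) : exists n0 : nat, forall i j, (n0 <= i)%N -> (n0 <= j)%N ->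
  ord_ge p N (ev z i - ev z j).
Proof.
move/asboolP: (cu) => /(_ (N - p z.2))[n0 h]; exists n0 => i j hi hj.
have -> : ev z i - ev z j = z.2 * (u i - u j) by rewrite /ev; ring.
by rewrite -[N](subrKC (p z.2)); apply: ord_geM; [apply: ord_ge_refl | apply: h].
Qed.

(** The product with the conjugate sequence tends to the nonzero norm, and the order of the
    conjugate is bounded below. This bounds the order of [ev z n] from above; the sequence being
    Cauchy, its order becomes constant. *)
Let ev_limit z : z != 0 -> exists k : int, exists n0 : nat,
  forall n, (n0 <= n)%N -> ev z n != 0 /\ p (ev z n) = k.
Proof.
move=> z0; have nz : quad_norm z != 0 by rewrite qnorm_eq0.
have [m hm] := ev_bound (quad_conj z).
have [n1 h1] : exists n1 : nat, forall n, (n1 <= n)%N ->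
    ord_ge p (p (quad_norm z) + 1) (- (z.2 ^+ 2 * (u n ^+ 2 - lam))).
  exists (absz (p (quad_norm z) - p (z.2 ^+ 2) - p lam)%R) => n hn.
  rewrite ord_geN; apply: (@ord_geW _ p _ (p (z.2 ^+ 2) + (p lam + n.+1%:Z))); first by lia.
  by apply: ord_geM (hu n); apply: ord_ge_refl.
have prod n : quad_norm z - z.2 ^+ 2 * (u n ^+ 2 - lam) = ev z n * ev (quad_conj z) n.
  by rewrite /quad_norm /ev /=; ring.
have ub n : (n1 <= n)%N -> ev z n != 0 /\ p (ev z n) <= p (quad_norm z) - m.
  move=> hn; have [+ pn] := ord_add_dom nz (h1 n hn); rewrite prod mulf_eq0 negb_or.
  move=> /andP[e0 e0']; split=> //; rewrite -pn prod ordM //.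
  by have := hm n; rewrite ord_geE //; lia.
have [n2 h2] := ev_cauchy z (p (quad_norm z) - m + 1).
pose n0 := maxn n1 n2; exists (p (ev z n0)), n0 => n; rewrite geq_max => /andP[hn1 hn2].
have [e0 le0] := ub n0 (leq_maxl _ _).
rewrite -[ev z n](subrKC (ev z n0)); apply: ord_add_dom => //.
by apply: ord_geW (h2 n n0 hn2 (leq_maxr _ _)); lia.
Qed.

Lemma above_split_exists : near_square p lam -> exists w, above p w.
Proof.
move=> sq.
have /choice[w hw] : forall z, exists k : int, z != 0 ->
    exists n0 : nat, forall n, (n0 <= n)%N -> ev z n != 0 /\ p (ev z n) = k.
  move=> z; have [->|z0] := eqVneq z 0; first by exists 0.
  by have [k hk] := ev_limit z0; exists k.
have wE z k : z != 0 -> (exists n0 : nat, forall n, (n0 <= n)%N -> p (ev z n) = k) -> w z = k.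
  move=> z0 [n0 h0]; have [n1 h1] := hw z z0.
  by rewrite -(h0 (maxn n0 n1)) ?leq_maxl // (h1 _ (leq_maxr _ _)).2.
have geP n z : qge w n z <-> exists n0 : nat, forall i, (n0 <= i)%N -> ord_ge p n (ev z i).
  rewrite /qge; have [->|z0] /= := eqVneq z 0.
    by split=> // _; exists 0%N => i _; rewrite /ev /= mul0r addr0 ord_ge0.
  have [n0 h0] := hw z z0; split=> [le|[n1 h1]].
    by exists n0 => i /h0[e0 e1]; rewrite ord_geE // e1.
  have [e0 e1] := h0 (maxn n0 n1) (leq_maxl _ _).
  by have := h1 (maxn n0 n1) (leq_maxr _ _); rewrite ord_geE // e1.
have tail z z' (N : int) : exists n0 : nat, forall i, (n0 <= i)%N ->
    ord_ge p N (z.2 * z'.2 * (u i ^+ 2 - lam)).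
  exists (absz (N - p (z.2 * z'.2) - p lam)%R) => i hi.
  apply: (@ord_geW _ p _ (p (z.2 * z'.2) + (p lam + i.+1%:Z))); first by lia.
  by apply: ord_geM (hu i); apply: ord_ge_refl.
exists w; split.
- move=> z z' z0 z'0; apply: wE; first exact: qmul_neq0.
  have [n0 h0] := hw z z0; have [n1 h1] := hw z' z'0.
  have [n2 h2] := tail z z' (w z + w z' + 1).
  exists (maxn n0 (maxn n1 n2)) => i; rewrite !geq_max => /and3P[i0 i1 i2].
  have [e0 <-] := h0 i i0; have [e1 <-] := h1 i i1.
  have -> : ev (quad_mul z z') i = ev z i * ev z' i + - (z.2 * z'.2 * (u i ^+ 2 - lam)).
    by rewrite /ev /quad_mul /=; ring.
  have m0 : ev z i * ev z' i != 0 by rewrite mulf_neq0.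
  rewrite -ordM //; apply: (ord_add_dom m0 _).2; rewrite ord_geN ordM //.
  by rewrite (h0 i i0).2 (h1 i i1).2; apply: h2.
- move=> n z z' /geP[n0 h0] /geP[n1 h1]; apply/geP; exists (maxn n0 n1) => i.
  by rewrite geq_max ev_sub => /andP[i0 i1]; apply: ord_geB; [apply: h0 | apply: h1].
- move=> x x0; apply: wE; first by rewrite pair_neq0 x0.
  by exists 0%N => n _; rewrite /ev /= mul0r addr0.
- move=> z z0; have zc0 := qconj_neq0 z0.
  have [n0 h0] := hw z z0; have [n1 h1] := hw _ zc0.
  have nz : quad_norm z != 0 by rewrite qnorm_eq0.
  have [n2 h2] := tail z z (p (quad_norm z) + 1).
  pose i := maxn n0 (maxn n1 n2).
  have [i0 i1 i2] : [/\ n0 <= i, n1 <= i & n2 <= i]%N by rewrite /i !leq_max !leqnn !orbT.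
  have [e0 <-] := h0 i i0; have [e1 <-] := h1 i i1; rewrite -ordM //.
  have -> : ev z i * ev (quad_conj z) i = quad_norm z + - (z.2 * z.2 * (u i ^+ 2 - lam)).
    by rewrite /ev /quad_norm /=; ring.
  by apply: (ord_add_dom nz _).2; rewrite ord_geN; apply: h2.
- by move=> h; case: h.
move=> n; have [f hf] := residue_class p n.
have /choice[i hi] : forall z, exists i0 : nat, qge w n z ->
    forall i, (i0 <= i)%N -> ord_ge p n (ev z i) /\ ord_ge p (n + 1) (ev z i - ev z i0).
  move=> z; have [/geP[n0 h0]|nz] := boolP (qge w n z); last by exists 0%N.
  have [n1 h1] := ev_cauchy z (n + 1); exists (maxn n0 n1) => _ i; rewrite geq_max => /andP[i0 i1].
  by split; [apply: h0 | apply: h1 => //; apply: leq_maxr].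
exists 'rV[F]_(place_deg p), (fun z => f (ev z (i z))); split.
  by rewrite card_mx mul1n /residue_size; case: asboolP.
move=> z z' hz hz' e; apply/geP; exists (maxn (i z) (i z')) => l; rewrite geq_max => /andP[l0 l1].
rewrite ev_sub.
have -> : ev z l - ev z' l = (ev z l - ev z (i z)) - (ev z' l - ev z' (i z'))
    + (ev z (i z) - ev z' (i z')) by ring.
have [_ g1] := hi z hz l l0; have [_ g2] := hi z' hz' l l1.
have [g3 _] := hi z hz _ (leqnn _); have [g4 _] := hi z' hz' _ (leqnn _).
by apply: ord_geD; [apply: ord_geB | apply: hf].
Qed.

End Split.

Lemma above_exists p : exists w, above p w.
Proof.
have [sq|ns] := pselect (near_square p lam); last exact: above_inert_exists.
have [u [cu hu]] := near_square_hensel odd_char lam0 sq; have [a pl] := lam_even p.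
exact: above_split_exists pl cu hu sq.
Qed.

End QuadraticExtension.

(** * Squares and norm forms over a finite field *)

Section FiniteFieldSquares.
Variable F : finFieldType.

Let sq := [set c ^+ 2 | c in [set c : F | c != 0]].

Let card_sq : (#|F|.-1 <= 2 * #|sq|)%N.
Proof.
have -> : #|F|.-1 = #|[set c : F | c != 0]|.
  by rewrite -(cardsC1 (0 : F)); apply: eq_card => c; rewrite !inE.
apply: (@card_imset_half _ _ _ (fun c : F => - c)) => c c' _ _ /eqP.
by rewrite eqf_sqr => /orP[/eqP->|/eqP->]; [left | right].
Qed.

(** Otherwise [c], [c'] and 1 give three disjoint cosets of the nonzero squares, each with at least
    half of the nonzero elements. *)
Lemma finField_square_trichotomy (c c' : F) : c != 0 -> c' != 0 ->
  [\/ exists s, c = s ^+ 2, exists s, c' = s ^+ 2 | exists s, c / c' = s ^+ 2].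
Proof.
move=> c0 c'0; apply: contrapT => no.
pose A (w : F) := [set w * s | s in sq].
have cA w : w != 0 -> #|A w| = #|sq| by move=> w0; apply: card_imset; apply: mulfI.
have sqn s : s \in sq -> s != 0.
  by move=> /imsetP[r]; rewrite inE => r0 ->; rewrite expf_neq0.
have sub w : w != 0 -> A w \subset [set~ 0].
  move=> w0; apply/fintype.subsetP => _ /imsetP[s /sqn s0 ->].
  by rewrite !inE mulf_neq0.
have disj w w' : w != 0 -> w' != 0 -> (forall s, w / w' != s ^+ 2) -> A w :&: A w' = finset.set0.
  move=> w0 w'0 h; apply/setP => x; rewrite !inE; apply/negP.
  move=> /andP[/imsetP[_ /imsetP[r + ->] ->] /imsetP[_ /imsetP[r' + ->]]].
  rewrite !inE => r0 r'0 e; have /eqP := h (r' / r); apply.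
  apply: (mulIf w'0); apply: (mulIf (expf_neq0 2 r0)); rewrite divfK // e.
  by rewrite expr_div_n mulrAC divfK ?expf_neq0 // mulrC.
have d1 : A c :&: A 1 = finset.set0.
  by apply: disj; rewrite ?oner_neq0 // => s; apply/eqP => e; apply: no; constructor 1; exists s; rewrite -e divr1.
have d2 : A c' :&: A 1 = finset.set0.
  by apply: disj; rewrite ?oner_neq0 // => s; apply/eqP => e; apply: no; constructor 2; exists s; rewrite -e divr1.
have d3 : A c :&: A c' = finset.set0.
  by apply: disj => // s; apply/eqP => e; apply: no; constructor 3; exists s.
have le : (#|A c| + #|A c'| + #|A 1%R| <= #|F|.-1)%N.
  rewrite -cardsUI d3 cards0 addn0 -cardsUI finset.setIUl d1 d2 finset.setU0 cards0 addn0.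
  apply: leq_trans (subset_leq_card (_ : _ \subset [set~ 0])) _.
    by rewrite !finset.subUset !sub ?oner_neq0.
  by rewrite cardsC1.
move: le card_sq; rewrite !cA ?oner_neq0 //.
have : (0 < #|sq|)%N by apply/card_gt0P; exists (1 ^+ 2); apply: imset_f; rewrite inE oner_neq0.
by have := finRing_gt1 F; lia.
Qed.

(** Pigeonhole: the squares [s ^+ 2] and the elements [c + z * r ^+ 2] each make up more than half
    of [F]. *)
Lemma finField_norm_form (z c : F) : z != 0 -> exists s r : F, c = s ^+ 2 - z * r ^+ 2.
Proof.
move=> z0; pose A := [set s ^+ 2 | s : F]; pose B := [set c + z * s | s in A].
have cB : #|B| = #|A| by apply: card_imset => s r /addrI /(mulfI z0).
have cA : (#|sq|.+1 <= #|A|)%N.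
  rewrite -add1n -(cards1 (0 : F)) -cardsUI.
  have -> : [set 0] :&: sq = finset.set0.
    apply/setP => x; rewrite !inE; apply/negP => /andP[/eqP-> /imsetP[r]].
    by rewrite inE => r0 /esym/eqP; rewrite expf_eq0 (negPf r0).
  rewrite cards0 addn0; apply: subset_leq_card; rewrite finset.subUset finset.sub1set.
  apply/andP; split; first by apply/imsetP; exists 0; rewrite // expr0n.
  by apply/fintype.subsetP => _ /imsetP[r _ ->]; apply: imset_f.
have [AB0|[x xAB]] := set_0Vmem (A :&: B).
  exfalso; have := cardsUI A B; rewrite AB0 cards0 addn0 cB.
  have : (#|A :|: B| <= #|F|)%N by apply: max_card.
  have := card_sq; have F1 : (1 < #|F|)%N := finRing_gt1 F.
  by move: cA F1; move: #|A| #|sq| #|F| #|A :|: B| => k1 k2 k3 k4; lia.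
move: xAB; rewrite inE => /andP[/imsetP[s _ ->] /imsetP[_ /imsetP[r _ ->] e]].
by exists s, r; rewrite e addrK.
Qed.

End FiniteFieldSquares.

(** * Finiteness of effective divisors of bounded degree *)

Section EffectiveDivisors.
Variables (F : finFieldType) (K : fieldExtType {fraction {poly F}}).
Hypothesis full : full_constant_field K.
Variables (m : nat) (C : 'I_m -> divisor K) (d : 'I_m -> nat).
Hypothesis smith : Pic0_smith C d.
Implicit Types (D E G : divisor K).

Lemma effective_class_finite (c : Pic K) : exists s : seq (divisor K),
  forall D, effective D -> pic_class D = c -> D \in s.
Proof.
have [G <-] := pic_class_surj c; have [s hs] := RR_finite full smith G.
have /choice[dv hdv] : forall x : K, exists D : divisor K, x != 0 -> is_div D x.
  by move=> x; have [->|/has_divisor[D hD]] := eqVneq x 0; [exists 0 | exists D].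
exists [seq G + dv x | x <- s] => D eD /pic_class_eq[x x0 hx].
apply/mapP; exists x.
  apply: hs => p; rewrite ord_geE // -hx coeffB lerDr; exact: eD.
by apply/eqP/freeg_eqP => p; rewrite coeffD (hdv x x0) -hx coeffB addrC subrK.
Qed.

Lemma effective_finite (n : nat) : exists s : seq (divisor K),
  forall D, effective D -> div_deg D <= n%:Z -> D \in s.
Proof.
have /choice[S hS] := effective_class_finite.
have [sP hsP] := Pic0_finite smith.
have /choice[T hT] : forall k : nat, exists s : seq (divisor K),
    forall D, effective D -> div_deg D = k%:Z -> D \in s.
  move=> k; have [[E dE]|no] := pselect (exists E : divisor K, div_deg E = k%:Z); last first.
    by exists [::] => D _ dD; case: no; exists D.
  exists (flatten [seq S (c + pic_class E) | c <- sP]) => D eD dD.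
  apply/flattenP; exists (S (pic_class D)); last exact: hS.
  apply/mapP; exists (pic_class (D - E)); last by rewrite raddfB /= subrK.
  by apply: hsP; exists (D - E) => //; rewrite raddfB /= dD dE subrr.
exists (flatten [seq T k | k <- iota 0 n.+1]) => D eD dD.
have := div_deg_ge0 eD; case e : (div_deg D) dD => [k|k] // kn _.
apply/flattenP; exists (T k); last exact: hT.
by apply: map_f; rewrite mem_iota.
Qed.

End EffectiveDivisors.

(** * The class group of [K(sqrt lam)], its finiteness and its invariants *)

Section QuadraticClassGroup.
Variables (F : finFieldType) (K : fieldExtType {fraction {poly F}}).
Local Notation cst := (@constK F K).
Local Notation q := #|F|.
Local Notation divisor2 := (divisor K * divisor K)%type.
Implicit Types (p : place K) (x y : K) (z : K * K).
Hypothesis odd_char : 2%N \notin [pchar K].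
Hypothesis full : full_constant_field K.
Variables (m : nat) (C : 'I_m -> divisor K) (d : 'I_m -> nat).
Hypothesis smith : Pic0_smith C d.
Variable lam : K.
Hypothesis lam0 : lam != 0.
Variable H : divisor K.
Hypothesis lam_div : forall p, p lam = coeff p H *+ 2.
Hypothesis lam_nsq : forall y, lam != y ^+ 2.
Variable w : place K -> K * K -> int.
Hypothesis hw : forall p, above lam p (w p).

Local Notation qmul := (quad_mul lam).
Local Notation qnorm := (quad_norm lam).

Let nz z : z != 0 -> qnorm z != 0. Proof. by rewrite qnorm_eq0. Qed.

Definition is_qdiv (D : divisor2) z :=
  forall p, coeff p D.1 = w p z /\ coeff p D.2 = w p (quad_conj z).

Definition qprincipal : {pred divisor2} := fun D => `[< exists2 z, z != 0 & is_qdiv D z >].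

Definition qinv z : K * K := (z.1 / qnorm z, - z.2 / qnorm z).

Lemma qmulV z : z != 0 -> qmul z (qinv z) = (1, 0).
Proof.
move=> /nz; case: z => x y; rewrite /qmul /qinv /quad_norm /= => z0.
by congr pair; field.
Qed.

Lemma qinv_neq0 z : z != 0 -> qinv z != 0.
Proof.
move=> z0; apply: contraTneq (oner_neq0 K) => e.
have := qmulV z0; rewrite e /quad_mul /= !mulr0 !addr0 => -[/eqP].
by rewrite eq_sym => ->.
Qed.

Lemma w_inv p z : z != 0 -> w p (qinv z) = - w p z.
Proof.
move=> z0; have := above_mul (hw p) z0 (qinv_neq0 z0); rewrite qmulV //.
rewrite (above_base (hw p)) ?oner_neq0 // Defs.ord1 => e.
by apply/eqP; rewrite -addr_eq0 addrC -e.
Qed.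

Lemma qconj_inv z : quad_conj (qinv z) = qinv (quad_conj z).
Proof. by rewrite /quad_conj /qinv /quad_norm /= sqrrN !mulNr. Qed.

(** [sqrt lam] has norm [- lam], and its conjugate [- sqrt lam] has the same order. *)
Lemma w_root p : w p (0, 1) = coeff p H /\ w p (0, -1) = coeff p H.
Proof.
have r0 : (0, 1) != 0 :> K * K by rewrite pair_neq0 /= oner_neq0 orbT.
have n0 : (-1, 0) != 0 :> K * K by rewrite pair_neq0 /= oppr_eq0 oner_neq0.
have e : w p (0, -1) = w p (0, 1).
  have := above_mul (hw p) n0 r0; rewrite (above_base (hw p)) ?oppr_eq0 ?oner_neq0 //.
  by rewrite ordN1 add0r /quad_mul /= !mulr0 !mul0r mulr0 !addr0 mulr1 => <-.
have := above_norm (hw p) r0; rewrite /quad_conj /= e /quad_norm /=.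
rewrite expr0n expr1n mulr1 sub0r ordN lam_div !mulr2n => e1.
by split; lia.
Qed.

Lemma w_scaled_root p y : y != 0 -> w p (0, y) = coeff p H + p y.
Proof.
move=> y0; have r0 : (0, 1) != 0 :> K * K by rewrite pair_neq0 /= oner_neq0 orbT.
have y0' : (y, 0) != 0 :> K * K by rewrite pair_neq0 /= y0.
have := above_mul (hw p) r0 y0'; rewrite (above_base (hw p)) // (w_root p).1 => <-.
by rewrite /quad_mul /= !mulr0 !mul0r !addr0 mul1r add0r.
Qed.

Lemma qge_coords p n z : ord_ge p n z.1 -> ord_ge p (n - coeff p H) z.2 -> qge (w p) n z.
Proof.
case: z => x y /= hx hy.
have -> : (x, y) = (x, 0) - (0, - y) by congr pair; rewrite /= ?subr0 // sub0r opprK.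
apply: (above_sub (hw p)); rewrite /qge.
  have [->|x0] := eqVneq x 0; first by rewrite eqxx.
  by rewrite (above_base (hw p)) // -(ord_geE _ _ x0) hx orbT.
have [->|y0] := eqVneq y 0; first by rewrite oppr0 eqxx.
rewrite w_scaled_root ?oppr_eq0 // ordN; apply/orP; right.
by rewrite -lerBlDl -ord_geE.
Qed.

Lemma qge_conj_coords p n z : ord_ge p n z.1 -> ord_ge p (n - coeff p H) z.2 ->
  qge (w p) n (quad_conj z).
Proof. by move=> h1 h2; apply: qge_coords; rewrite //= ord_geN. Qed.

Lemma w_eq0 p z : z != 0 -> ord_ge p 0 z.1 -> ord_ge p (- coeff p H) z.2 ->
  p (qnorm z) = 0 -> w p z = 0 /\ w p (quad_conj z) = 0.
Proof.
move=> z0 h1 h2 pn; have := above_norm (hw p) z0; rewrite pn.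
have := @qge_coords p 0 z h1; have := @qge_conj_coords p 0 z h1; rewrite sub0r /qge.
rewrite (negPf z0) (negPf (qconj_neq0 z0)) /= => /(_ h2) g1 /(_ h2) g2; lia.
Qed.

Lemma qdiv_exists z : z != 0 -> exists D, is_qdiv D z.
Proof.
move=> z0; have supp (x : K) : exists s : seq (place K), forall p, p \notin s -> x != 0 -> p x = 0.
  have [->|x0] := eqVneq x 0; first by exists [::].
  have [s hs] := finite_support x0; exists s => p ps _.
  by apply/eqP; apply: contraNT ps => /hs.
have [s1 h1] := supp z.1; have [s2 h2] := supp z.2.
have [s3 h3] := supp lam; have [s4 h4] := supp (qnorm z).
pose s := s1 ++ s2 ++ s3 ++ s4.
have w0 p : p \notin s -> w p z = 0 /\ w p (quad_conj z) = 0.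
  rewrite !mem_cat !negb_or => /and4P[p1 p2 p3 p4]; apply: w_eq0 => //.
  - have [->|x0] := eqVneq z.1 0; first by rewrite ord_ge0.
    by rewrite ord_geE // h1.
  - have [->|x0] := eqVneq z.2 0; first by rewrite ord_ge0.
    rewrite ord_geE // h2 //; have := h3 p p3 lam0; rewrite lam_div mulr2n; lia.
  - by apply: h4 => //; apply: nz.
have [D1 hD1] : exists D : divisor K, forall p, coeff p D = w p z.
  by apply: (@divisor_of_function _ _ _ s) => p; apply: contraNT => /w0[-> _].
have [D2 hD2] : exists D : divisor K, forall p, coeff p D = w p (quad_conj z).
  by apply: (@divisor_of_function _ _ _ s) => p; apply: contraNT => /w0[_ ->].
by exists (D1, D2) => p /=; rewrite hD1 hD2.
Qed.

Lemma qprincipal_zmod_closed : zmod_closed qprincipal.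
Proof.
split.
  have one0 : (1, 0) != 0 :> K * K by rewrite pair_neq0 /= oner_neq0.
  apply/asboolP; exists (1, 0) => // p /=.
  by rewrite /quad_conj /= oppr0 (above_base (hw p)) ?oner_neq0 // Defs.ord1 coeff0.
move=> D E /asboolP[x x0 hx] /asboolP[y y0 hy]; apply/asboolP.
exists (qmul x (qinv y)); first by rewrite qmul_neq0 // qinv_neq0.
move=> p; have [e1 e2] := hx p; have [e3 e4] := hy p.
rewrite /= !coeffB e1 e2 e3 e4 qconjM qconj_inv.
by rewrite !(above_mul (hw p)) ?w_inv ?qinv_neq0 ?qconj_neq0.
Qed.

HB.instance Definition _ :=
  GRing.isZmodClosed.Build divisor2 qprincipal qprincipal_zmod_closed.

(* Pairs of divisors of [K] modulo the divisors of [K(sqrt lam)], one component for each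
   place above; the classes of actual divisors are singled out by [geom_class]. *)
Definition qPic : zmodType := Quotient.quot qprincipal.

Definition qclass (D : divisor2) : qPic := \pi_qPic D.

Lemma qclass_is_zmod_morphism : zmod_morphism qclass.
Proof. by move=> D E; rewrite /qclass raddfB. Qed.

HB.instance Definition _ :=
  GRing.isZmodMorphism.Build divisor2 qPic qclass qclass_is_zmod_morphism.

Lemma qclass_eq D E : qclass D = qclass E <-> exists2 z, z != 0 & is_qdiv (D - E) z.
Proof.
split; first by move=> /eqP; rewrite /qclass -Quotient.idealrBE => /asboolP.
by move=> h; apply/eqP; rewrite /qclass -Quotient.idealrBE; apply/asboolP.
Qed.

Lemma qclass_repr (a : qPic) : qclass (repr a) = a.
Proof. exact: reprK. Qed.

Definition swap (D : divisor2) : divisor2 := (D.2, D.1).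

Definition qsigma (a : qPic) : qPic := qclass (swap (repr a)).

Lemma qsigmaE D : qsigma (qclass D) = qclass (swap D).
Proof.
have /qclass_eq[z z0 hz] := qclass_repr (qclass D).
apply/qclass_eq; exists (quad_conj z); first exact: qconj_neq0.
by move=> p; have [h1 h2] := hz p; rewrite qconjK.
Qed.

Lemma qsigma_is_zmod_morphism : zmod_morphism qsigma.
Proof.
move=> a b; rewrite -(qclass_repr a) -(qclass_repr b) -raddfB !qsigmaE -raddfB.
by [].
Qed.

HB.instance Definition _ :=
  GRing.isZmodMorphism.Build qPic qPic qsigma qsigma_is_zmod_morphism.

Definition qN (a : qPic) : Pic K := pic_class ((repr a).1 + (repr a).2).

Lemma qNE D : qN (qclass D) = pic_class (D.1 + D.2).
Proof.
have /qclass_eq[z z0 hz] := qclass_repr (qclass D).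
apply/eqP; rewrite /qN -subr_eq0 -raddfB; apply/eqP/pic_class_eq0.
exists (qnorm z); first exact: nz.
move=> p; have [h1 h2] := hz p; rewrite -(above_norm (hw p) z0) -h1 -h2 /= !coeffB !coeffD; ring.
Qed.

Lemma qN_is_zmod_morphism : zmod_morphism qN.
Proof.
move=> a b; rewrite -(qclass_repr a) -(qclass_repr b) -raddfB !qNE -raddfB.
by congr pic_class; rewrite /= opprD addrACA.
Qed.

HB.instance Definition _ := GRing.isZmodMorphism.Build qPic (Pic K) qN qN_is_zmod_morphism.

Definition qj (c : Pic K) : qPic := qclass (repr c, repr c).

Lemma qjE D : qj (pic_class D) = qclass (D, D).
Proof.
have [|x x0 hx] := @pic_class_eq F K (repr (pic_class D)) D; first by rewrite /pic_class reprK.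
apply/qclass_eq; exists (x, 0); first by rewrite pair_neq0 x0.
by move=> p; rewrite /quad_conj /= oppr0 (above_base (hw p)) // -hx.
Qed.

Lemma qj_is_zmod_morphism : zmod_morphism qj.
Proof.
move=> a b; have [D <-] := pic_class_surj a; have [E <-] := pic_class_surj b.
by rewrite -raddfB !qjE -raddfB.
Qed.

HB.instance Definition _ := GRing.isZmodMorphism.Build (Pic K) qPic qj qj_is_zmod_morphism.

Definition pic_deg (c : Pic K) : int := div_deg (repr c).

Lemma pic_degE D : pic_deg (pic_class D) = div_deg D.
Proof.
have [|x x0 hx] := @pic_class_eq F K (repr (pic_class D)) D; first by rewrite /pic_class reprK.
by apply/eqP; rewrite -subr_eq0 -raddfB /= (div_deg_principal full smith x0 hx).
Qed.

Lemma pic_deg_is_zmod_morphism : zmod_morphism pic_deg.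
Proof.
move=> a b; have [D <-] := pic_class_surj a; have [E <-] := pic_class_surj b.
by rewrite -raddfB !pic_degE raddfB.
Qed.

HB.instance Definition _ := GRing.isZmodMorphism.Build (Pic K) int pic_deg pic_deg_is_zmod_morphism.

(* The divisors of [K(sqrt lam)]: a place of [K] that does not split has only one place above it. *)
Definition inert_eq (D : divisor2) := forall p, ~ near_square p lam -> coeff p D.1 = coeff p D.2.

Lemma inert_eqB D E : inert_eq D -> inert_eq E -> inert_eq (D - E).
Proof. by move=> hD hE p ns; rewrite !coeffB hD // hE. Qed.

Definition geom_class (a : qPic) := exists2 D, qclass D = a & inert_eq D.

Definition in_qRR (D : divisor2) z :=
  forall p, qge (w p) (- coeff p D.1) z /\ qge (w p) (- coeff p D.2) (quad_conj z).

Lemma qconjB z z' : quad_conj (z - z') = quad_conj z - quad_conj z'.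
Proof. by rewrite /quad_conj /=; congr pair; rewrite /= opprD. Qed.

Lemma in_qRR_B D z z' : in_qRR D z -> in_qRR D z' -> in_qRR D (z - z').
Proof.
move=> h h' p; have [h1 h2] := h p; have [h3 h4] := h' p.
by rewrite qconjB; split; apply: (above_sub (hw p)).
Qed.

Lemma qge_inert p n z : ~ near_square p lam -> qge (w p) n (quad_conj z) = qge (w p) n z.
Proof.
move=> ns; rewrite /qge (above_inert (hw p) ns); congr orb.
by apply/eqP/eqP => [e|->]; [rewrite -[z]qconjK e | ]; rewrite /quad_conj /= oppr0.
Qed.

(** The analogue of [covers_RR] upstairs, where [div_deg (E.1 + E.2)] is the degree of [E] over
    [F]. *)
Lemma covers_qRR D E n : inert_eq D -> inert_eq E -> effective E.1 -> effective E.2 ->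
  div_deg (E.1 + E.2) = n%:Z -> covers (in_qRR D) (in_qRR (D - E)) (q ^ n).
Proof.
have [k] := ubnP n; elim: k => // k IH in n D E *; move=> nk iD iE eE1 eE2 dE.
have [E0|E0] := eqVneq E 0.
  exists [:: 0]; first by rewrite expn_gt0 (ltn_trans _ (finRing_gt1 F)).
  by move=> x hx; exists 0; rewrite ?mem_head // E0 !subr0.
have step (G : divisor2) (p : place K) :
    (forall p', 0 <= coeff p' G.1 <= coeff p' E.1) ->
    (forall p', 0 <= coeff p' G.2 <= coeff p' E.2) -> inert_eq G ->
    div_deg (G.1 + G.2) = (residue_size lam p)%:Z ->
    covers (in_qRR D) (in_qRR (D - G)) (q ^ residue_size lam p) ->
    covers (in_qRR D) (in_qRR (D - E)) (q ^ n).
  move=> hG1 hG2 iG dG cov.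
  have e1 : effective (E - G).1 by move=> p'; rewrite coeffB subr_ge0; case/andP: (hG1 p').
  have e2 : effective (E - G).2 by move=> p'; rewrite coeffB subr_ge0; case/andP: (hG2 p').
  have dEG : div_deg ((E - G).1 + (E - G).2) = n%:Z - (residue_size lam p)%:Z.
    by rewrite -dE -dG -raddfB; congr div_deg; rewrite /= opprD addrACA.
  have le : (residue_size lam p <= n)%N.
    have := div_deg_ge0 e1; have := div_deg_ge0 e2; move: dEG; rewrite raddfD /=; lia.
  have pos : (0 < residue_size lam p)%N.
    by rewrite /residue_size; have := place_deg_gt0 p; case: asboolP; lia.
  rewrite -(subnKC le) expnD; apply: covers_trans cov _.
  have -> : D - E = D - G - (E - G) by rewrite opprB addrA subrK.
  apply: IH => //; [lia | exact: inert_eqB | exact: inert_eqB |].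
  by rewrite dEG; lia.
have one (p p' : place K) : coeff p' (<< p >> : divisor K) = if p == p' then 1 else 0.
  by rewrite coeffU mul1r; case: eqP.
have le1 (G : divisor K) p : effective G -> 0 < coeff p G ->
    forall p', 0 <= coeff p' (<< p >> : divisor K) <= coeff p' G.
  move=> eG pG p'; rewrite one; case: eqP => [<-|_] /=; last by rewrite ?lexx eG.
  by rewrite ?ler01 -gtz0_ge1.
have le0 (G : divisor K) : effective G -> forall p', 0 <= coeff p' (0 : divisor K) <= coeff p' G.
  by move=> eG p'; rewrite coeff0 lexx eG.
have [p pE] : exists p, (0 < coeff p E.1) || (0 < coeff p E.2).
  apply: contrapT => no; move/eqP: E0; apply; rewrite [E]surjective_pairing.
  have zero (G : divisor K) : effective G -> (forall p, ~~ (0 < coeff p G)) -> G = 0.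
    move=> eG h; apply/eqP/freeg_eqP => p; rewrite coeff0; apply/eqP.
    by rewrite eq_le eG andbT leNgt h.
  have h p : ~~ ((0 < coeff p E.1) || (0 < coeff p E.2)) by apply/negP => h; apply: no; exists p.
  by congr pair; apply: zero => // p; have := h p; rewrite negb_or => /andP[].
(* One place above [p] is removed at a time: a single component if [p] splits, both at once if [p]
   is inert. *)
have [sq|ns] := pselect (near_square p lam).
  have rs : residue_size lam p = place_deg p by rewrite /residue_size; case: asboolP.
  case/orP: pE => pE.
    apply: (step (<< p >>, 0) p); rewrite /= ?addr0 ?rs ?div_degU ?mul1r //.
    - exact: le1.
    - exact: le0.
    - move=> p' ns; rewrite /= one coeff0; case: eqP => // e; by case: ns; rewrite -e.
    have [R [phi [cR hphi]]] := above_covers (hw p) (- coeff p D.1).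
    rewrite -rs -cR; apply: (covers_fin (phi := phi)) => x y hx hy e p'.
    have [h1 h2] := hx p'; have [h3 h4] := hy p'.
    rewrite /= !coeffB coeff0 subr0 one qconjB; split; last exact: (above_sub (hw p')).
    have [ep|_] := eqVneq p p'; last by rewrite /= subr0; apply: (above_sub (hw p')).
    by rewrite /= opprB addrC; subst p'; apply: hphi.
  apply: (step (0, << p >>) p); rewrite /= ?add0r ?rs ?div_degU ?mul1r //.
  - exact: le0.
  - exact: le1.
  - move=> p' ns; rewrite /= one coeff0; case: eqP => // e; by case: ns; rewrite -e.
  have [R [phi [cR hphi]]] := above_covers (hw p) (- coeff p D.2).
  rewrite -rs -cR; apply: (covers_fin (phi := phi \o @quad_conj F K)) => x y hx hy e p'.
  have [h1 h2] := hx p'; have [h3 h4] := hy p'.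
  rewrite /= !coeffB coeff0 subr0 one qconjB; split; first exact: (above_sub (hw p')).
  have [ep|_] := eqVneq p p'; last by rewrite /= subr0; apply: (above_sub (hw p')).
  by rewrite /= opprB addrC; subst p'; apply: hphi.
have rs : residue_size lam p = (2 * place_deg p)%N by rewrite /residue_size; case: asboolP.
have pE12 := iE p ns; have {pE} pE1 : 0 < coeff p E.1 by move: pE; rewrite -pE12 orbb.
apply: (step (<< p >>, << p >>) p); rewrite /= ?rs //.
- exact: le1.
- by apply: le1 => //; rewrite -pE12.
- by rewrite raddfD /= div_degU mul1r -PoszD addnn mul2n.
have [R [phi [cR hphi]]] := above_covers (hw p) (- coeff p D.1).
rewrite -rs -cR; apply: (covers_fin (phi := phi)) => x y hx hy e p'.
have [h1 h2] := hx p'; have [h3 h4] := hy p'.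
rewrite /= !coeffB one qconjB; have [ep|_] := eqVneq p p'; last first.
  by rewrite /= !subr0; split; apply: (above_sub (hw p')).
subst p'; rewrite /= -(iD p ns) !opprB ![1 - _]addrC -qconjB qge_inert //.
by split; apply: hphi.
Qed.


Lemma div_deg_half : div_deg H = 0.
Proof.
have := @div_deg_principal F K full m C d smith lam (H *+ 2) lam0.
rewrite raddfMn /= => h; have /eqP : div_deg H *+ 2 = 0.
  by apply: h => p; rewrite coeffMn lam_div.
by rewrite mulrn_eq0 /= => /eqP.
Qed.

(** The space upstairs contains [L(D) + L(D + H) sqrt lam], and [deg H = 0], so Riemann's inequality
    downstairs applies to both summands. *)
Lemma card_le_qRR_diag (D : divisor K) (k n c : nat) :
  (forall (D : divisor K) k n, card_le (in_RR D) k -> n%:Z + c%:Z <= div_deg D -> (q ^ n <= k)%N) ->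
  card_le (in_qRR (D, D)) k -> n%:Z + c%:Z <= div_deg D -> (q ^ (2 * n) <= k)%N.
Proof.
move=> hc hk hn.
have full_RR (G : divisor K) : div_deg G = div_deg D ->
    exists s : seq K, [/\ uniq s, (forall x, x \in s -> in_RR G x) & (q ^ n <= size s)%N].
  move=> dG; have [s0 hs0] := RR_finite full smith G.
  have [s [us hs]] := finite_of_card_le (card_le_seq hs0).
  exists s; split=> // [x /hs //|]; apply: (hc G); last by rewrite dG.
  by apply: card_le_seq => x /hs.
have [s1 [us1 hs1 sz1]] := full_RR D (erefl _).
have [|s2 [us2 hs2 sz2]] := full_RR (D + H); first by rewrite raddfD /= div_deg_half addr0.
rewrite mul2n -addnn expnD; apply: leq_trans (leq_mul sz1 sz2) _.
rewrite -(size_allpairs pair); apply: hk.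
  by apply: allpairs_uniq => // -[x y] [x' y'] _ _ [-> ->].
move=> _ /allpairsP[[x y] [/= xs ys ->]] p.
have hy : ord_ge p (- coeff p D - coeff p H) y.
  by have := hs2 y ys p; rewrite coeffD opprD.
by split=> /=; [apply: qge_coords | apply: qge_conj_coords] => //; apply: hs1.
Qed.

(** Adding a fixed [(B, B)] of large degree makes every class of degree zero effective, and the
    effective pairs of a given total degree are finitely many. *)
Lemma geom_class_finite : exists s : seq qPic,
  forall a, geom_class a -> pic_deg (qN a) = 0 -> a \in s.
Proof.
have [c hc] := riemann full smith; have [p0 _] := exists_place full.
pose B : divisor K := << c.+1%:Z *g p0 >>.
have dB : c.+1%:Z <= div_deg B.
  rewrite div_degU; have := place_deg_gt0 p0; move: (place_deg p0) => l l0; nia.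
have [nB dnB] : exists nB : nat, div_deg B = nB by exists `|div_deg B|%N; rewrite gez0_abs //; lia.
have [s hs] := effective_finite full smith (2 * nB).
exists [seq qclass ((D1, D2) - (B, B)) | D1 <- s, D2 <- s] => _ [D <- iD].
rewrite qNE pic_degE => dD.
pose M1 := fgpos D.1 + fgpos D.2.
have pos_le (G : divisor K) p : coeff p G <= coeff p (fgpos G).
  by rewrite coeff_fgposE le_max lexx orbT.
have pos_ge0 (G : divisor K) : effective (fgpos G).
  by move=> p; rewrite coeff_fgposE le_max lexx.
have [l dM1] : exists l : nat, div_deg M1 = l.
  exists `|div_deg M1|%N; rewrite gez0_abs //; apply: div_deg_ge0 => p.
  by rewrite coeffD addr_ge0 ?pos_ge0.
pose G : divisor2 := (B, B) + D; pose E : divisor2 := (M1, M1) - D.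
have [z z0 hz] : exists2 z, z != 0 & in_qRR G z.
  apply: contrapT => no.
  have cl : card_le (in_qRR G) 1.
    move=> [|x [|y s']] //= /andP[xs _] h; exfalso; move: xs.
    have z0 z : z \in [:: x, y & s'] -> z = 0.
      by move=> zs; apply/eqP; apply: contraT => z0; exfalso; apply: no; exists z => //; apply: h.
    by rewrite (z0 x) ?mem_head // (z0 y) ?mem_head // !inE eqxx orbT.
  (* [G] is [(B + M1, B + M1)] less the effective [E] of degree [2 * l]. As
     [deg (B + M1) >= l.+1 + c], the larger space has at least [q ^ (2 * l.+1)] elements, too many
     for index [q ^ (2 * l)] over a zero space. *)
  have cov : covers (in_qRR (B + M1, B + M1)) (in_qRR G) (q ^ (2 * l)).
    have -> : G = (B + M1, B + M1) - E.
      by rewrite /G /E [D]surjective_pairing; congr pair; rewrite /= opprB addrA addrAC addrK.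
    apply: covers_qRR => //.
    - by apply: inert_eqB.
    - move=> p; rewrite /= coeffB subr_ge0 coeffD; apply: le_trans (pos_le _ p) _.
      by rewrite lerDl pos_ge0.
    - move=> p; rewrite /= coeffB subr_ge0 coeffD; apply: le_trans (pos_le _ p) _.
      by rewrite lerDr pos_ge0.
    have -> : E.1 + E.2 = M1 *+ 2 - (D.1 + D.2) by rewrite /= mulr2n opprD addrACA.
    by rewrite raddfB raddfMn /= dD dM1 subr0 -mulr_natl natz PoszM.
  have := card_le_covers (@in_qRR_B G) cov cl => /(@card_le_qRR_diag _ _ l.+1 _ hc).
  rewrite muln1 leq_exp2l ?finRing_gt1 // => h.
  suff : (2 * l.+1 <= 2 * l)%N by lia.
  by apply: h; rewrite raddfD /= dM1; move: dB; lia.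
have [Z hZ] := qdiv_exists z0.
have e1 : effective (G.1 + Z.1).
  move=> p; have [h _] := hz p; move: h; rewrite /qge (negPf z0) /= => h.
  by rewrite coeffD (hZ p).1 -lerBlDl sub0r.
have e2 : effective (G.2 + Z.2).
  move=> p; have [_ h] := hz p; move: h; rewrite /qge (negPf (qconj_neq0 z0)) /= => h.
  by rewrite coeffD (hZ p).2 -lerBlDl sub0r.
have dGZ : div_deg (G.1 + Z.1) + div_deg (G.2 + Z.2) = (2 * nB)%N%:Z.
  have dZ : div_deg (Z.1 + Z.2) = 0.
    apply: (div_deg_principal full smith (nz z0)) => p.
    by rewrite coeffD (hZ p).1 (hZ p).2 (above_norm (hw p)).
  rewrite -raddfD /= addrACA raddfD /= dZ addr0 /G /= addrACA raddfD /= dD addr0.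
  by rewrite raddfD /= dnB; lia.
have -> : qclass D = qclass ((G.1 + Z.1, G.2 + Z.2) - (B, B)).
  symmetry; apply/qclass_eq; exists z => // p; have [h1 h2] := hZ p.
  by rewrite -h1 -h2 /G /= !coeffB !coeffD; split; ring.
have d1 := div_deg_ge0 e1; have d2 := div_deg_ge0 e2.
by apply: allpairs_f; apply: hs => //; lia.
Qed.

(** Hilbert 90 for [f / e], with [g] the product of [e] and the conjugate of [e + f], or [sqrt lam]
    if [f = - e]. *)
Lemma hilbert90 f e : f != 0 -> e != 0 -> qnorm f = qnorm e ->
  exists2 g, g != 0 & qmul f g = qmul e (quad_conj g).
Proof.
case: f e => [f1 f2] [e1 e2] f0 e0; rewrite /quad_norm /= => nfe.
have [efz|ef0] := eqVneq ((e1, e2) + (f1, f2) : K * K) 0.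
  exists (0, 1); first by rewrite pair_neq0 /= oner_neq0 orbT.
  have [h1 h2] : e1 + f1 = 0 /\ e2 + f2 = 0 by case: efz.
  have -> : f1 = - e1 by apply/eqP; rewrite -addr_eq0 addrC h1.
  have -> : f2 = - e2 by apply/eqP; rewrite -addr_eq0 addrC h2.
  by rewrite /quad_mul /=; congr pair; ring.
exists (qmul (e1, e2) (quad_conj (e1 + f1, e2 + f2))).
  by rewrite qmul_neq0 // qconj_neq0.
rewrite /quad_mul /=; congr pair.
  apply/eqP; rewrite -subr_eq0; apply/eqP.
  transitivity ((f1 ^+ 2 - lam * f2 ^+ 2 - (e1 ^+ 2 - lam * e2 ^+ 2)) * e1 ); first by ring.
  by rewrite nfe subrr mul0r.
apply/eqP; rewrite -subr_eq0; apply/eqP.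
transitivity ((f1 ^+ 2 - lam * f2 ^+ 2 - (e1 ^+ 2 - lam * e2 ^+ 2)) * e2); first by ring.
by rewrite nfe subrr mul0r.
Qed.

(** Invariance says that [swap D - D] is the divisor of some [f]; all orders of its norm vanish, so
    the norm is a constant. *)
Lemma invariant_class a : geom_class a -> qsigma a = a ->
  exists f : K * K, exists c : F, [/\ f != 0, c != 0, qnorm f = cst c &
    exists2 D, qclass D = a & is_qdiv (swap D - D) f].
Proof.
move=> [D <- iD]; rewrite qsigmaE => /qclass_eq[f f0 hf].
have pn p : p (qnorm f) = 0.
  have [h1 h2] := hf p; rewrite -(above_norm (hw p) f0) -h1 -h2 /= !coeffB; ring.
have [|c hc] := constant_of_no_pole (x := qnorm f) full; first by move=> p; rewrite pn.
exists f, c; split=> //; last by exists D.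
by rewrite -(constK_eq0 K) -hc nz.
Qed.

(** With [g] from Hilbert 90, subtracting the divisor of [g] from [D] makes the two components
    equal, since [e] contributes nothing to the orders. *)
Lemma descend_invariant D f e : f != 0 -> e != 0 -> qnorm f = qnorm e ->
  (forall p, w p e = 0) -> is_qdiv (swap D - D) f -> exists b, qclass D = qj b.
Proof.
move=> f0 e0 nfe we hf; have [g g0 hg] := hilbert90 f0 e0 nfe.
have [G hG] := qdiv_exists g0; exists (pic_class (D.1 - G.1)); rewrite qjE.
apply/qclass_eq; exists g => // p; have [h1 h2] := hG p; have [h3 _] := hf p.
have := above_mul (hw p) f0 g0; rewrite hg (above_mul (hw p)) ?qconj_neq0 // we add0r.
move: h3; rewrite /= !coeffB -h1 -h2 => <- e1.
by split; rewrite ?e1; ring.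
Qed.

(* The places that split generate [Pic K / 2 Pic K], hence the norm is onto. *)
Hypothesis split_gen : forall c : Pic K, exists (D : divisor K) (y : Pic K),
  c = pic_class D + y *+ 2 /\ forall p, coeff p D != 0 -> near_square p lam.

Lemma qN_surj b : exists2 a, geom_class a & qN a = b.
Proof.
have [D [y [-> hD]]] := split_gen b; have [E <-] := pic_class_surj y.
exists (qclass ((D, 0) + (E, E))).
  exists ((D, 0) + (E, E)) => // p ns; rewrite /= !coeffD coeff0; congr (_ + _).
  by apply/eqP; apply: contraT => /hD.
by rewrite qNE /= add0r -addrA raddfD raddfD /= mulr2n.
Qed.

Lemma no_split_quadratic_extension : False.
Proof.
have [sM hsM] := geom_class_finite; have [sP hsP] := Pic0_finite smith.
have A0B a b : geom_class a -> geom_class b -> geom_class (a - b).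
  move=> [D <- iD] [E <- iE]; exists (D - E); first by rewrite raddfB.
  exact: inert_eqB.
have A0s a : geom_class a -> geom_class (qsigma a).
  move=> [D <- iD]; exists (swap D); first by rewrite qsigmaE.
  by move=> p ns; rewrite /= iD.
have A0j b : geom_class (qj b).
  by have [D <-] := pic_class_surj b; exists (D, D) => //; rewrite qjE.
have Ns a : qN (qsigma a) = qN a.
  by rewrite -[a]qclass_repr qsigmaE !qNE /= addrC.
have Nj b : qN (qj b) = b *+ 2.
  by have [D <-] := pic_class_surj b; rewrite qjE qNE /= raddfD.
have sPfin b : pic_deg b = 0 -> b \in sP.
  by have [D <-] := pic_class_surj b; rewrite pic_degE => dD; apply: hsP; exists D.
have dg0 : exists b, pic_deg b != 0.
  have [p _] := exists_place full; exists (pic_class << p >>).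
  by rewrite pic_degE div_degU mul1r eqz_nat -lt0n place_deg_gt0.
(* In a constant extension every nonzero constant is the norm of some [s + (r / y) sqrt lam] without
   zeros or poles, so all invariant classes descend. *)
have [[c [y lamc]]|nconst] := pselect (exists c y, lam = cst c * y ^+ 2).
  apply: (@herbrand_invariants _ _ geom_class qsigma qN qj pic_deg A0B A0s A0j Ns Nj
           qN_surj sM sP hsM sPfin dg0) => a ga sa.
  have [f [c' [f0 c'0 nf [D <- hf]]]] := invariant_class ga sa.
  have cy0 : (cst c != 0) && (y ^+ 2 != 0) by rewrite -negb_or -mulf_eq0 -lamc.
  move: cy0; rewrite constK_eq0 expf_eq0 /= => /andP[c0 y0].
  have [s [r e1]] := finField_norm_form c' c0.
  have ne : qnorm (cst s, cst r / y) = cst c'.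
    rewrite /quad_norm /= lamc e1 (rmorphB cst) (rmorphXn cst) (rmorphM cst) (rmorphXn cst); field.
    exact: y0.
  have e0 : (cst s, cst r / y) != 0 :> K * K by rewrite -(qnorm_eq0 lam_nsq) ne constK_eq0.
  apply: (descend_invariant f0 e0 _ _ hf); first by rewrite nf ne.
  move=> p; apply: (w_eq0 e0 _ _ _).1; rewrite /= ?ne ?ord_constK ?ord_ge_constK //.
  have -> : - coeff p H = 0 + p y^-1.
    have := lam_div p; rewrite lamc ordM ?constK_eq0 ?expf_neq0 // ord_constK ordX // ordV //.
    by rewrite !mulr2n; lia.
  by rewrite ord_ge_mul ?invr_eq0 // ord_ge_constK.
(* The class of [div lam / 2] is nonzero, since [lam] is not a constant times a square, and it
   capitulates as the divisor of [sqrt lam]. *)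
pose tau := pic_class H.
have tau0 : tau != 0.
  apply/eqP => /pic_class_eq0[y y0 hy]; apply: nconst.
  have [|c hc] := constant_of_no_pole (x := lam / y ^+ 2) full.
    move=> p; rewrite ordM ?invr_eq0 ?expf_neq0 // ordV ?expf_neq0 // ordX // lam_div.
    by rewrite hy subrr.
  by exists c, y; rewrite -hc divfK // expf_neq0.
have dtau : pic_deg tau = 0 by rewrite pic_degE div_deg_half.
have jtau : qj tau = 0.
  rewrite qjE -[0](raddf0 qclass); apply/qclass_eq; exists (0, 1).
    by rewrite pair_neq0 /= oner_neq0 orbT.
  by move=> p; rewrite /quad_conj /= !subr0; have [-> ->] := w_root p.
apply: (@herbrand_capitulation _ _ geom_class qsigma qN qj pic_deg A0B A0s A0j Ns Nj
         qN_surj sM sP hsM sPfin dg0 tau tau0 dtau jtau) => a a' ga sa ga' sa'.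
have [f [c [f0 c0 nf [D hD hf]]]] := invariant_class ga sa.
have [f' [c' [f'0 c'0 nf' [D' hD' hf']]]] := invariant_class ga' sa'.
(* Norms that are squares of constants come from the constant [s]. Of two nonzero constants, one or
   the quotient is a square, which gives the three cases of [herbrand_capitulation]. *)
have sqr_desc E (g : K * K) s : g != 0 -> qnorm g = cst (s ^+ 2) -> is_qdiv (swap E - E) g ->
    exists b, qclass E = qj b.
  move=> g0 ng hg; have e0 : (cst s, 0) != 0 :> K * K.
    rewrite pair_neq0 /= eqxx orbF; apply: contra_neq (nz g0) => s0.
    by rewrite ng rmorphXn /= s0 expr0n.
  apply: (descend_invariant g0 e0 _ _ hg).
    by rewrite ng /quad_norm /= expr0n mulr0 subr0 rmorphXn.
  move=> p; rewrite (above_base (hw p)) ?ord_constK //.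
  by move: e0; rewrite pair_neq0 /= eqxx orbF.
have [[s cs]|[s cs]|[s cs]] := finField_square_trichotomy c0 c'0.
- by constructor 1; rewrite -hD; apply: (sqr_desc D f s) => //; rewrite nf cs.
- by constructor 2; rewrite -hD'; apply: (sqr_desc D' f' s) => //; rewrite nf' cs.
constructor 3; rewrite -hD -hD' -raddfB; apply: (sqr_desc _ (qmul f (qinv f')) s).
- by rewrite qmul_neq0 // qinv_neq0.
- have := congr1 qnorm (qmulV f'0); rewrite !qnormM nf nf' -cs => h.
  have c'K : cst c' != 0 by rewrite constK_eq0.
  rewrite fmorph_div; congr (_ * _); apply: (mulfI c'K); rewrite h mulfV //.
  by rewrite /quad_norm /= expr0n mulr0 subr0 expr1n.
move=> p; have [h1 h2] := hf p; have [h3 h4] := hf' p.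
rewrite qconjM qconj_inv !(above_mul (hw p)) ?qinv_neq0 ?qconj_neq0 // !w_inv ?qconj_neq0 //.
by rewrite -h1 -h2 -h3 -h4 /= !coeffB; split; ring.
Qed.

End QuadraticClassGroup.

Theorem square_of_split_places (F : finFieldType) (K : fieldExtType {fraction {poly F}})
    (m : nat) (C : 'I_m -> divisor K) (d : 'I_m -> nat) (lam : K) :
    2%N \notin [pchar K] -> full_constant_field K -> Pic0_smith C d -> singular lam ->
    (forall c : Pic K, exists (D : divisor K) (y : Pic K),
      c = pic_class D + y *+ 2 /\ forall p, coeff p D != 0 -> near_square p lam) ->
  exists y, lam = y ^+ 2.
Proof.
move=> odd_char full smith [lam0 lam_even] gen; apply: contrapT => nsq.
have lam_nsq y : lam != y ^+ 2 by apply/eqP => e; apply: nsq; exists y.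
have even (p : place K) : exists a : int, p lam = a *+ 2.
  exists (p lam %/ 2)%Z; rewrite -mulr_natr; have := lam_even p; lia.
have /choice[h hh] := even.
have [s hs] := finite_support lam0.
have [H hH] : exists H : divisor K, forall p, coeff p H = h p.
  apply: (@divisor_of_function _ _ _ s) => p hp; apply: hs; rewrite hh.
  by rewrite mulrn_eq0.
have /choice[w hw] := above_exists odd_char lam0 even lam_nsq.
apply: (@no_split_quadratic_extension F K odd_char full m C d smith lam lam0 H _ lam_nsq w hw gen).
by move=> p; rewrite hH.
Qed.

(** * The group Pic X / 2 Pic X *)

Section F2Spans.

Lemma F2_cases (e : 'F_2) : e = 0 \/ e = 1.
Proof. by case: e => [[|[|k]] h] //; [left | right]; apply/val_inj. Qed.

Lemma F2_bool (b : bool) : (b%:R : 'F_2) = b :> nat.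
Proof. by case: b. Qed.

Variable V : zmodType.
Hypothesis V2 : forall x : V, x *+ 2 = 0.
Implicit Types (s : seq V) (x y : V).

Definition F2_span s x := exists e : 'I_(size s) -> 'F_2, x = \sum_(i < size s) s`_i *+ e i.

Let F2D x (e e' : 'F_2) : x *+ (e + e')%R = x *+ e + x *+ e'.
Proof.
have [->|->] := F2_cases e; first by rewrite add0r mulr0n add0r.
have [->|->] := F2_cases e'; first by rewrite addr0 mulr0n addr0.
by rewrite -mulrnDr V2.
Qed.

Lemma F2_spanD s x y : F2_span s x -> F2_span s y -> F2_span s (x + y).
Proof.
move=> [e ->] [e' ->]; exists (fun i => e i + e' i).
by rewrite -big_split; apply: eq_bigr => i _; rewrite F2D.
Qed.

Lemma F2_span0 s : F2_span s 0.
Proof. by exists (fun=> 0); rewrite big1. Qed.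

Let V2N x : - x = x.
Proof. by apply/eqP; rewrite eq_sym -addr_eq0 -mulr2n V2. Qed.

Lemma F2_spanMn s x n : F2_span s x -> F2_span s (x *+ n).
Proof.
move=> sx; elim: n => [|n IH]; first exact: F2_span0.
by rewrite mulrS; apply: F2_spanD.
Qed.

Lemma F2_spanMz s x (n : int) : F2_span s x -> F2_span s (x *~ n).
Proof.
case: n => n sx; first by rewrite -pmulrn; apply: F2_spanMn.
by rewrite NegzE mulrNz V2N -pmulrn; apply: F2_spanMn.
Qed.

Lemma F2_span_sum s (I : Type) (r : seq I) (P : pred I) (f : I -> V) :
  (forall i, P i -> F2_span s (f i)) -> F2_span s (\sum_(i <- r | P i) f i).
Proof.
move=> h; elim/big_rec: _ => [|i x Pi sx]; first exact: F2_span0.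
by apply: F2_spanD => //; apply: h.
Qed.

Lemma F2_span_mem s x : x \in s -> F2_span s x.
Proof.
move=> xs; have lt : (index x s < size s)%N by rewrite index_mem.
exists (fun i => if i == Ordinal lt then 1 else 0); rewrite (bigD1 (Ordinal lt)) //.
by rewrite eqxx big1 /= ?nth_index ?addr0 // => i /negPf ->.
Qed.

Lemma F2_span_or_independent s x : F2_independent s ->
  F2_span s x \/ F2_independent (x :: s).
Proof.
move=> is_; have [sx|nx] := pselect (F2_span s x); first by left.
right=> e; rewrite big_ord_recl /= => h.
have [e0|e1] := F2_cases (e ord0).
  move: h; rewrite e0 mulr0n add0r => h i.
  case: (unliftP ord0 i) => [j ->|->] //; exact: (is_ (fun j => e (fintype.lift ord0 j)) h).
exfalso; apply: nx; exists (fun j => e (fintype.lift ord0 j)).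
by move/eqP: h; rewrite e1 mulr1n addr_eq0 => /eqP ->; rewrite V2N.
Qed.

(** The [2 ^ size s] combinations of [s] are distinct, and each is one of the at most [2 ^ size g]
    combinations of [g]. *)
Lemma F2_independent_size s g : F2_independent s -> (forall x, F2_span g x) ->
  (size s <= size g)%N.
Proof.
move=> is_ hg; rewrite -(@leq_exp2l 2) //.
pose val (e : {ffun 'I_(size s) -> 'F_2}) := \sum_(i < size s) s`_i *+ e i.
have /choice[f hf] : forall e, exists f : {ffun 'I_(size g) -> 'F_2}, val e = \sum_(i < size g) g`_i *+ f i.
  move=> e; have [f hf] := hg (val e); exists (finfun f).
  by rewrite hf; apply: eq_bigr => i _; rewrite ffunE.
have finj : injective f.
  move=> e e' ff; apply/ffunP => i; apply/eqP; rewrite -subr_eq0; apply/eqP.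
  apply: (is_ (fun i => e i - e' i)).
  have -> : \sum_(i < size s) s`_i *+ (e i - e' i)%R = val e - val e'.
    rewrite -sumrB; apply: eq_bigr => j _; rewrite F2D.
    by have [->|->] := F2_cases (e' j); rewrite ?oppr0 ?mulr0n ?subr0 ?addr0 // [- (_ *+ _)]V2N.
  by rewrite !hf ff subrr.
have := leq_card f finj; rewrite !card_ffun !card_ord; exact.
Qed.

End F2Spans.

Lemma mod2_double (V : zmodType) (x : mod2 V) : x *+ 2 = 0.
Proof.
have <- : \pi_(mod2 V) (0 : V) = 0 by apply: raddf0.
rewrite -(reprK x) -raddfMn; apply/eqP.
by rewrite -Quotient.idealrBE subr0; apply/asboolP; exists (repr x).
Qed.

Section PicMod2.
Variables (F : finFieldType) (K : fieldExtType {fraction {poly F}}).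
Implicit Types (p : place K) (D E : divisor K).

Lemma pic2_class_is_zmod_morphism : zmod_morphism (@pic2_class K).
Proof. by move=> D E; rewrite /pic2_class -raddfB -raddfB. Qed.

HB.instance Definition _ :=
  GRing.isZmodMorphism.Build (divisor K) (mod2 (Pic K)) (@pic2_class K)
    pic2_class_is_zmod_morphism.

Lemma pic2_class_surj (c : mod2 (Pic K)) : exists D, pic2_class D = c.
Proof.
have [D hD] := pic_class_surj (repr c); exists D.
by rewrite /pic2_class hD reprK.
Qed.

Lemma pic2_class_supported s D :
  (forall p, p \in dom D -> F2_span s (place_pic2_class p)) -> F2_span s (pic2_class D).
Proof.
move=> h; rewrite -[D]freeg_sumE raddf_sum /= big_seq.
apply: F2_span_sum => [|p pD]; first exact: mod2_double.
rewrite -[coeff p D]intz -freegU_mulz raddfMz; apply: F2_spanMz; first exact: mod2_double.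
exact: h.
Qed.

(** Each [D j] is a combination of the places in its support, and a support place outside the span
    of [b] could be added to [b]. *)
Lemma basis_of_maximal n (D : 'I_n -> divisor K) (J : {set 'I_n}) (b : seq (place K)) :
  generates J (fun j => pic2_class (D j)) ->
  maximal_independent_places (supports D J) b -> basis_places b.
Proof.
have V2 := @mod2_double (Pic K).
move=> genJ [bS ib maxb]; split=> // x; have [k ->] := genJ x.
apply: (F2_span_sum V2) => j jJ; apply: (F2_spanMz V2).
apply: pic2_class_supported => p pD.
have [//|ipb] := F2_span_or_independent V2 (place_pic2_class p) ib.
apply: F2_span_mem; apply: map_f; apply: (maxb (p :: b)); last by rewrite mem_head.
- by move=> p' p'b; rewrite inE p'b orbT.
- move=> p'; rewrite inE => /orP[/eqP->|/bS //]; apply/flattenP.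
  by exists (dom (D j)) => //; apply: map_f; rewrite mem_enum.
- exact: ipb.
Qed.

Lemma basis_generates (b : seq (place K)) : basis_places b -> forall c : Pic K,
  exists D y, c = pic_class D + y *+ 2 /\ forall p, coeff p D != 0 -> p \in b.
Proof.
move=> [_ gen] c; have [e he] := gen (\pi_(mod2 (Pic K)) c).
have szb := size_map (@place_pic2_class K) b.
pose D := \sum_i << tnth (in_tuple b) (cast_ord szb i) >> *+ e i : divisor K.
have hD : pic2_class D = \pi_(mod2 (Pic K)) c.
  rewrite he /D raddf_sum; apply: eq_bigr => i _; rewrite raddfMn; congr (_ *+ _).
  by rewrite (tnth_nth (tnth (in_tuple b) (cast_ord szb i))) /= (nth_map (tnth (in_tuple b) (cast_ord szb i))) // -szb.
have : (c - pic_class D) \in doubled (V := Pic K).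
  by rewrite Quotient.idealrBE -hD.
move=> /asboolP[y hy]; exists D, y; split; first by rewrite -hy addrC subrK.
move=> p; apply: contraNT => pb; rewrite /D raddf_sum big1 // => i _.
rewrite /= coeffMn coeffU; case: eqP => [e1|]; last by rewrite mulr0 mul0rn.
by move: pb; rewrite -e1 mem_tnth.
Qed.

End PicMod2.

(** * Singular elements *)

Section SingularElements.
Variables (F : finFieldType) (K : fieldExtType {fraction {poly F}}).
Local Notation cst := (@constK F K).
Implicit Types (p : place K) (x y : K).
Hypothesis odd_char : 2%N \notin [pchar K].

Lemma singular1 : singular (1 : K).
Proof. by split; [apply: oner_neq0 | move=> p; rewrite Defs.ord1]. Qed.

Lemma singularM x y : singular x -> singular y -> singular (x * y).
Proof.
move=> [x0 hx] [y0 hy]; split; first by rewrite mulf_neq0.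
by move=> p; have := hx p; have := hy p; rewrite ordM //; lia.
Qed.

Lemma singularX x n : singular x -> singular (x ^+ n).
Proof.
move=> sx; elim: n => [|n IH]; first exact: singular1.
by rewrite exprS; apply: singularM.
Qed.

Lemma singular_prod n (s : 'I_n -> K) (e : 'I_n -> nat) :
  (forall i, singular (s i)) -> singular (\prod_i s i ^+ e i).
Proof.
move=> h; elim/big_rec: _ => [|i x _]; first exact: singular1.
by apply: singularM; apply: singularX.
Qed.

Lemma singular_constK (c : F) : c != 0 -> singular (cst c).
Proof. by move=> c0; split; rewrite ?constK_eq0 // => p; rewrite ord_constK. Qed.

Lemma nonsquare_sqr p y : y != 0 -> nonsquare p (y ^+ 2) = false.
Proof.
move=> y0; have ey : ~~ odd `|p (y ^+ 2)|%N by rewrite ordX // mulr2n; lia.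
apply/negP => /(nonsquareP odd_char (expf_neq0 2 y0) ey); apply.
exact: near_square_sqr.
Qed.

Lemma nonsquareMs p x y : singular x -> singular y ->
  nonsquare p (x * y) = nonsquare p x (+) nonsquare p y.
Proof. by move=> [x0 hx] [y0 hy]; apply: nonsquareM. Qed.

Lemma nonsquare_prod p n (s : 'I_n -> K) (e : 'I_n -> 'F_2) : (forall i, singular (s i)) ->
  (nonsquare p (\prod_i s i ^+ e i))%:R = \sum_i e i * (nonsquare p (s i))%:R :> 'F_2.
Proof.
move=> hs; have n1 : nonsquare p (1 : K) = false.
  by rewrite -(expr1n K 2) nonsquare_sqr ?oner_neq0.
suff [_ ->] : singular (\prod_i s i ^+ e i) /\
    (nonsquare p (\prod_i s i ^+ e i))%:R = \sum_i e i * (nonsquare p (s i))%:R :> 'F_2 by [].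
elim/big_rec2: _ => [|i x y _ [sy <-]]; first by rewrite n1; split=> //; apply: singular1.
split; first by apply: singularM => //; apply: singularX.
rewrite nonsquareMs //; last exact: singularX.
have [->|->] := F2_cases (e i); first by rewrite expr0 n1 /= mul0r add0r.
rewrite expr1 mul1r; case: (nonsquare p (s i)); case: (nonsquare p y);
  exact/val_inj.
Qed.

Lemma F2_bool_inj : injective (fun b : bool => b%:R : 'F_2).
Proof. by case; case. Qed.

Lemma near_square_nonsquare p x : singular x -> ~~ nonsquare p x -> near_square p x.
Proof. by move=> [x0 hx]; case: (nonsquareP odd_char x0 (hx p)) => // /contrapT. Qed.

(** The symbols at [b] read off the exponents of a product of the [beta], whence independence. For
    spanning, the product prescribed by the symbols of [x] has the same symbols as [x], so their
    product is a square. *)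
Lemma dual_basis r (b : r.-tuple (place K)) (beta : seq K) : size beta = r ->
  (forall i : 'I_r, singular beta`_i) ->
  (forall i j : 'I_r, nonsquare (tnth b j) beta`_i = (i == j)) ->
  (forall x, singular x -> (forall j, ~~ nonsquare (tnth b j) x) -> exists y, x = y ^+ 2) ->
  singular_basis beta.
Proof.
move=> sz; subst r => sing dual key.
have ns (e : 'I_(size beta) -> 'F_2) j :
    (nonsquare (tnth b j) (\prod_(i < size beta) beta`_i ^+ e i))%:R = e j.
  rewrite (nonsquare_prod _ (fun i : 'I_(size beta) => e i)) // (bigD1 j) //= dual eqxx mulr1.
  by rewrite big1 ?addr0 // => i /negPf ij; rewrite dual ij mulr0.
split.
- by move=> i hi; apply: (sing (Ordinal hi)).
- move=> e [z z0 h] j; have := ns e j; rewrite h mul1r nonsquare_sqr //.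
move=> x sx; pose e j : 'F_2 := (nonsquare (tnth b j) x)%:R; exists e.
set y := \prod_(i < _) _; have sy : singular y by apply: singular_prod.
have [|j|z hz] := key (x * y); first exact: singularM.
  rewrite nonsquareMs //; have -> : nonsquare (tnth b j) y = nonsquare (tnth b j) x.
    by apply: F2_bool_inj; rewrite /y ns.
  by rewrite addbb.
have [x0 _] := sx; have [y0 _] := sy.
have z0 : z != 0 by have : x * y != 0 by [rewrite mulf_neq0]; rewrite hz expf_eq0.
exists (z / y); first by rewrite mulf_neq0 ?invr_eq0.
by apply: (mulIf y0); rewrite hz; field.
Qed.

End SingularElements.

(** * The family [alpha] and its symbol matrix *)

Section Subroutine.
Variables (F : finFieldType) (K : fieldExtType {fraction {poly F}}).
Local Notation cst := (@constK F K).
Implicit Types (p : place K) (x y : K).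
Hypothesis odd_char : 2%N \notin [pchar K].
Hypothesis full : full_constant_field K.
Variables (zeta : F) (m : nat) (C : 'I_m -> divisor K) (d : 'I_m -> nat).
Hypothesis zeta_neq0 : zeta != 0.
Hypothesis zeta_nsq : forall y : F, zeta != y ^+ 2.
Hypothesis smith : Pic0_smith C d.
Variable a : 'I_m -> K.
Hypothesis a_RR : forall i, ~~ odd (d i) ->
  a i != 0 /\ riemann_roch_space (C i *+ d i) (a i).

Let alpha := even_family zeta d a.
Let evens := [seq i <- enum 'I_m | ~~ odd (d i)].

Let d_gt0 i : (0 < d i)%N.
Proof. by have [_ ho _] := smith; have [] := ho i. Qed.

Lemma div_deg_C i : div_deg (C i) = 0.
Proof.
have [[h _ _] _ _] := smith; have [D dD hD] := h i.
have [x x0 hx] := pic_class_eq hD; have := div_deg_principal full smith x0 hx.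
by rewrite raddfB /= dD sub0r => /eqP; rewrite oppr_eq0 => /eqP.
Qed.

(** Membership in the Riemann-Roch space makes [C i *+ d i] plus the divisor of [a i] effective; its
    degree is 0, so it vanishes. *)
Lemma ord_a i p : ~~ odd (d i) -> p (a i) = - (coeff p (C i) *+ d i).
Proof.
move=> ev; have [ai0 [/eqP|[_ h]]] := a_RR ev; first by rewrite (negPf ai0).
have [A hA] := has_divisor ai0.
have E0 : C i *+ d i + A = 0.
  apply: effective_deg0 => [p'|].
    by rewrite coeffD hA -lerBlDl sub0r.
  by rewrite raddfD raddfMn /= div_deg_C mul0rn add0r (div_deg_principal full smith ai0 hA).
have := congr1 (coeff p) E0; rewrite coeffD coeffMn hA coeff0 => /eqP.
by rewrite addrC addr_eq0 => /eqP.
Qed.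

Lemma alpha_singular x : x \in alpha -> singular x.
Proof.
rewrite inE => /orP[/eqP->|/mapP[i]]; first exact: singular_constK.
rewrite mem_filter => /andP[ev _] ->; have [ai0 _] := a_RR ev; split=> // p.
by rewrite ord_a // abszN -mulr_natr natz abszM oddM negb_and ev orbT.
Qed.

Lemma prod_map_index (T : eqType) (s : seq T) (f : T -> K) (g : nat -> nat) : uniq s ->
  \prod_(j < size (map f s)) (map f s)`_j ^+ g j = \prod_(x <- s) f x ^+ g (index x s).
Proof.
elim: s g => [|x s IH] g /=; first by rewrite big_ord0 big_nil.
move=> /andP[xs us]; rewrite big_ord_recl big_cons eqxx /=; congr (_ * _).
rewrite (IH (fun j => g j.+1) us) !big_seq; apply: eq_bigr => y ys.
by case: eqP => // e; move: xs; rewrite e ys.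
Qed.

(** Halving the divisor of a product equal to [z ^+ 2] gives a relation among the classes of the
    [C i] with coefficients 0 or [d i / 2]. By directness each term vanishes, which the order [d i]
    allows only for coefficient 0. What remains is [zeta], which is not the square of a constant. *)
Lemma alpha_independent n (e : 'I_n -> 'F_2) : n = size alpha ->
  (exists z : K, \prod_(i < n) alpha`_i ^+ e i = z ^+ 2) -> forall i, e i = 0.
Proof.
move=> sz; subst n; move: e; rewrite /alpha /even_family /= -/evens => e [z].
have us : uniq evens by rewrite filter_uniq ?enum_uniq.
rewrite big_ord_recl /=.
(* Exponents extended by 0 to all naturals, so that the product over positions can be turned into
   one over the indices in [evens]. *)
pose ee (j : nat) : 'F_2 := if insub j is Some o then e (fintype.lift ord0 o) else 0.
have eeE (o : 'I_(size [seq a i | i <- evens])) : e (fintype.lift ord0 o) = ee o.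
  by rewrite /ee valK.
under eq_bigr => o _ do rewrite eeE.
rewrite (prod_map_index a (fun j => ee j) us) => hz.
have ev i : i \in evens -> ~~ odd (d i) by rewrite mem_filter => /andP[].
have a0 i : i \in evens -> a i != 0 by move=> /ev/a_RR[].
have P0 : \prod_(i <- evens) a i ^+ ee (index i evens) != 0.
  by rewrite big_seq prodf_seq_neq0; apply/allP => i ie; rewrite ie expf_neq0 // a0.
have z0 : z != 0.
  have : z ^+ 2 != 0 by rewrite -hz mulf_neq0 // expf_neq0 // constK_eq0.
  by rewrite expf_eq0.
have [Z hZ] := has_divisor z0.
pose G := \sum_(i <- evens) C i *+ (ee (index i evens) * (d i)./2) + Z.
have ordP p : p (\prod_(i <- evens) a i ^+ ee (index i evens)) =
    - \sum_(i <- evens) coeff p (C i) *+ (ee (index i evens) * d i).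
  rewrite -sumrN; suff gen s : {subset s <= evens} ->
      p (\prod_(i <- s) a i ^+ ee (index i evens)) =
      \sum_(i <- s) - (coeff p (C i) *+ (ee (index i evens) * d i)) by apply: gen.
  elim: s => [_|i s IH sub]; first by rewrite !big_nil Defs.ord1.
  have ie : i \in evens by apply: sub; rewrite mem_head.
  have sub' : {subset s <= evens} by move=> j js; apply: sub; rewrite inE js orbT.
  rewrite !big_cons ordM ?IH ?expf_neq0 ?a0 //.
    by congr (_ + _); rewrite ordX ?a0 // ord_a ?ev // mulNrn -mulrnA mulnC.
  by rewrite big_seq prodf_seq_neq0; apply/allP => j js; rewrite js expf_neq0 // a0 // sub'.
have G0 : G = 0.
  apply/eqP/freeg_eqP => p; rewrite coeff0 /G coeffD hZ raddf_sum /=.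
  under eq_bigr => i _ do rewrite coeffMn.
  have := congr1 p hz; rewrite ordM ?expf_neq0 ?constK_eq0 // -(rmorphXn cst) ord_constK add0r.
  rewrite ordP ordX // => h; have : (\sum_(i <- evens) coeff p (C i) *+
      (ee (index i evens) * (d i)./2) + p z) *+ 2 = 0.
    rewrite mulrnDl -h -sumrMnl; apply/eqP; rewrite subr_eq0; apply/eqP.
    rewrite !big_seq; apply: eq_bigr => i /ev di; rewrite -mulrnA -mulnA muln2.
    by rewrite even_halfK.
  by move/eqP; rewrite mulrn_eq0 /= => /eqP.
have rel : \sum_(i <- evens) pic_class (C i) *+ (ee (index i evens) * (d i)./2) = 0.
  have : pic_class G = 0 by rewrite G0 raddf0.
  rewrite raddfD /= (pic_class_eq0 Z).2; last by exists z.
  rewrite addr0 raddf_sum /= => h; rewrite -[RHS]h.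
  by apply: eq_bigr => i _; rewrite raddfMn.
have [[_ _ direct] ho _] := smith.
pose k i : int := if ~~ odd (d i) then (ee (index i evens) * (d i)./2)%N else 0%N.
have kappa0 i : i \in evens -> ee (index i evens) = 0.
  move=> ie; have rel' : \sum_i pic_class (C i) *~ k i = 0.
    rewrite -[RHS]rel /evens big_filter big_enum_cond /= [RHS]big_mkcond /=; apply: eq_bigr => j _.
    by rewrite /k; case: ifP => _; rewrite -pmulrn.
  have := direct k rel' i; rewrite /k (ev i ie) -pmulrn => /(ho i).2.
  have [//|->] := F2_cases (ee (index i evens)); rewrite mul1n => /dvdn_leq.
  have := d_gt0 i; have := even_halfK (ev i ie); lia.
have ee0 (o : 'I_(size [seq a i | i <- evens])) : e (fintype.lift ord0 o) = 0.
  have lt : (o < size evens)%N by rewrite -(size_map a) ltn_ord.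
  have [i0 _] : exists i0, i0 \in evens.
    have : (0 < size evens)%N by apply: leq_ltn_trans lt.
    by case: (evens) => // i0 s0 _; exists i0; rewrite mem_head.
  rewrite eeE.
  have := kappa0 (nth i0 evens o) (mem_nth _ lt).
  by rewrite index_uniq.
move=> i; case: (unliftP ord0 i) => [o ->|->]; first exact: ee0.
have [//|e1] := F2_cases (e ord0).
have [c hc] : exists c, z = cst c.
  apply: (constant_of_no_pole full) => p; have := congr1 p hz.
  rewrite ordM ?expf_neq0 ?constK_eq0 // -(rmorphXn cst) ord_constK add0r ordP big_seq big1.
    by rewrite ordX // mulr2n; lia.
  by move=> j je; rewrite kappa0.
have := zeta_nsq c; rewrite -(inj_eq (fmorph_inj cst)) rmorphXn /= -hc -hz e1 expr1.
by rewrite big_seq big1 ?mulr1 ?eqxx // => j je; rewrite kappa0.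
Qed.

Variables (r : nat) (b : r.-tuple (place K)).
Hypothesis b_basis : basis_places b.

Lemma square_of_symbols x : singular x -> (forall j, ~~ nonsquare (tnth b j) x) ->
  exists y, x = y ^+ 2.
Proof.
move=> sx h; apply: (square_of_split_places odd_char full smith sx) => c.
have [D [y [-> hD]]] := basis_generates b_basis c; exists D, y; split=> // p /hD pb.
apply: near_square_nonsquare => //.
by have /tnthP[j ->] := pb; apply: h.
Qed.

(** A vanishing combination of rows is a product of the [alpha] with trivial symbols at [b], hence a
    square, hence a trivial combination. *)
Lemma symbols_row_free n : n = size alpha ->
  row_free (\matrix_(i < n, j < r) (nonsquare (tnth b j) alpha`_i)%:R : 'M['F_2]_(n, r)).
Proof.
move=> sz; apply: inj_row_free => v hv; apply/rowP => i; rewrite mxE.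
apply: (alpha_independent (e := fun i => v 0 i) sz).
have sing (l : 'I_n) : singular alpha`_l by apply: alpha_singular; rewrite mem_nth // -sz.
apply: square_of_symbols; first exact: singular_prod.
move=> j; have := nonsquare_prod odd_char (tnth b j) (fun i => v 0 i) sing.
have := congr1 (fun M : 'rV_r => M 0 j) hv; rewrite !mxE => e1.
have -> : \sum_i v 0 i * (nonsquare (tnth b j) alpha`_i)%:R = 0 :> 'F_2.
  by rewrite -[RHS]e1; apply: eq_bigr => k _; rewrite mxE.
by case: nonsquare.
Qed.

(** The degrees form a nonzero subgroup of the integers, and [D0] realizes its smallest positive
    element. *)
Lemma degree_generator : exists D0 : divisor K, forall D : divisor K, exists k : int,
  div_deg D = div_deg D0 * k.
Proof.
have ex : exists l : nat, (0 < l)%N && `[< exists D : divisor K, div_deg D = l%:Z >].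
  have [p _] := exists_place full; exists (place_deg p); rewrite place_deg_gt0.
  by apply/asboolP; exists << p >>; rewrite div_degU mul1r.
case: (ex_minnP ex) => l /andP[l0 /asboolP[D0 dD0]] minl; exists D0 => D.
exists (div_deg D %/ l)%Z; rewrite dD0.
have md : div_deg (D - D0 *~ (div_deg D %/ l)%Z) = (div_deg D %% l)%Z.
  rewrite raddfB raddfMz /= dD0 {1}(divz_eq (div_deg D) l) -mulrzr intz mulrC; ring.
have m0 : 0 <= (div_deg D %% l)%Z by rewrite modz_ge0 // eqz_nat -lt0n.
have ml : (div_deg D %% l)%Z < l by rewrite ltz_pmod.
have [z0|nz] := eqVneq (div_deg D %% l)%Z 0.
  by rewrite {1}(divz_eq (div_deg D) l) z0 addr0 mulrC.
have := minl `|(div_deg D %% l)%Z|%N; rewrite absz_gt0 nz /=.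
have -> : `[< exists D' : divisor K, div_deg D' = `|(div_deg D %% l)%Z|%N%:Z >].
  by apply/asboolP; eexists; rewrite gez0_abs //; apply: md.
by move=> /(_ isT); lia.
Qed.

(** At most [r], because [r] columns bound the number of independent rows. At least [r], because
    [D0] generates [Pic] modulo [Pic^0], so that [D0] and the [C i] of even order span the quotient
    by doubles. *)
Lemma size_alpha : size alpha = r.
Proof.
have V2 := @mod2_double (Pic K).
apply/eqP; rewrite eqn_leq; apply/andP; split.
  by have /eqP <- := symbols_row_free (erefl (size alpha)); apply: rank_leq_col.
have [ib _] := b_basis; have [D0 hD0] := degree_generator.
have -> : r = size (map (@place_pic2_class K) b) by rewrite size_map size_tuple.
have -> : size alpha = size (pic2_class D0 :: [seq pic2_class (C i) | i <- evens]).
  by rewrite /alpha /even_family /= !size_map.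
apply: (F2_independent_size V2) => // c; have [D <-] := pic2_class_surj c.
set g := _ :: _; have [k hk] := hD0 D.
have [[_ gen _] ho _] := smith.
have [|h eh] := gen (pic_class (D - D0 *~ k)).
  by exists (D - D0 *~ k) => //; rewrite raddfB raddfMz /= hk -mulrzr intz subrr.
have -> : pic2_class D = pic2_class D0 *~ k + \sum_i pic2_class (C i) *~ h i.
  have -> : D = D0 *~ k + (D - D0 *~ k) by rewrite addrC subrK.
  rewrite raddfD raddfMz /=; congr (_ + _); rewrite /pic2_class eh raddf_sum.
  by apply: eq_bigr => i _; rewrite raddfMz.
apply: (F2_spanD V2).
  by apply: (F2_spanMz V2); apply: F2_span_mem; rewrite mem_head.
apply: (F2_span_sum V2) => i _; apply: (F2_spanMz V2).
(* A class of odd order is twice another class. *)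
have [od|ev] := boolP (odd (d i)); last first.
  apply: F2_span_mem; rewrite inE; apply/orP; right; apply: map_f.
  by rewrite mem_filter ev mem_enum.
suff -> : pic2_class (C i) = 0 by apply: F2_span0.
have : pic_class (C i) *+ d i = 0 by apply/(ho i).2.
rewrite -[d i]odd_double_half od add1n mulrS => /eqP; rewrite addr_eq0 => /eqP e1.
rewrite /pic2_class e1 raddfN raddfMn /= -mul2n mulrnA V2 mul0rn oppr0 //.
Qed.

End Subroutine.

Theorem mainTheorem2 (F : finFieldType) (K : fieldExtType {fraction {poly F}})
    (odd_char : 2%N \notin [pchar K])
    (full_const : full_constant_field K)
    (* steps 1 and 2 *)
    (n : nat) (D : 'I_n -> divisor K)
    (D_gen : generates [set: 'I_n]%SET (fun i => pic_class (D i)))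
    (J : {set 'I_n})
    (J_gen : generates J (fun j => pic2_class (D j)))
    (* steps 3 and 4 *)
    (r : nat) (b : r.-tuple (place K))
    (b_max : maximal_independent_places (supports D J) b)
    (* step 5: the choices made by the subroutine *)
    (zeta : F) (zeta_neq0 : zeta != 0) (zeta_nsq : forall y : F, zeta != y ^+ 2)
    (m : nat) (C : 'I_m -> divisor K) (d : 'I_m -> nat)
    (C_smith : Pic0_smith C d)
    (a : 'I_m -> K)
    (a_RR : forall i, ~~ odd (d i) ->
      a i != 0 /\ riemann_roch_space (C i *+ d i) (a i)) :
  let alpha := even_family zeta d a in
  let eps := symbol_matrix alpha b in
  let beta := dual_family alpha b in
  (* the subroutine applies to b and is well defined *)
  (basis_places b /\ size alpha = r /\
   (forall i j : 'I_r, (-1) ^+ eps i j = symbol alpha`_i (tnth b j)) /\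
   eps \in unitmx) /\
  (* its output is compatible with b and is a basis of the singular elements *)
  compatible b beta /\ singular_basis beta.
Proof.
move=> alpha eps beta.
have b_basis : basis_places b by apply: basis_of_maximal J_gen b_max.
have sz : size alpha = r.
  exact: (size_alpha odd_char full_const zeta_neq0 zeta_nsq C_smith a_RR b_basis).
have sing (i : 'I_r) : singular alpha`_i.
  apply: (alpha_singular full_const zeta_neq0 C_smith a_RR).
  by rewrite mem_nth // -/alpha sz.
have epsE : eps = \matrix_(i < r, j < r) (nonsquare (tnth b j) alpha`_i)%:R.
  by apply/matrixP => i j; rewrite !mxE.
have eps_unit : eps \in unitmx.
  rewrite -row_free_unit epsE.
  exact: (symbols_row_free odd_char full_const zeta_neq0 zeta_nsq C_smith a_RR b_basis (esym sz)).
have beta_sing (i : 'I_r) : singular beta`_i.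
  by rewrite -tnth_nth tnth_mktuple; apply: singular_prod.
(* The exponents of [beta] are the rows of the inverse of [eps], so its symbols are the entries of
   [invmx eps *m eps]. *)
have dual (i j : 'I_r) : nonsquare (tnth b j) beta`_i = (i == j).
  apply: F2_bool_inj; rewrite -tnth_nth tnth_mktuple nonsquare_prod //.
  have := congr1 (fun M : 'M_r => M i j) (mulVmx eps_unit); rewrite !mxE => <-.
  by apply: eq_bigr => k _; rewrite epsE !mxE.
split; first split=> //.
  split=> //; split=> // i j; have [_ ev] := sing i.
  by rewrite (symbolE (ev _)) epsE mxE F2_bool.
split.
  split=> [i|i j ij]; rewrite (tnth_nth 0) symbolE ?dual ?eqxx ?(negPf ij) //;
    by have [_ ev] := beta_sing i; apply: ev.
apply: (@dual_basis _ _ odd_char r b) => //; first by rewrite size_tuple.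
by move=> x; apply: (square_of_symbols odd_char full_const C_smith b_basis).
Qed.
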